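(* Reflected random walk $(X_n^x)$ is (topologically) recurrent on its essential class(es), if (a) $\mathsf{E}(Y_1^-)<\mathsf{E}(Y_1^+)$ and $\mathsf{E}\bigl(\sqrt{Y_1^+}\,\bigr)<\infty$, or if (b) $0<\mathsf{E}(Y_1^-)=\mathsf{E}(Y_1^+)$ and $\mathsf{E}\Bigl(\sqrt{Y_1^+}^{\,3}\Bigr)<\infty$.
   Context: Let $(Y_n)_{n\ge1}$ be i.i.d. real random variables (of arbitrary sign) with common distribution $\mu$, and let $Y_n^+=\max\{Y_n,0\}$, $Y_n^-=\max\{-Y_n,0\}$. In (a), $\mathsf{E}(Y_1^+)=\infty$ is allowed. Reflected random walk started at $x\ge0$ is $X_0^x=x$, $X_{n+1}^x=|X_n^x-Y_{n+1}|$. One of the following two cases is assumed. Lattice case: $\operatorname{supp}(\mu)\subset\mathbb{Z}$ and the group generated by $\operatorname{supp}(\mu)$ is $\mathbb{Z}$. Then $(X_n^x)$ evolves in the denumerable set $\{k\pm x:k\in\mathbb{Z}\}\cap[0,\infty)$. An essential class is a subset of the state space which is irreducible and absorbing, i.e. for $u$ in the class, a state $v$ can be reached from $u$ with positive probability if and only if $v$ is in the class. Recurrence on an essential class is recurrence in the usual sense of irreducible denumerable Markov chains. Non-lattice case: the closed group generated by $\operatorname{supp}(\mu)$ is $\mathbb{R}$. The essential class is $C=[0,\infty)$, except that, if $Y_1\ge0$ almost surely and $N=\sup\operatorname{supp}(\mu)<\infty$, it is $C=[0,N]$. Topological recurrence on $C$ means that for every starting point $x\in C$, with probability $1$, the sequence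 $(X_n^x)$ visits every open set that intersects $C$ infinitely often. *)

(* Defs.v *)
From HB Require Import structures.
From mathcomp Require Import all_boot all_order all_algebra finmap.
From mathcomp Require Import all_classical all_reals all_analysis.

Set Implicit Arguments.
Unset Strict Implicit.
Unset Printing Implicit Defensive.

Import Order.TTheory GRing.Theory Num.Theory.
Import numFieldNormedType.Exports.

Local Open Scope classical_set_scope.
Local Open Scope ring_scope.

Section laws_on_the_line.
Context {R : realType}.

Definition mutually_independent d (T : measurableType d) (P : probability T R)
    (Y : nat -> {RV P >-> R}) :=
  forall (J : {fset nat}) (A : nat -> set R),
    (forall n, measurable (A n)) ->
    P (\bigcap_(n in [set` J]) (Y n @^-1` A n)) =
    (\prod_(n <- J) P (Y n @^-1` A n))%E.

Definition common_distribution d (T : measurableType d) (P : probability T R)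
    (Y : nat -> {RV P >-> R}) (mu : probability R R) :=
  forall n (A : set R), measurable A -> distribution P (Y n) A = mu A.

(* The closed support: points all of whose open neighbourhoods are charged. *)
Definition supp (mu : probability R R) : set R :=
  [set y | forall U : set R, open U -> U y -> (0 < mu U)%E].

Definition additive_subgroup (H : set R) :=
  H 0 /\ forall x y, H x -> H y -> H (x - y).

Definition generated_group (A : set R) : set R := smallest additive_subgroup A.

Definition generated_closed_group (A : set R) : set R :=
  smallest (fun H => additive_subgroup H /\ closed H) A.

Definition integers : set R := range (fun k : int => k%:~R).

Definition lattice_case (mu : probability R R) :=
  supp mu `<=` integers /\ generated_group (supp mu) = integers.

Definition nonlattice_case (mu : probability R R) :=
  generated_closed_group (supp mu) = setT.

End laws_on_the_line.

Arguments mutually_independent {R d T} P Y.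
Arguments common_distribution {R d T} P Y mu.

Section reflected_random_walk.
Context {d : measure_display} {T : measurableType d} {R : realType}.
Variables (P : probability T R) (Y : nat -> {RV P >-> R}).

(* [Y n] is the increment of the step from time [n] to time [n.+1], i.e. the
   variable traditionally written Y_{n+1}. *)
Fixpoint reflected_walk (x : R) (n : nat) (t : T) : R :=
  if n is m.+1 then `|reflected_walk x m t - Y m t| else x.

Definition lattice_states (x : R) : set R :=
  [set u | 0 <= u /\ exists k : int, u = k%:~R + x \/ u = k%:~R - x].

Definition reachable (u v : R) :=
  exists n, (0 < P [set t | reflected_walk u n t = v])%E.

Definition essential_class (x : R) (C : set R) :=
  C `<=` lattice_states x /\
  forall u v, C u -> lattice_states x v -> (reachable u v <-> C v).

Definition recurrent_on (C : set R) :=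
  forall u, C u -> P [set t | exists n, reflected_walk u n.+1 t = u] = 1%E.

(* The test on [has_ubound] is N < +oo: real-valued [sup] is meaningless on a
   set that is not bounded above. *)
Definition nonlattice_class (mu : probability R R) : set R :=
  if `[< {ae P, forall t, 0 <= Y 0%N t} /\ has_ubound (supp mu) >]
  then `[0, sup (supp mu)]%classic else `[0, +oo[%classic.

Definition topologically_recurrent_on (C : set R) :=
  forall x, C x ->
    {ae P, forall t, forall U : set R, open U -> U `&` C !=set0 ->
      infinite_set [set n | U (reflected_walk x n t)]}.

End reflected_random_walk.

Arguments reachable {d T R} P Y u v.
Arguments essential_class {d T R} P Y x C.
Arguments recurrent_on {d T R} P Y C.
Arguments nonlattice_class {d T R} P Y mu _.
Arguments topologically_recurrent_on {d T R} P Y C.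

(* Main.v *)
(* Let S_n = Y_1 + ... + Y_n and let H be the first strict ascending ladder height of (S_n). Under
   either moment assumption H > 0 almost surely and E(sqrt H) < oo. With positive drift, the ladder
   epoch has finite expectation, by a supersolution M + x^+ for the walk x - S_n killed on ]-oo, 0[. With
   zero drift, time reversal bounds the potential of the walk before the ladder epoch by the renewal
   measure of the record minima, and the 3/2-th moment of Y_1^+ makes the resulting sum finite.

   Reflected walk with increments distributed as H, observed at its times of reflection, has the
   invariant density r(z) = P(H >= z, H' >= H - z), H' an independent copy of H. Its mass is
   E min(H, H') <= (E sqrt H)^2 < oo. Starting at the first ladder epoch and comparing with r, the
   probability that the walk is below L infinitely often, which does not depend on the starting point
   because the walk is contractive, is seen to tend to 1 as L grows: the walk does not escape to
   infinity.

   So the walk returns infinitely often to some bounded part of C, from which any given state, or open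
   set, is hit within a bounded time with probability bounded below. In the lattice case this holds
   because bounded parts of C are finite. In the non-lattice case contractivity reduces it to finitely
   many starting points, and to reachability along steps in supp(mu). If supp(mu) is nonnegative, a
   large N in supp(mu) is used to reverse the other steps: up to sign and modulo 2N, the walk can move
   by any element of the group generated by supp(mu). If supp(mu) has elements of both signs, the
   semigroup generated by -supp(mu) is dense and the upward steps are taken first. *)

Require Import Defs.
From HB Require Import structures.
From mathcomp Require Import all_boot all_order all_algebra finmap.
From mathcomp Require Import all_classical all_reals all_analysis.
From mathcomp Require Import measurable_realfun ring lra zify.

Set Implicit Arguments.
Unset Strict Implicit.
Unset Printing Implicit Defensive.

Import Order.TTheory GRing.Theory Num.Theory.
Import numFieldNormedType.Exports.

Local Open Scope classical_set_scope.
Local Open Scope ring_scope.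

(** * Integrals of nonnegative measurable functions *)

(** Stopping times never appear. What happens before the ladder epoch is expressed by two positive
    operators, [down] (a step that keeps the killed walk nonnegative) and [up] (the step that
    overshoots). Expectations at the ladder epoch are bounded through supersolutions,
    [up g + down phi <= phi], by induction on the first increment. Independence enters only through
    [first_step].

    Inequalities suffice: invariance of the density is used only to see that the averaged
    probability of being below [L] at some time after [m] does not drop as [m] grows, the reverse
    being trivial. Finite mass matters because starting points above [L] then carry little of it.

    Under zero drift, [H > 0] almost surely needs an argument of its own. The bound by record minima
    controls the time spent by the killed walk at heights up to [K], at a cost linear in [K].
    Heights above [K] are rare because the mean height grows sublinearly, which is read off the
    convex function [sqrt(z^2 + L^2)] without a second moment. Taking [K] to be a small multiple of
    the time balances the two. *)

Definition nnm {d} {T : measurableType d} {R : realType} (f : T -> \bar R) :=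
  measurable_fun [set: T] f /\ forall x, (0 <= f x)%E.

Section nnm_theory.
Context {d d'} {T : measurableType d} {T' : measurableType d'} {R : realType}.
Local Open Scope ereal_scope.

Lemma nnm_cst (c : \bar R) : 0 <= c -> nnm (fun _ : T => c).
Proof. by move=> c0; split => //; exact: measurable_cst. Qed.

Lemma nnmD (f g : T -> \bar R) : nnm f -> nnm g -> nnm (fun x => f x + g x).
Proof.
move=> [mf f0] [mg g0]; split; first exact: emeasurable_funD.
by move=> x; exact: adde_ge0.
Qed.

Lemma nnmM (f g : T -> \bar R) : nnm f -> nnm g -> nnm (fun x => f x * g x).
Proof.
move=> [mf f0] [mg g0]; split; first exact: emeasurable_funM.
by move=> x; exact: mule_ge0.
Qed.

Lemma nnm_if (b : T -> bool) (f g : T -> \bar R) : measurable_fun [set: T] b ->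
  nnm f -> nnm g -> nnm (fun x => if b x then f x else g x).
Proof.
move=> mb [mf f0] [mg g0]; split; first exact: measurable_fun_ifT.
by move=> x; case: ifP.
Qed.

Lemma nnm_comp (f : T' -> \bar R) (h : T -> T') : measurable_fun [set: T] h ->
  nnm f -> nnm (fun x => f (h x)).
Proof. by move=> mh [mf f0]; split => //; exact: measurableT_comp. Qed.

Lemma nnm_sum (f : nat -> T -> \bar R) n : (forall k, nnm (f k)) ->
  nnm (fun x => \sum_(k < n) f k x).
Proof.
move=> nf; split; last by move=> x; apply: sume_ge0 => k _; exact: (nf k).2.
by apply: emeasurable_sum => k; exact: (nf k).1.
Qed.

Lemma nnm_series (f : nat -> T -> \bar R) : (forall k, nnm (f k)) ->
  nnm (fun x => \sum_(k <oo) f k x).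
Proof.
move=> nf; split; last by move=> x; apply: nneseries_ge0 => k _ _; exact: (nf k).2.
apply: ge0_emeasurable_sum; first by move=> k x _ _; exact: (nf k).2.
by move=> k _; exact: (nf k).1.
Qed.

Lemma nnm_EFin (f : T -> R) : measurable_fun [set: T] f ->
  (forall x, 0 <= f x)%R -> nnm (EFin \o f).
Proof. by move=> mf f0; split => [|x]; [exact/measurable_EFinP|rewrite lee_fin]. Qed.

End nnm_theory.

Section tonelli.
Context {d1 d2} {T1 : measurableType d1} {T2 : measurableType d2} {R : realType}.
Local Open Scope ereal_scope.
Variables (m1 : {sigma_finite_measure set T1 -> \bar R})
  (m2 : {sigma_finite_measure set T2 -> \bar R}).

Lemma nnm_int2 (f : T1 -> T2 -> \bar R) : nnm (fun z => f z.1 z.2) ->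
  nnm (fun x => \int[m2]_y f x y).
Proof.
move=> [mf f0]; split; last by move=> x; apply: integral_ge0 => y _; exact: (f0 (x, y)).
exact: (@measurable_fun_fubini_tonelli_F _ _ _ _ _ m2 _ mf).
Qed.

Lemma nnm_int1 (f : T1 -> T2 -> \bar R) : nnm (fun z => f z.1 z.2) ->
  nnm (fun y => \int[m1]_x f x y).
Proof.
move=> [mf f0]; split; last by move=> y; apply: integral_ge0 => x _; exact: (f0 (x, y)).
exact: (@measurable_fun_fubini_tonelli_G _ _ _ _ _ m1 _ mf).
Qed.

Lemma tonelli (f : T1 -> T2 -> \bar R) : nnm (fun z => f z.1 z.2) ->
  \int[m1]_x \int[m2]_y f x y = \int[m2]_y \int[m1]_x f x y.
Proof. by move=> [mf f0]; exact: (@fubini_tonelli _ _ _ _ _ m1 m2 _ mf). Qed.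

End tonelli.

Section integral_nnm.
Context {d} {T : measurableType d} {R : realType}.
Local Open Scope ereal_scope.
Variable m : {measure set T -> \bar R}.

Lemma int_ge0 (f : T -> \bar R) : nnm f -> 0 <= \int[m]_x f x.
Proof. by move=> nf; apply: integral_ge0 => x _; exact: nf.2. Qed.

Lemma int_le (f g : T -> \bar R) : nnm f -> nnm g -> (forall x, f x <= g x) ->
  \int[m]_x f x <= \int[m]_x g x.
Proof.
by move=> [mf f0] [mg g0] fg; apply: ge0_le_integral => // x _.
Qed.

Lemma intD (f g : T -> \bar R) : nnm f -> nnm g ->
  \int[m]_x (f x + g x) = \int[m]_x f x + \int[m]_x g x.
Proof. by move=> [mf f0] [mg g0]; exact: ge0_integralD. Qed.

Lemma intZ (k : \bar R) (f : T -> \bar R) : 0 <= k -> nnm f ->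
  \int[m]_x (k * f x) = k * \int[m]_x f x.
Proof. by move=> k0 [mf f0]; exact: ge0_integralZl. Qed.

Lemma int_sum (f : nat -> T -> \bar R) n : (forall k, nnm (f k)) ->
  \int[m]_x (\sum_(k < n) f k x) = \sum_(k < n) \int[m]_x f k x.
Proof.
move=> nf; rewrite ge0_integral_sum => // [k|k x _]; first exact: (nf k).1.
exact: (nf k).2.
Qed.

Lemma int_series (f : nat -> T -> \bar R) : (forall k, nnm (f k)) ->
  \int[m]_x (\sum_(k <oo) f k x) = \sum_(k <oo) \int[m]_x f k x.
Proof.
move=> nf; rewrite integral_nneseries => // [k|k x _]; first exact: (nf k).1.
exact: (nf k).2.
Qed.

End integral_nnm.

Lemma int_cst {d} {T : measurableType d} {R : realType} (P : probability T R) (c : \bar R) :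
  (\int[P]_x c = c)%E.
Proof.
rewrite integral_cst// -[RHS]mule1; congr (_ * _)%E; exact: probability_setT.
Qed.

Lemma int_if {d} {T : measurableType d} {R : realType} (m : {measure set T -> \bar R})
    (b : T -> bool) : measurable_fun [set: T] b ->
  (\int[m]_x (if b x then 1 else 0) = m [set x | b x])%E.
Proof.
move=> mb; have mS : measurable [set x | b x] by rewrite -[X in measurable X]setTI; exact: mb.
transitivity (\int[m]_x (\1_[set x | b x] x)%:E)%E.
  apply: eq_integral => x _; rewrite indicE; case: ifPn => bx; first by rewrite mem_set.
  by rewrite memNset//=; exact/negP.
by rewrite integral_indic// setIT.
Qed.

(** * The law of the sequence of increments *)

Section sequences_of_increments.
Context {R : realType}.

Definition cylinder (n : nat) (A : nat -> set R) : set (nat -> R) :=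
  [set w | forall i, (i < n)%N -> A i (w i)].

Definition cylinders : set (set (nat -> R)) :=
  [set G | exists n A, (forall i, measurable (A i)) /\ G = cylinder n A].

Definition increments := g_sigma_algebraType cylinders.

HB.instance Definition _ := Measurable.on increments.

Definition scons (y : R) (w : increments) : increments :=
  fun n => if n is m.+1 then w m else y.

Lemma setI_closed_cylinders : setI_closed cylinders.
Proof.
move=> _ _ [n [A [mA ->]]] [m [B [mB ->]]].
exists (maxn n m), (fun i => (if (i < n)%N then A i else setT) `&`
                     (if (i < m)%N then B i else setT)); split.
  by move=> i; apply: measurableI; case: ifP.
apply/seteqP; split => w.
  by move=> [wA wB] i _; split; case: ifPn => // im; [exact: wA|exact: wB].
move=> wAB; split => i im.
  by have := wAB i; rewrite leq_max im /= => /(_ isT)[].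
by have := wAB i; rewrite leq_max im orbT => /(_ isT)[].
Qed.

Lemma measurable_coord i : measurable_fun [set: increments] (fun w => w i).
Proof.
move=> _ A mA; rewrite setTI; apply: sub_sigma_algebra.
exists i.+1, (fun j => if j == i then A else setT); split.
  by move=> j; case: ifP.
apply/seteqP; split => w /=.
  by move=> Aw j _; case: eqP => // ->.
by move=> /(_ i (ltnSn i)); rewrite eqxx.
Qed.

Lemma measurable_increments d (T : measurableType d) (h : T -> increments) :
  (forall i, measurable_fun [set: T] (fun t => h t i)) ->
  measurable_fun [set: T] h.
Proof.
move=> mh; apply: (@measurability d _ T increments setT h cylinders); first reflexivity.
move=> _ [_ [n [A [mA ->]]] <-].
rewrite setTI.
have -> : h @^-1` cylinder n A =
    \bigcap_(i in [set k | (k < n)%N]) ((h ^~ i) @^-1` A i).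
  by apply/seteqP; split.
apply: bigcap_measurableType => i _.
by rewrite -[X in measurable X]setTI; exact: mh.
Qed.

Lemma measurable_scons d (T : measurableType d) (f : T -> R) (g : T -> increments) :
  measurable_fun [set: T] f -> measurable_fun [set: T] g ->
  measurable_fun [set: T] (fun t => scons (f t) (g t)).
Proof.
move=> mf mg; apply: measurable_increments => -[|i] //=.
exact: (measurableT_comp (measurable_coord i) mg).
Qed.

(** Cylinders form a pi-system that contains the whole space, so finite measures agreeing on them
    agree everywhere. *)
Lemma increments_measure_unique (m1 m2 : {measure set increments -> \bar R}) :
  (m1 setT < +oo)%E ->
  (forall n A, (forall i, measurable (A i)) -> m1 (cylinder n A) = m2 (cylinder n A)) ->
  forall G, measurable G -> m1 G = m2 G.
Proof.
move=> m1fin m12 G mG.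
apply: (@measure_unique _ R increments cylinders (fun=> setT) _ _ _ _ m1 m2) => //.
- exact: setI_closed_cylinders.
- move=> _; exists 0%N, (fun=> setT); split => //.
  by apply/seteqP; split.
- by rewrite bigcup_const//; exists 0%N.
- by move=> _ [n [A [mA ->]]]; exact: m12.
Qed.

(* Says that the coordinates are i.i.d. with law [mu] under [Pi]. *)
Definition first_step (mu : probability R R) (Pi : probability increments R) :=
  forall F : increments -> \bar R, nnm F ->
    (\int[Pi]_w F w = \int[mu]_y \int[Pi]_w F (scons y w))%E.

End sequences_of_increments.
Arguments increments : clear implicits.

Section law_of_the_increments.
Context {R : realType} {d : measure_display} {T : measurableType d}.
Variables (P : probability T R) (Y : nat -> {RV P >-> R}) (mu : probability R R).

Definition path (t : T) : increments R := fun n => Y n t.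

Lemma measurable_path : measurable_fun [set: T] path.
Proof. by apply: measurable_increments => i; exact: measurable_funPT. Qed.

HB.instance Definition _ := @isMeasurableFun.Build _ _ T (increments R) path measurable_path.

Definition path_law : probability (increments R) R := distribution P path.

Lemma path_lawE (G : set (increments R)) : path_law G = P (path @^-1` G).
Proof. by []. Qed.

Hypothesis indepY : mutually_independent P Y.
Hypothesis distY : common_distribution P Y mu.

Lemma path_law_cylinder n (A : nat -> set R) : (forall i, measurable (A i)) ->
  (path_law (cylinder n A) = \prod_(i < n) mu (A i))%E.
Proof.
move=> mA; rewrite path_lawE.
pose J := [fset i in iota 0 n]%fset.
have -> : path @^-1` cylinder n A = \bigcap_(i in [set` J]) (Y i @^-1` A i).
  apply/seteqP; split => t /= h i.
    by rewrite /= !inE mem_iota add0n => /andP[_]; exact: h.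
  by move=> im; apply: h; rewrite /= !inE mem_iota add0n im.
rewrite indepY// (perm_big (iota 0 n)) /=; last first.
  by apply: uniq_perm => [||i]; rewrite ?fset_uniq ?iota_uniq// !inE.
rewrite -{1}(subn0 n) -/(index_iota 0 n) big_mkord.
by apply: eq_bigr => i _; rewrite -(distY i).
Qed.

Lemma measurable_scons_pair :
  measurable_fun [set: R * increments R] (fun z => scons z.1 z.2).
Proof. exact: measurable_scons. Qed.

Lemma cylinder_scons n A y (w : increments R) :
  cylinder n.+1 A (scons y w) <-> A 0%N y /\ cylinder n (fun i => A i.+1) w.
Proof.
split => [h|[h0 h] [|i]//]; last exact: h.
by split => [|i im]; [exact: (h 0%N)|exact: (h i.+1)].
Qed.

(** The law of the path and the image of [mu \x path_law] under [scons] have the same value on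
    cylinders, namely a product of values of [mu]; hence they are equal, and Tonelli turns the
    second one into an iterated integral. *)
Lemma path_law_first_step : first_step mu path_law.
Proof.
move=> F nF.
pose cons_ (z : R * increments R) := scons z.1 z.2.
pose m2 := pushforward (mu \x path_law)%E cons_.
have mc : measurable_fun [set: R * increments R] cons_ by exact: measurable_scons_pair.
have E n A : (forall i, measurable (A i)) ->
    path_law (cylinder n A) = m2 (cylinder n A).
  move=> mA; rewrite path_law_cylinder// /m2 /pushforward.
  case: n => [|n].
    rewrite big_ord0.
    have -> : cons_ @^-1` cylinder 0 A = setT `*` setT by apply/seteqP; split.
    rewrite product_measure1E// [X in (X * _)%E]probability_setT mul1e.
    exact: (esym (probability_setT path_law)).
  have -> : cons_ @^-1` cylinder n.+1 A = A 0%N `*` cylinder n (fun i => A i.+1).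
    by apply/seteqP; split => -[y w]; rewrite /= cylinder_scons.
  rewrite product_measure1E//; last first.
    by apply: sub_sigma_algebra; exists n, (fun i => A i.+1).
  by rewrite big_ord_recl; congr (_ * _)%E; exact/esym/path_law_cylinder.
have -> : (\int[path_law]_w F w = \int[m2]_w F w)%E.
  apply: eq_measure_integral => G mG _.
  apply: increments_measure_unique => //.
  by apply: le_lt_trans (@probability_le1 _ _ _ path_law _ measurableT) _; exact: ltry.
rewrite /m2 ge0_integral_pushforward//; first last.
- by move=> w _; exact: nF.2.
- exact: nF.1.
rewrite preimage_setT fubini_tonelli1//; last by move=> z; exact: nF.2.
exact: (measurableT_comp nF.1 mc).
Qed.

End law_of_the_increments.

(** * Monotone limits and the one-step operators of the killed walk *)

Section monotone_limits.
Context {d} {T : measurableType d} {R : realType}.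
Local Open Scope ereal_scope.
Variable m : {measure set T -> \bar R}.

(** Monotone convergence, in the form that passes a uniform bound on integrals to a function below
    the pointwise limit. *)
Lemma int_le_lim (F_ : nat -> T -> \bar R) (F : T -> \bar R) c :
  (forall n, nnm (F_ n)) -> (forall x, {homo F_ ^~ x : i j / (i <= j)%N >-> i <= j}) ->
  nnm F -> (forall x, F x <= limn (F_ ^~ x)) -> (forall n, \int[m]_x F_ n x <= c) ->
  \int[m]_x F x <= c.
Proof.
move=> nF_ ndF nF FF_ Fc.
have cF : ((\int[m]_x F_ n x) @[n --> \oo] --> \int[m]_x limn (F_ ^~ x)).
  apply: cvg_monotone_convergence => //.
  - by move=> n; exact: (nF_ n).1.
  - by move=> n x _; exact: (nF_ n).2.
have mL : nnm (fun x => limn (F_ ^~ x)).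
  split; last first.
    by move=> x; apply: le_trans (FF_ x); exact: nF.2.
  apply: (emeasurable_fun_cvg F_) => [n|x _]; first exact: (nF_ n).1.
  exact: (ereal_nondecreasing_is_cvgn (ndF x)).
apply: (@le_trans _ _ (\int[m]_x limn (F_ ^~ x))); first exact: int_le.
rewrite -(cvg_lim _ cF)//; apply: lime_le; first by apply/cvg_ex; eexists; exact: cF.
exact: nearW.
Qed.

Lemma int_le_ex (F_ : nat -> T -> \bar R) (F : T -> \bar R) c :
  (forall n, nnm (F_ n)) -> (forall x, {homo F_ ^~ x : i j / (i <= j)%N >-> i <= j}) ->
  nnm F -> (forall x, exists n, F x <= F_ n x) -> (forall n, \int[m]_x F_ n x <= c) ->
  \int[m]_x F x <= c.
Proof.
move=> nF_ ndF nF FF_; apply: int_le_lim => // x.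
have [n Fn] := FF_ x; apply: (le_trans Fn).
rewrite (cvg_lim _ (ereal_nondecreasing_cvgn (ndF x)))//.
by apply: ereal_sup_ubound; exists n.
Qed.

End monotone_limits.

Section one_step_operators.
Context {R : realType}.
Local Open Scope ereal_scope.
Variable mu : probability R R.
Implicit Types f g : R -> \bar R.

(** Transition operator of the walk [x - S_n] killed when it becomes negative. For the reflected
    walk, [down] is the part of a step without reflection and [up] the part with reflection. *)
Definition down f (x : R) : \bar R := \int[mu]_y (if (y <= x)%R then f (x - y)%R else 0).

Definition up f (x : R) : \bar R := \int[mu]_y (if (x < y)%R then f (y - x)%R else 0).

Lemma measurable_sub_pair : measurable_fun [set: R * R] (fun z => z.1 - z.2)%R.
Proof. exact: measurable_funB. Qed.

Lemma nnm_down_pair f : nnm f ->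
  nnm (fun z : R * R => if (z.2 <= z.1)%R then f (z.1 - z.2)%R else 0).
Proof.
move=> nf; apply: nnm_if.
- exact: measurable_fun_ler.
- exact: (nnm_comp measurable_sub_pair).
- exact: nnm_cst.
Qed.

Lemma nnm_up_pair f : nnm f ->
  nnm (fun z : R * R => if (z.1 < z.2)%R then f (z.2 - z.1)%R else 0).
Proof.
move=> nf; apply: nnm_if.
- exact: measurable_fun_ltr.
- by apply: (@nnm_comp _ _ _ _ _ f (fun z : R * R => z.2 - z.1)%R) => //; exact: measurable_funB.
- exact: nnm_cst.
Qed.

Lemma nnm_down f : nnm f -> nnm (down f).
Proof.
move=> nf; apply: (@nnm_int2 _ _ _ _ _ mu
  (fun x y => if (y <= x)%R then f (x - y)%R else 0)); exact: nnm_down_pair.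
Qed.

Lemma nnm_up f : nnm f -> nnm (up f).
Proof.
move=> nf; apply: (@nnm_int2 _ _ _ _ _ mu
  (fun x y : R => if (x < y)%R then f (y - x)%R else 0)). exact: nnm_up_pair.
Qed.

Lemma nnm_section1 d1 d2 (T1 : measurableType d1) (T2 : measurableType d2)
  (f : T1 -> T2 -> \bar R) x : nnm (fun z => f z.1 z.2) -> nnm (f x).
Proof.
move=> nf; apply: (@nnm_comp _ _ _ _ _ (fun z => f z.1 z.2) (fun y => (x, y))) => //.
exact: pair1_measurable.
Qed.

Lemma nnm_down_at f (x : R) : nnm f -> nnm (fun y : R => if (y <= x)%R then f (x - y)%R else 0).
Proof.
by move=> nf; apply: (@nnm_section1 _ _ R R
  (fun x y : R => if (y <= x)%R then f (x - y)%R else 0)); exact: nnm_down_pair.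
Qed.

Lemma nnm_up_at f (x : R) : nnm f -> nnm (fun y : R => if (x < y)%R then f (y - x)%R else 0).
Proof.
by move=> nf; apply: (@nnm_section1 _ _ R R
  (fun x y : R => if (x < y)%R then f (y - x)%R else 0)); exact: nnm_up_pair.
Qed.

Lemma down_le f g x : nnm f -> nnm g -> (forall z, (0 <= z)%R -> f z <= g z) ->
  down f x <= down g x.
Proof.
move=> nf ng fg; apply: int_le; [exact: nnm_down_at|exact: nnm_down_at|].
by move=> y; case: ifP => // yx; apply: fg; rewrite subr_ge0.
Qed.

Lemma downD f g x : nnm f -> nnm g -> down (fun z => f z + g z) x = down f x + down g x.
Proof.
move=> nf ng; rewrite /down -intD; [|exact: nnm_down_at|exact: nnm_down_at].
by apply: eq_integral => y _; case: ifP; rewrite ?adde0.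
Qed.

Lemma downZ k f x : 0 <= k -> nnm f -> down (fun z => k * f z) x = k * down f x.
Proof.
move=> k0 nf; rewrite /down -intZ//; last exact: nnm_down_at.
by apply: eq_integral => y _; case: ifP; rewrite ?mule0.
Qed.

Lemma down_series (f : nat -> R -> \bar R) x : (forall k, nnm (f k)) ->
  down (fun z => \sum_(k <oo) f k z) x = \sum_(k <oo) down (f k) x.
Proof.
move=> nf; rewrite /down -(@int_series _ _ _ mu (fun k (y : R) =>
    if (y <= x)%R then f k (x - y)%R else 0)); last by move=> k; exact: nnm_down_at.
by apply: eq_integral => y _; case: ifP => // _; rewrite eseries0.
Qed.

Lemma updown g f x : nnm f -> nnm g ->
  \int[mu]_y (if (x < y)%R then g (y - x)%R else f (x - y)%R) = up g x + down f x.
Proof.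
move=> nf ng; rewrite /up /down -intD; [|exact: nnm_up_at|exact: nnm_down_at].
by apply: eq_integral => y _; rewrite leNgt; case: ifP => _ /=; rewrite ?adde0 ?add0e.
Qed.

Lemma updown_norm f x : nnm f -> \int[mu]_y f `|x - y|%R = up f x + down f x.
Proof.
move=> nf; rewrite -updown//; apply: eq_integral => y _.
by case: ltP => xy; [rewrite ltr0_norm ?opprB ?subr_lt0|rewrite ger0_norm ?subr_ge0].
Qed.

Lemma nnm_iter_down n f : nnm f -> nnm (iter n down f).
Proof. by move=> nf; elim: n => //= n; exact: nnm_down. Qed.

(** A supersolution dominates the potential: each use of [f + down phi <= phi] splits off one term
    of the sum and leaves a nonnegative remainder. *)
Lemma potential_le n f phi x : nnm f -> nnm phi ->
  (forall z, (0 <= z)%R -> f z + down phi z <= phi z) -> (0 <= x)%R ->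
  \sum_(k < n) iter k down f x <= phi x.
Proof.
move=> nf nphi fphi; elim: n x => [|n ih] x x0; first by rewrite big_ord0; exact: nphi.2.
rewrite big_ord_recl /=; apply: le_trans (fphi x x0); rewrite leeD2l//.
have -> : \sum_(i < n) down (iter i down f) x = down (fun z => \sum_(k < n) iter k down f z) x.
  rewrite /down -(@int_sum _ _ _ mu (fun k (y : R) =>
    if (y <= x)%R then iter k down f (x - y)%R else 0)); last first.
    by move=> k; exact/nnm_down_at/nnm_iter_down.
  by apply: eq_integral => y _; case: ifP => // _; rewrite big1.
apply: down_le => //; apply: nnm_sum => k; exact: nnm_iter_down.
Qed.

(** The Green potential of the killed walk; it satisfies the supersolution inequality with
    equality. *)
Definition potential f (x : R) : \bar R := \sum_(k <oo) iter k down f x.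

Lemma nnm_potential f : nnm f -> nnm (potential f).
Proof. by move=> nf; apply: nnm_series => k; exact: nnm_iter_down. Qed.

Lemma potentialE f x : nnm f -> potential f x = f x + down (potential f) x.
Proof.
move=> nf; rewrite /potential down_series; last by move=> k; exact: nnm_iter_down.
rewrite nneseries_recl//; last by move=> k _; exact: (nnm_iter_down _ nf).2.
congr (_ + _); rewrite -nneseries_addn; last by move=> k; exact: (nnm_iter_down _ nf).2.
by apply: eq_eseriesr => k _; rewrite addn1.
Qed.

End one_step_operators.

Section events.
Context {d1 d2} {T1 : measurableType d1} {T2 : measurableType d2} {R : realType}.
Variable m : {sigma_finite_measure set T2 -> \bar R}.

Lemma nnm_xsection (G : T1 -> T2 -> Prop) : measurable [set z | G z.1 z.2] ->
  nnm (fun x => m [set w | G x w]).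
Proof.
move=> mG; split => [|x]; last exact: measure_ge0.
rewrite (_ : (fun x => _) = m \o xsection [set z | G z.1 z.2]).
  exact: measurable_fun_xsection.
by apply/funext => x /=; congr (m _); apply/seteqP; split => w; rewrite /xsection /= inE.
Qed.

Lemma measurable_section (G : T1 -> T2 -> Prop) x : measurable [set z | G z.1 z.2] ->
  measurable [set w | G x w].
Proof.
move=> mG; rewrite (_ : [set w | G x w] = xsection [set z | G z.1 z.2] x).
  exact: measurable_xsection.
by apply/seteqP; split => w; rewrite /xsection /= inE.
Qed.

End events.

(** * First-step analysis of the reflected walk *)

Section first_step_of_events.
Context {R : realType}.
Variables (mu : probability R R) (Pi : probability (increments R) R).
Hypothesis fs : first_step mu Pi.
Local Open Scope ereal_scope.

Lemma first_step_event (G : set (increments R)) : measurable G ->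
  Pi G = \int[mu]_y Pi [set w | G (scons y w)].
Proof.
move=> mG.
have mS y : measurable [set w | G (scons y w)].
  by rewrite -[X in measurable X]setTI; apply: measurable_scons.
have nG : nnm (EFin \o (\1_G : increments R -> R)).
  by apply: nnm_EFin => // w; rewrite indicE ler0n.
have /= := fs nG; rewrite integral_indic// setIT => ->.
apply: eq_integral => y _.
transitivity (\int[Pi]_w (\1_[set w | G (scons y w)] w)%:E).
  by apply: eq_integral => w _; rewrite !indicE; congr (_%:R%:E).
by rewrite integral_indic// setIT.
Qed.

Fixpoint rwalk (x : R) (n : nat) (w : increments R) : R :=
  if n is m.+1 then `|rwalk x m w - w m|%R else x.

Lemma rwalk_scons x n y w : rwalk x n.+1 (scons y w) = rwalk `|x - y|%R n w.
Proof. by elim: n => // n ih; rewrite /= -ih. Qed.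

Lemma measurable_rwalk n :
  measurable_fun [set: R * increments R] (fun z => rwalk z.1 n z.2).
Proof.
elim: n => [|n ih] /=; first exact: measurable_fst.
apply: (measurableT_comp (@normr_measurable R setT)); apply: measurable_funB => //.
exact: (measurableT_comp (measurable_coord n)).
Qed.

(** Both walks use the same increments, and [x -> |x - y|] is 1-Lipschitz. *)
Lemma rwalk_contract x x' n w : (`|rwalk x n w - rwalk x' n w| <= `|x - x'|)%R.
Proof.
elim: n => //= n ih; apply: (le_trans _ ih).
apply: le_trans (ler_dist_dist _ _) _.
by rewrite opprB addrA subrK.
Qed.

Definition low (L : R) (m : nat) (x : R) (w : increments R) : Prop :=
  exists2 n, (m <= n)%N & (rwalk x n w <= L)%R.

Lemma measurable_low L m : measurable [set z : R * increments R | low L m z.1 z.2].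
Proof.
rewrite (_ : [set z | _] = \bigcup_(n in [set k | (m <= k)%N])
    [set z : R * increments R | (rwalk z.1 n z.2 <= L)%R]).
  apply: bigcup_measurable => n _.
  rewrite -[X in measurable X]setTI.
  exact: (measurable_fun_ler (measurable_rwalk n) (@measurable_cst _ _ _ _ _ L)).
by apply/seteqP; split => z [n mn zn]; exists n.
Qed.

Definition plow (L : R) (m : nat) (x : R) : \bar R := Pi [set w | low L m x w].

Lemma nnm_plow L m : nnm (plow L m).
Proof. exact: (nnm_xsection Pi (measurable_low L m)). Qed.

Lemma measurable_low_at L m x : measurable [set w | low L m x w].
Proof. exact: (measurable_section x (measurable_low L m)). Qed.

Lemma plow_le1 L m x : plow L m x <= 1.
Proof. by apply: probability_le1; exact: measurable_low_at. Qed.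

Lemma plowS L m x : plow L m.+1 x <= plow L m x.
Proof.
apply: le_measure; rewrite ?inE; [exact: measurable_low_at..|].
by move=> w [n mn wn]; exists n => //; exact: ltnW.
Qed.

Lemma plow_step L m x : plow L m.+1 x = up mu (plow L m) x + down mu (plow L m) x.
Proof.
rewrite -updown_norm; last exact: nnm_plow.
rewrite /plow first_step_event; last exact: measurable_low_at.
apply: eq_integral => y _; congr (Pi _); apply/seteqP; split => w [n mn wn].
  by case: n mn wn => // n mn; rewrite rwalk_scons => wn; exists n.
by exists n.+1 => //; rewrite rwalk_scons.
Qed.

End first_step_of_events.

(** * Ladder heights *)

Section ladder_height.
Context {R : realType}.

Definition shift_ (w : increments R) : increments R := fun n => w n.+1.

Lemma measurable_shift : measurable_fun [set: increments R] shift_.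
Proof. by apply: measurable_increments => i; exact: measurable_coord. Qed.

(* Overshoot of the level [s] by the partial sums of [w] if it occurs within [n] steps, [0]
   otherwise. *)
Fixpoint over (n : nat) (s : R) (w : increments R) : R :=
  if n is m.+1 then
    if s < w 0%N then w 0%N - s else over m (s - w 0%N) (shift_ w)
  else 0.

Lemma measurable_over n :
  measurable_fun [set: R * increments R] (fun z => over n z.1 z.2).
Proof.
have m0 : measurable_fun [set: R * increments R] (fun z => z.2 0%N).
  exact: (measurableT_comp (measurable_coord 0)).
have mg : measurable_fun [set: R * increments R] (fun z => (z.1 - z.2 0%N, shift_ z.2)).
  apply: measurable_fun_pair; first exact: measurable_funB.
  exact: (measurableT_comp measurable_shift).
elim: n => [|n ih] /=; first exact: measurable_cst.
apply: measurable_fun_ifT.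
- exact: measurable_fun_ltr.
- exact: measurable_funB.
exact: (measurableT_comp ih mg).
Qed.

Lemma over_ge0 n s w : 0 <= over n s w.
Proof. by elim: n s w => //= n ih s w; case: ltP => // /ltW; rewrite subr_ge0. Qed.

Lemma over_stable n m s w : (n <= m)%N -> 0 < over n s w -> over m s w = over n s w.
Proof.
elim: n m s w => [|n ih] [|m] s w //=; first by rewrite ltxx.
by rewrite ltnS => nm; case: ifP => // _; exact: ih.
Qed.

(** The sequence is eventually constant, and its limit is 0 exactly when no partial sum is positive.
    Thus [ladder <= 0] encodes an infinite ladder epoch, and no extended value is needed. *)
Definition ladder (w : increments R) : R := limn (fun n => over n 0 w).

Lemma over_cvg_ladder w : over n 0 w @[n --> \oo] --> ladder w.
Proof.
have [[n n0]|h] := pselect (exists n, 0 < over n 0 w).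
  apply/cvg_ex; exists (over n 0 w); apply: cvg_near_cst.
  by exists n => // m /= nm; rewrite (over_stable nm n0).
apply/cvg_ex; exists 0; apply: cvg_near_cst.
exists 0%N => // m _ /=; apply/le_anti; rewrite over_ge0 andbT leNgt.
by apply/negP => m0; apply: h; exists m.
Qed.

Lemma ladder_over n w : 0 < over n 0 w -> ladder w = over n 0 w.
Proof.
move=> n0; apply: cvg_lim => //; apply: cvg_near_cst.
by exists n => // m /= nm; rewrite (over_stable nm n0).
Qed.

Lemma ladder_gt0 w : 0 < ladder w <-> exists n, 0 < over n 0 w.
Proof.
split => [l0|[n n0]]; last by rewrite (ladder_over n0).
apply: contrapT => h; move: l0; rewrite (_ : ladder w = 0) ?ltxx//.
apply: cvg_lim => //; apply: cvg_near_cst.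
exists 0%N => // m _ /=; apply/le_anti; rewrite over_ge0 andbT leNgt.
by apply/negP => m0; apply: h; exists m.
Qed.

Lemma measurable_ladder : measurable_fun [set: increments R] ladder.
Proof.
apply: (measurable_fun_cvg (h := fun n w => over n 0 w)) => [n|w _].
  by have := measurable_fun_pair2 (0 : R) (measurable_over n).
exact: over_cvg_ladder.
Qed.

HB.instance Definition _ := @isMeasurableFun.Build _ _ (increments R) R ladder measurable_ladder.

End ladder_height.

Section ladder_law.
Context {R : realType}.
Variables (mu : probability R R) (Pi : probability (increments R) R).
Hypothesis fs : first_step mu Pi.
Local Open Scope ereal_scope.

Definition ladder_law : probability R R := distribution Pi ladder.

(** Discards the value 0 that stands for a missing ladder height; later it also restricts Lebesgue
    integrals to []0, +oo[]. *)
Definition pos (g : R -> \bar R) (h : R) : \bar R := if (0 < h)%R then g h else 0.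

Lemma nnm_pos g : nnm g -> nnm (pos g).
Proof. by move=> ng; apply: nnm_if => //; exact: measurable_fun_ltr. Qed.

Lemma nnm_pos_over g n : nnm g ->
  nnm (fun z : R * increments R => pos g (over n z.1 z.2)).
Proof. by move=> /nnm_pos; apply: nnm_comp; exact: measurable_over. Qed.

(** The first increment [y] either overshoots [s] by [y - s], which [up] accounts for, or leaves the
    level [s - y] to be crossed in one step less, which [down] and the induction hypothesis account
    for. *)
Lemma over_bound g phi n s : nnm g -> nnm phi ->
  (forall z, (0 <= z)%R -> up mu g z + down mu phi z <= phi z) -> (0 <= s)%R ->
  \int[Pi]_w pos g (over n s w) <= phi s.
Proof.
move=> ng nphi gphi; elim: n s => [|n ih] s s0.
  by rewrite /pos /= ltxx integral0; exact: nphi.2.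
have nn k t : nnm (fun w => pos g (over k t w)).
  exact: (@nnm_section1 R _ _ R (increments R) (fun t w => pos g (over k t w)) t (nnm_pos_over k ng)).
rewrite (fs (nn n.+1 s)); apply: le_trans (gphi s s0).
rewrite -updown//; apply: int_le.
- apply: (@nnm_int2 _ _ R (increments R) R Pi (fun y w => pos g (over n.+1 s (scons y w)))).
  apply: (nnm_comp _ (nnm_pos_over n.+1 ng) (h := fun z => (s, scons z.1 z.2))).
  apply: measurable_fun_pair; first exact: measurable_cst.
  exact: measurable_scons.
- apply: nnm_if; first by apply: measurable_fun_ltr => //; exact: measurable_cst.
  + by apply: nnm_comp ng; apply: measurable_funB => //; exact: measurable_cst.
  + by apply: nnm_comp nphi; apply: measurable_funB => //; exact: measurable_cst.
move=> y; case: ltP => sy.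
  have -> : (fun w => pos g (over n.+1 s (scons y w))) = fun=> g (y - s)%R.
    by apply/funext => w; rewrite /= sy /pos subr_gt0 sy.
  by rewrite int_cst.
have -> : (fun w => pos g (over n.+1 s (scons y w))) = fun w => pos g (over n (s - y) w).
  by apply/funext => w; rewrite /= ltNge sy.
by apply: ih; rewrite subr_ge0.
Qed.

(** A positive overshoot is final, so [pos g (over n 0 w)] is nondecreasing in [n] and the bound of
    [over_bound], uniform in [n], passes to the limit. *)
Lemma ladder_law_le g phi : nnm g -> nnm phi ->
  (forall z, (0 <= z)%R -> up mu g z + down mu phi z <= phi z) ->
  \int[ladder_law]_h pos g h <= phi 0%R.
Proof.
move=> ng nphi gphi.
rewrite ge0_integral_distribution; [|exact: (nnm_pos ng).1|exact: (nnm_pos ng).2].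
apply: (int_le_ex (F_ := fun n w => pos g (over n 0%R w))).
- move=> n.
  exact: (@nnm_section1 R _ _ R (increments R) (fun t w => pos g (over n t w)) 0%R (nnm_pos_over n ng)).
- move=> w i j ij; rewrite /pos; case: ifPn => i0; last by case: ifP => // _; exact: ng.2.
  by rewrite (over_stable ij i0) i0.
- by apply: nnm_comp (nnm_pos ng); exact: measurable_ladder.
- move=> w; rewrite /pos /=; case: ifPn => [/ladder_gt0[n n0]|_].
    by exists n; rewrite (ladder_over n0) n0.
  by exists 0%N; rewrite /= ltxx.
- by move=> n; apply: over_bound.
Qed.

(** The right-hand side is the probability that the first [n] partial sums are all nonpositive. *)
Lemma no_ladder_le n : ladder_law [set h | h <= 0]%R <= iter n (down mu) (cst 1) 0%R.
Proof.
have mb k (t : R) : measurable_fun [set: increments R] (fun w => over k t w <= 0)%R.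
  apply: measurable_fun_ler; last exact: measurable_cst.
  by have := measurable_fun_pair2 t (measurable_over k).
have nn k (t : R) : nnm (fun w => if (over k t w <= 0)%R then 1 else 0 : \bar R).
  by apply: (@nnm_if _ (increments R) R _ (cst 1) (cst 0)); [exact: mb|exact: nnm_cst|exact: nnm_cst].
have key s : (0 <= s)%R ->
    \int[Pi]_w (if (over n s w <= 0)%R then 1 else 0) = iter n (down mu) (cst 1) s.
  elim: n s => [|n ih] s s0.
    by rewrite /= lexx int_cst.
  rewrite (fs (nn n.+1 s)) /= {1}/down; apply: eq_integral => y _.
  by case: leP => sy; rewrite ?ih ?subr_ge0// leNgt subr_gt0 sy integral0.
rewrite -key// int_if//.
change (Pi [set w | ladder w <= 0]%R <= Pi [set w | over n 0%R w <= 0]%R).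
apply: le_measure; rewrite ?inE.
- have ml : measurable_fun [set: increments R] (fun w => ladder w <= 0)%R.
    by apply: measurable_fun_ler; [exact: measurable_ladder|exact: measurable_cst].
  by rewrite -[X in measurable X]setTI; exact: ml.
- by rewrite -[X in measurable X]setTI; exact: mb.
move=> w /= l0; rewrite leNgt; apply/negP => n0.
by move: l0; rewrite leNgt (ladder_over n0) n0.
Qed.

End ladder_law.

(* [lebesgue_measure] lives on the copy [measurableTypeR R] of the real line, whose display
   differs from the one of [R]. *)
HB.lock Definition leb {R : realType} : set R -> \bar R := @lebesgue_measure R.

(** * Lebesgue measure under translations and reflections *)

Section lebesgue_invariance.
Context {R : realType}.
Local Open Scope ereal_scope.
Local Notation leb := (@leb R).

Let leb0 : leb set0 = 0. Proof. by rewrite unlock; exact: measure0. Qed.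

Let leb_ge0 A : 0 <= leb A. Proof. by rewrite unlock; exact: measure_ge0. Qed.

Let leb_additive : semi_sigma_additive leb.
Proof. by rewrite unlock; exact: (@measure_semi_sigma_additive _ _ _ (@lebesgue_measure R)). Qed.

HB.instance Definition _ := isMeasure.Build _ _ _ leb leb0 leb_ge0 leb_additive.

Let leb_sigma_finite : sigma_finite setT leb.
Proof. by rewrite unlock; exact: (@sigma_finiteT _ _ _ (@lebesgue_measure R)). Qed.

HB.instance Definition _ := Measure_isSigmaFinite.Build _ _ _ leb leb_sigma_finite.

Lemma leb_oc (a b : R) : leb `]a, b]%classic = if (a < b)%R then (b - a)%:E else 0.
Proof. by rewrite unlock lebesgue_measure_itv/= lte_fin EFinB. Qed.

Lemma leb_cc (a b : R) : leb `[a, b]%classic = if (a < b)%R then (b - a)%:E else 0.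
Proof. by rewrite unlock lebesgue_measure_itv/= lte_fin EFinB. Qed.

Lemma leb_set1 (a : R) : leb [set a] = 0.
Proof. by rewrite unlock; exact: lebesgue_measure_set1. Qed.

Lemma leb_shift (h : R) (A : set R) : measurable A ->
  leb A = pushforward leb (fun x => x + h)%R A.
Proof.
move=> mA; rewrite unlock.
change (@lebesgue_measure R A =
  pushforward (@lebesgue_measure R) (fun x : measurableTypeR R => (x + h)%R : measurableTypeR R) A).
apply: lebesgue_measure_unique; last exact: mA.
  exact: (@measurable_funD _ _ R setT id (cst h)).
move=> mh _ [[a b]] _ <-; rewrite /pushforward /=.
transitivity (leb `](a - h)%R, (b - h)%R]%classic).
  rewrite unlock !lebesgue_measure_itv/= !lte_fin ltrD2r; case: ifP => // _.
  by rewrite -!EFinD; congr (_%:E); lra.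
rewrite unlock; congr (@lebesgue_measure R _); apply/funext => x; apply/propext => /=.
by rewrite !in_itv/=; split => H; lra.
Qed.

Lemma leb_reflect (A : set R) : measurable A -> leb A = pushforward leb (@GRing.opp R) A.
Proof. by move=> mA; rewrite unlock; apply/esym/lebesgue_measureN. Qed.

Lemma integral_shift (h : R) (f : R -> \bar R) : nnm f ->
  \int[leb]_x f (x + h)%R = \int[leb]_x f x.
Proof.
move=> nf; have mh : measurable_fun [set: R] (fun x => x + h)%R.
  by apply: measurable_funD => //; exact: measurable_cst.
transitivity (\int[pushforward leb (fun x => x + h)%R]_x f x).
  by rewrite (ge0_integral_pushforward mh _ measurableT nf.1)// => x _; exact: nf.2.
by apply: eq_measure_integral => A mA _; exact/esym/leb_shift.
Qed.

Lemma integral_reflect0 (f : R -> \bar R) : nnm f ->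
  \int[leb]_x f (- x)%R = \int[leb]_x f x.
Proof.
move=> nf.
transitivity (\int[pushforward leb (@GRing.opp R)]_x f x).
  rewrite (ge0_integral_pushforward (@oppr_measurable R setT) _ measurableT nf.1)// => x _.
  exact: nf.2.
by apply: eq_measure_integral => A mA _; exact/esym/leb_reflect.
Qed.

Lemma integral_reflect (h : R) (f : R -> \bar R) : nnm f ->
  \int[leb]_x f (h - x)%R = \int[leb]_x f x.
Proof.
move=> nf; rewrite -[RHS]integral_reflect0//.
rewrite -(@integral_shift (- h) (fun x => f (- x)%R)); last first.
  have mo : measurable_fun [set: R] (fun x : R => - x)%R by exact: oppr_measurable.
  exact: (nnm_comp mo nf).
by apply: eq_integral => x _; rewrite opprD opprK addrC.
Qed.

End lebesgue_invariance.

(** * The invariant density at the times of reflection *)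

Section stationary_density.
Context {R : realType}.
Variable k : probability R R.
Local Open Scope ereal_scope.
Implicit Types f g phi : R -> \bar R.

Definition tail (z : R) : \bar R := \int[k]_h (if (z <= h)%R then 1 else 0).

(** Up to the boundary, the adjoint of [down k] for Lebesgue measure. With [S_n] a sum of [n]
    independent copies of [H], the iterate [iter n fwd tail z] is the probability of
    [H >= z + S_n]. *)
Definition fwd f (z : R) : \bar R := \int[k]_h f (z + h)%R.

Definition dens (z : R) : \bar R := \int[k]_h (if (z <= h)%R then tail (h - z)%R else 0).

Lemma nnm_ler_pair : nnm (fun z : R * R => if (z.1 <= z.2)%R then 1 else 0 : \bar R).
Proof.
apply: (@nnm_if _ _ R (fun z : R * R => (z.1 <= z.2)%R) (cst 1) (cst 0)).
- exact: measurable_fun_ler.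
- exact: nnm_cst.
- exact: nnm_cst.
Qed.

Lemma nnm_tail : nnm tail.
Proof.
exact: (@nnm_int2 _ _ R R R k (fun z h : R => if (z <= h)%R then 1 else 0) nnm_ler_pair).
Qed.

Lemma nnm_add_pair f : nnm f -> nnm (fun z : R * R => f (z.1 + z.2)%R).
Proof.
move=> nf; have ma : measurable_fun [set: R * R] (fun z => z.1 + z.2)%R by exact: measurable_funD.
exact: (nnm_comp ma nf).
Qed.

Lemma nnm_fwd f : nnm f -> nnm (fwd f).
Proof.
by move=> nf; exact: (@nnm_int2 _ _ R R R k (fun z h : R => f (z + h)%R) (nnm_add_pair nf)).
Qed.

Lemma nnm_add_at f (z : R) : nnm f -> nnm (fun h => f (z + h)%R).
Proof.
by move=> nf; exact: (@nnm_section1 _ _ _ R R (fun z h : R => f (z + h)%R) z (nnm_add_pair nf)).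
Qed.

Lemma nnm_dens_pair : nnm (fun z : R * R => if (z.1 <= z.2)%R then tail (z.2 - z.1)%R else 0).
Proof.
apply: nnm_if.
- exact: measurable_fun_ler.
- have ma : measurable_fun [set: R * R] (fun z => z.2 - z.1)%R by exact: measurable_funB.
  exact: (nnm_comp ma nnm_tail).
- exact: nnm_cst.
Qed.

Lemma nnm_dens : nnm dens.
Proof.
exact: (@nnm_int2 _ _ R R R k (fun z h : R => if (z <= h)%R then tail (h - z)%R else 0) nnm_dens_pair).
Qed.

Lemma nnm_iter_fwd n f : nnm f -> nnm (iter n fwd f).
Proof. by move=> nf; elim: n => //= n; exact: nnm_fwd. Qed.

(** For an independent copy [H'], the event [H >= z] forces [H' >= H - z] or [H >= z + H']. The
    second event has probability [fwd tail z] once the two integrations are exchanged. *)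
Lemma tail_le_dens z : tail z <= dens z + fwd tail z.
Proof.
pose swapped (h h' : R) : \bar R := if (z + h' <= h)%R then 1 else 0.
have ns : nnm (fun p : R * R => swapped p.1 p.2).
  have ma : measurable_fun [set: R * R] (fun p => (z + p.2, p.1))%R.
    by apply: measurable_fun_pair => //; apply: measurable_funD => //; exact: measurable_cst.
  exact: (nnm_comp ma nnm_ler_pair).
have -> : fwd tail z = \int[k]_h \int[k]_h' swapped h h'.
  by rewrite (tonelli k k ns).
have nd : nnm (fun h : R => if (z <= h)%R then tail (h - z)%R else 0).
  exact: (@nnm_section1 _ _ _ R R (fun z h : R => if (z <= h)%R then tail (h - z)%R else 0) z nnm_dens_pair).
have ni : nnm (fun h => \int[k]_h' swapped h h') by exact: nnm_int2.
rewrite /dens -intD//; apply: int_le.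
- exact: (@nnm_section1 _ _ _ R R (fun z h : R => if (z <= h)%R then 1 else 0) z nnm_ler_pair).
- exact: nnmD.
move=> h; case: ifPn => zh; last by rewrite add0e; exact: ni.2.
have nt : nnm (fun h' : R => if (h - z <= h')%R then 1 else 0 : \bar R).
  exact: (@nnm_section1 _ _ _ R R (fun z h : R => if (z <= h)%R then 1 else 0) _ nnm_ler_pair).
have ns1 : nnm (swapped h) by exact: nnm_section1.
rewrite /tail -intD// -[leLHS](int_cst k); apply: int_le => //.
- exact: nnmD.
move=> h'; rewrite /swapped; case: (leP (h - z)%R h') => [_|hz].
  by case: (_ <= h)%R; rewrite ?adde0// -EFinD lee_fin; lra.
by rewrite add0e ifT//; lra.
Qed.

Lemma fwd_le f g z : nnm f -> nnm g -> (forall x, f x <= g x) -> fwd f z <= fwd g z.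
Proof. by move=> nf ng fg; apply: int_le; [exact: nnm_add_at|exact: nnm_add_at|]. Qed.

Lemma fwdD f g z : nnm f -> nnm g -> fwd (fun x => f x + g x) z = fwd f z + fwd g z.
Proof. by move=> nf ng; rewrite /fwd intD//; exact: nnm_add_at. Qed.

Lemma iter_tail_le_dens n z :
  iter n fwd tail z <= iter n fwd dens z + iter n.+1 fwd tail z.
Proof.
elim: n z => [|n ih] z; first exact: tail_le_dens.
have nt j := nnm_iter_fwd j nnm_tail; have nd j := nnm_iter_fwd j nnm_dens.
rewrite [leLHS]/= [X in _ <= X + _]/= [X in _ <= _ + X]/=.
rewrite -fwdD//; last exact: (nt n.+1).
apply: fwd_le => //; apply: nnmD => //; exact: (nt n.+1).
Qed.

Lemma tail_le_sum n z :
  tail z <= \sum_(j < n) iter j fwd dens z + iter n fwd tail z.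
Proof.
elim: n => [|n ih]; first by rewrite big_ord0 add0e.
rewrite big_ord_recr -addeA; apply: (le_trans ih).
by rewrite leeD2l//; exact: iter_tail_le_dens.
Qed.

Hypothesis kpos : k [set h | h <= 0]%R = 0.

Lemma int_pos f : nnm f -> \int[k]_h f h = \int[k]_h pos f h.
Proof.
move=> nf; apply: ge0_ae_eq_integral => //.
- exact: nf.1.
- exact: (nnm_pos nf).1.
- by move=> x _; exact: nf.2.
- by move=> x _; exact: (nnm_pos nf).2.
exists [set h | h <= 0]%R; split => //.
  rewrite -[X in measurable X]setTI.
  by apply: (@measurable_fun_ler _ _ R setT id (cst 0%R)).
move=> h /= H; rewrite leNgt; apply/negP => h0; apply: H => _.
by rewrite /pos h0.
Qed.

Lemma int_gt0 f : nnm f -> (forall h, (0 < h)%R -> 0 < f h) -> 0 < \int[k]_h f h.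
Proof.
move=> nf f0; rewrite lt0e int_ge0// andbT; apply/negP => /eqP i0.
have ia : \int[k]_h `|f h| = 0.
  by rewrite -[RHS]i0; apply: eq_integral => h _; rewrite gee0_abs//; exact: nf.2.
have [N [mN N0 sN]] := (ae_eq_integral_abs k measurableT nf.1).1 ia.
have mle : measurable [set h : R | (h <= 0)%R].
  rewrite -[X in measurable X]setTI.
  by apply: (@measurable_fun_ler _ _ R setT id (cst 0%R)).
have : k setT <= k ([set h : R | (h <= 0)%R] `|` N).
  apply: le_measure; rewrite ?inE//; first exact: measurableU.
  move=> h _; have [h0|h0] := leP h 0%R; [by left|right; apply: sN => /= H].
  by have := f0 _ h0; rewrite H// ltxx.
rewrite (probability_setT k) leNgt => /negP; apply.
apply: (@le_lt_trans _ _ (k [set h : R | (h <= 0)%R] + k N)).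
  by apply: measureU2 => //.
by rewrite N0 adde0 kpos lte01.
Qed.

(** Cut off outside []0, +oo[] so as to stay below 1 everywhere. As [k] lives on []0, +oo[], the
    integral [theta] is the Laplace transform of [k] at 1. *)
Definition decay (h : R) : R := if (0 < h)%R then expR (- h) else 0%R.

Lemma measurable_decay : measurable_fun [set: R] decay.
Proof.
apply: measurable_fun_ifT.
- by apply: measurable_fun_ltr => //; exact: measurable_cst.
- by apply: measurableT_comp => //; exact: oppr_measurable.
- exact: measurable_cst.
Qed.

Lemma decay_ge0 h : (0 <= decay h)%R.
Proof. by rewrite /decay; case: ifP => // _; exact: expR_ge0. Qed.

Lemma decay_lt1 h : (decay h < 1)%R.
Proof. by rewrite /decay; case: ifPn => // h0; rewrite -expR0 ltr_expR oppr_lt0. Qed.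

Lemma nnm_decay : nnm (EFin \o decay).
Proof. exact: nnm_EFin measurable_decay decay_ge0. Qed.

Definition theta : R := fine (\int[k]_h (decay h)%:E).

Lemma thetaE : \int[k]_h (decay h)%:E = theta%:E.
Proof.
rewrite fineK// ge0_fin_numE; last exact: (int_ge0 k nnm_decay).
apply: (@le_lt_trans _ _ (\int[k]_h 1)); last by rewrite int_cst ltry.
apply: int_le; [exact: nnm_decay|exact: nnm_cst|].
by move=> h; rewrite lee_fin ltW// decay_lt1.
Qed.

Lemma theta_ge0 : (0 <= theta)%R.
Proof. by rewrite -lee_fin -thetaE; exact: (int_ge0 k nnm_decay). Qed.

Lemma theta_lt1 : (theta < 1)%R.
Proof.
have mf : measurable_fun [set: R] (fun h => (1 - decay h)%R%:E).
  apply/measurable_EFinP; apply: measurable_funB; first exact: measurable_cst.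
  exact: measurable_decay.
have nf : nnm (fun h => (1 - decay h)%R%:E).
  by split => // h; rewrite lee_fin subr_ge0 ltW// decay_lt1.
have e : theta%:E + \int[k]_h (1 - decay h)%R%:E = 1.
  rewrite -thetaE -intD//; last exact: nnm_decay.
  rewrite -[RHS](int_cst k); apply: eq_integral => h _.
  by rewrite /= -EFinD; congr (_%:E); lra.
have i0 : 0 < \int[k]_h (1 - decay h)%R%:E.
  by apply: int_gt0 => // h _; rewrite lte_fin subr_gt0 decay_lt1.
by rewrite -lte_fin -e lteDl// lte_fin.
Qed.

(** A Chernoff bound: [H >= z + S_n] requires [H >= a] or [S_n < a - z], and the second event has
    probability at most [exp(a - z) * theta^n]. *)
Lemma iter_tail_bound (a : R) n z :
  iter n fwd tail z <= tail a + (expR (a - z) * theta ^+ n)%:E.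
Proof.
elim: n z => [|n ih] z.
  rewrite expr0 mulr1 /=; have [az|za] := leP a z.
    apply: (@le_trans _ _ (tail a)); last by rewrite leeDl// lee_fin expR_ge0.
    apply: int_le.
    - exact: (@nnm_section1 _ _ _ R R (fun z h : R => if (z <= h)%R then 1 else 0) z nnm_ler_pair).
    - exact: (@nnm_section1 _ _ _ R R (fun z h : R => if (z <= h)%R then 1 else 0) a nnm_ler_pair).
    by move=> h; case: (leP z h) => zh; case: (leP a h) => ah//; exfalso; lra.
  apply: (@le_trans _ _ 1).
    rewrite -[leRHS](int_cst k); apply: int_le.
    - exact: (@nnm_section1 _ _ _ R R (fun z h : R => if (z <= h)%R then 1 else 0) z nnm_ler_pair).
    - exact: nnm_cst.
    by move=> h; case: (leP z h) => //; rewrite lee_fin.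
  apply: (@le_trans _ _ ((expR (a - z))%:E)).
    by rewrite lee_fin -expR0 ler_expR; lra.
  by rewrite leeDr//; exact: nnm_tail.2.
have nt := nnm_iter_fwd n nnm_tail.
rewrite iterS /fwd int_pos; last exact: nnm_add_at.
have c0 : (0 <= expR (a - z) * theta ^+ n)%R.
  by rewrite mulr_ge0 ?expR_ge0// exprn_ge0// theta_ge0.
have nc : nnm (fun h => (expR (a - z) * theta ^+ n)%:E * (decay h)%:E).
  by apply: nnmM; [exact: nnm_cst|exact: nnm_decay].
apply: (@le_trans _ _ (\int[k]_h (tail a + (expR (a - z) * theta ^+ n)%:E * (decay h)%:E))).
  apply: int_le.
  - exact/nnm_pos/nnm_add_at.
  - by apply: nnmD => //; apply: nnm_cst; exact: nnm_tail.2.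
  move=> h; rewrite /pos /decay; case: ifPn => h0; last first.
    by rewrite mule0 adde0; exact: nnm_tail.2.
  apply: (le_trans (ih _)); rewrite leeD2l// -EFinM lee_fin.
  by rewrite opprD addrA (expRD (a - z)%R) mulrAC.
rewrite intD//; last by apply: nnm_cst; exact: nnm_tail.2.
rewrite int_cst leeD2l// intZ//; last exact: nnm_decay.
by rewrite thetaE -EFinM exprSr mulrA.
Qed.

Hypothesis ksqrt : \int[k]_h (Num.sqrt h)%:E < +oo.

Lemma nnm_sqrt : nnm (fun h : R => (Num.sqrt h)%:E).
Proof.
apply: nnm_EFin => [|h]; last exact: sqrtr_ge0.
by apply: continuous_measurable_fun; exact: sqrt_continuous.
Qed.

Lemma tail_small (e : R) : (0 < e)%R -> exists a, tail a <= e%:E.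
Proof.
move=> e0; pose c := fine (\int[k]_h (Num.sqrt h)%:E).
have cE : \int[k]_h (Num.sqrt h)%:E = c%:E.
  by rewrite fineK// ge0_fin_numE//; exact: (int_ge0 k nnm_sqrt).
have c0 : (0 <= c)%R by rewrite -lee_fin -cE; exact: (int_ge0 k nnm_sqrt).
(* Markov's inequality for [sqrt H] at level [b] bounds [tail (b^2)] by [c / b <= e]; the added 1
   keeps [b] positive when [c = 0]. *)
pose b := ((c + 1) / e)%R.
have b0 : (0 < b)%R by rewrite divr_gt0//; lra.
exists (b ^+ 2)%R.
have : b%:E * tail (b ^+ 2)%R <= c%:E.
  rewrite -cE /tail -intZ; last 2 first.
  - by rewrite lee_fin ltW.
  - exact: (@nnm_section1 _ _ _ R R (fun z h : R => if (z <= h)%R then 1 else 0) _ nnm_ler_pair).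
  apply: int_le.
  - apply: nnmM; first by apply: nnm_cst; rewrite lee_fin ltW.
    exact: (@nnm_section1 _ _ _ R R (fun z h : R => if (z <= h)%R then 1 else 0) _ nnm_ler_pair).
  - exact: nnm_sqrt.
  move=> h; case: (leP (b ^+ 2)%R h) => bh; last by rewrite mule0 lee_fin sqrtr_ge0.
  by rewrite mule1 lee_fin -(ger0_norm (ltW b0)) -sqrtr_sqr ler_wsqrtr.
move=> bt; have b1 : (0 < b^-1)%R by rewrite invr_gt0.
have : b^-1%:E * (b%:E * tail (b ^+ 2)%R) <= b^-1%:E * c%:E.
  by rewrite lee_pmul2l.
rewrite muleA -EFinM mulVf ?gt_eqF// mul1e => /le_trans; apply.
rewrite -EFinM lee_fin /b invf_div mulrAC ler_pdivrMr; last by lra.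
by rewrite ler_wpM2l//; lra.
Qed.

(** The remainder in [tail_le_sum] vanishes: [a] is taken first so that [tail a] is small, then [n]
    so that [theta^n] beats [exp(a - z)]. *)
Lemma tail_le_series z : tail z <= \sum_(j <oo) iter j fwd dens z.
Proof.
apply/lee_addgt0Pr => e e0.
have e2 : (0 < e / 2)%R by lra.
have [a ta] := tail_small e2.
have [n nt] : exists n, (expR (a - z) * theta ^+ n <= e / 2)%R.
  have E0 : (0 < expR (a - z))%R by exact: expR_gt0.
  have /cvgrPdist_lt/(_ (e / 2 / expR (a - z))%R) : (theta ^+ n @[n --> \oo] --> (0 : R))%R.
    by apply: cvg_expr; rewrite ger0_norm ?theta_ge0// theta_lt1.
  move=> /(_ (divr_gt0 e2 E0)) [n _ /(_ n (leqnn n))] /=.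
  rewrite sub0r normrN ger0_norm; last by rewrite exprn_ge0// theta_ge0.
  by rewrite ltr_pdivlMr// mulrC => /ltW ?; exists n.
apply: (le_trans (tail_le_sum n z)).
apply: leeD.
  apply: (@le_trans _ _ (\sum_(0 <= j < n) iter j fwd dens z)); first by rewrite big_mkord.
  by apply: nneseries_lim_ge => j *; exact: (nnm_iter_fwd j nnm_dens).2.
apply: (le_trans (iter_tail_bound a n z)).
apply: (@le_trans _ _ ((e / 2)%:E + (e / 2)%:E)); last by rewrite -EFinD lee_fin; lra.
by apply: leeD => //; rewrite lee_fin.
Qed.

End stationary_density.

(** * The stationarity inequality *)

Section stationarity.
Context {R : realType}.
Variable k : probability R R.
Local Open Scope ereal_scope.
Implicit Types f g phi : R -> \bar R.
Local Notation leb := (@leb R).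

Hypothesis kpos : k [set h | h <= 0]%R = 0.

Lemma nnm_snd (f : R -> \bar R) : nnm f -> nnm (fun p : R * R => f p.2).
Proof. by move=> nf; exact: (nnm_comp (@measurable_snd _ _ R R) nf). Qed.

(** Substitute [x = z + h]: since [h > 0] almost surely, [z > 0] entails [x > 0] and [h <= x]. *)
Lemma fwd_le_down f phi : nnm f -> nnm phi ->
  \int[leb]_z (pos (fwd k f) z * phi z) <= \int[leb]_x (pos f x * down k phi x).
Proof.
move=> nf nphi.
pose A (h z : R) : \bar R := (if (0 < z)%R then f (z + h)%R else 0) * phi z.
pose B (h x : R) : \bar R := pos f x * (if (h <= x)%R then phi (x - h)%R else 0).
have m0 : measurable_fun [set: R * R] (fun p : R * R => (0 < p.2)%R).
  by apply: measurable_fun_ltr => //; exact: measurable_cst.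
have nA : nnm (fun p : R * R => A p.1 p.2).
  apply: nnmM; last exact: (nnm_snd nphi).
  apply: nnm_if => //.
  have ma : measurable_fun [set: R * R] (fun p => p.2 + p.1)%R by exact: measurable_funD.
  exact: (nnm_comp ma nf).
have nB : nnm (fun p : R * R => B p.1 p.2).
  apply: nnmM; first exact: (nnm_snd (nnm_pos nf)).
  apply: nnm_if; last exact: nnm_cst.
    exact: measurable_fun_ler.
  have ma : measurable_fun [set: R * R] (fun p => p.2 - p.1)%R by exact: measurable_funB.
  exact: (nnm_comp ma nphi).
have -> : \int[leb]_z (pos (fwd k f) z * phi z) = \int[k]_h \int[leb]_z A h z.
  transitivity (\int[leb]_z \int[k]_h A h z); last exact: (esym (tonelli k leb nA)).
  apply: eq_integral => z _.
  have na : nnm (fun h => if (0 < z)%R then f (z + h)%R else 0).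
    by case: (0 < z)%R; [exact: nnm_add_at|exact: nnm_cst].
  rewrite /A; under eq_integral do rewrite muleC.
  rewrite intZ//; last exact: nphi.2.
  by rewrite muleC /pos /fwd; case: ifP => // _; rewrite integral0.
have -> : \int[leb]_x (pos f x * down k phi x) = \int[k]_h \int[leb]_x B h x.
  transitivity (\int[leb]_x \int[k]_h B h x); last exact: (esym (tonelli k leb nB)).
  apply: eq_integral => x _.
  rewrite /B intZ//; first exact: (nnm_pos nf).2.
  exact: nnm_down_at.
have nIA : nnm (fun h => \int[leb]_z A h z) by exact: nnm_int2.
have nIB : nnm (fun h => \int[leb]_z B h z) by exact: nnm_int2.
rewrite (int_pos kpos nIA) (int_pos kpos nIB).
apply: int_le; [exact: nnm_pos|exact: nnm_pos|].
move=> h; rewrite /pos; case: ifPn => // h0.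
have nBh : nnm (B h) by exact: nnm_section1.
rewrite -(integral_shift h nBh); apply: int_le.
- exact: nnm_section1.
- have ma : measurable_fun [set: R] (fun z : R => z + h)%R.
    by apply: measurable_funD => //; exact: measurable_cst.
  exact: (nnm_comp ma nBh).
move=> z; rewrite /A /B /pos; case: ifPn => z0; last first.
  rewrite mul0e; apply: mule_ge0; first by case: ifP => // _; exact: nf.2.
  by case: ifP => // _; exact: nphi.2.
by rewrite ifT ?ifT ?addrK//; lra.
Qed.

(** Substitute [z = h - x], the point to which a step [h > x] reflects [x]; the factor
    [tail (h - z)] of the density becomes [tail x]. *)
Lemma dens_le_up g : nnm g ->
  \int[leb]_z (pos (dens k) z * g z) <= \int[leb]_x (pos (tail k) x * up k g x).
Proof.
move=> ng.
pose A (h z : R) : \bar R :=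
  (if (0 < z)%R then (if (z <= h)%R then tail k (h - z)%R else 0) else 0) * g z.
pose B (h x : R) : \bar R := pos (tail k) x * (if (x < h)%R then g (h - x)%R else 0).
have nt := nnm_tail k.
have mB : measurable_fun [set: R * R] (fun p => p.1 - p.2)%R by exact: measurable_funB.
have nA : nnm (fun p : R * R => A p.1 p.2).
  apply: nnmM; last exact: (nnm_snd ng).
  apply: nnm_if; last exact: nnm_cst.
    by apply: measurable_fun_ltr => //; exact: measurable_cst.
  apply: nnm_if; last exact: nnm_cst.
    exact: measurable_fun_ler.
  exact: (nnm_comp mB nt).
have nB : nnm (fun p : R * R => B p.1 p.2).
  apply: nnmM; first exact: (nnm_snd (nnm_pos nt)).
  apply: nnm_if; last exact: nnm_cst.
    exact: measurable_fun_ltr.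
  exact: (nnm_comp mB ng).
have -> : \int[leb]_z (pos (dens k) z * g z) = \int[k]_h \int[leb]_z A h z.
  transitivity (\int[leb]_z \int[k]_h A h z); last exact: (esym (tonelli k leb nA)).
  apply: eq_integral => z _.
  have nd : nnm (fun h : R => if (z <= h)%R then tail k (h - z)%R else 0).
    exact: (@nnm_section1 _ _ _ R R
      (fun z h : R => if (z <= h)%R then tail k (h - z)%R else 0) z (nnm_dens_pair k)).
  have na : nnm (fun h => if (0 < z)%R then (if (z <= h)%R then tail k (h - z)%R else 0) else 0).
    by case: (0 < z)%R => //; exact: nnm_cst.
  rewrite /A; under eq_integral do rewrite muleC.
  rewrite intZ//; last exact: ng.2.
  by rewrite muleC /pos /dens; case: ifP => // _; rewrite integral0.
have -> : \int[leb]_x (pos (tail k) x * up k g x) = \int[k]_h \int[leb]_x B h x.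
  transitivity (\int[leb]_x \int[k]_h B h x); last exact: (esym (tonelli k leb nB)).
  apply: eq_integral => x _.
  rewrite /B intZ//; first exact: (nnm_pos nt).2.
  exact: nnm_up_at.
apply: int_le; [exact: nnm_int2|exact: nnm_int2|].
move=> h.
have nBh : nnm (B h) by exact: nnm_section1.
have nAh : nnm (A h) by exact: nnm_section1.
have nBr : nnm (fun z : R => B h (h - z)%R).
  have ma : measurable_fun [set: R] (fun z : R => h - z)%R.
    by apply: measurable_funB => //; exact: measurable_cst.
  exact: (nnm_comp ma nBh).
rewrite -(integral_reflect h nBh) le_eqVlt; apply/orP; left; apply/eqP.
(* The two integrands differ at most at the point [h]. *)
apply: ge0_ae_eq_integral => //.
- exact: nAh.1.
- exact: nBr.1.
- by move=> x _; exact: nAh.2.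
- by move=> x _; exact: nBr.2.
exists [set h]; split => //; first exact: leb_set1.
move=> z /= H; apply: contrapT => zh; apply: H => _.
rewrite /A /B /pos; case: (ltP 0%R z) => z0; last first.
  by rewrite mul0e [X in _ * X]ifF ?mule0//; apply/negbTE; rewrite -leNgt; lra.
have -> : (h - z < h)%R by lra.
have -> : (h - (h - z) = z)%R by lra.
congr (_ * _); rewrite subr_gt0 le_eqVlt.
by case: eqVneq => [zh'|//]; case: zh.
Qed.

(** With [r_j = fwd^j dens], the hypothesis on [phi] and [fwd_le_down] give that the integral of
    [r_j * up g] plus that of [r_(j+1) * phi] is at most that of [r_j * phi]. Summed over [j] this
    telescopes, and [tail <= sum_j r_j] brings in the integral of [tail * up g], which [dens_le_up]
    compares with that of [dens * g]. *)
Lemma dens_stationary g phi : nnm g -> nnm phi -> (forall x, g x <= 1) ->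
  (forall x, (0 < x)%R -> up k g x + down k phi x <= phi x) ->
  (forall z, tail k z <= \sum_(j <oo) iter j (fwd k) (dens k) z) ->
  \int[leb]_z (pos (dens k) z * g z) <= \int[leb]_z (pos (dens k) z * phi z).
Proof.
move=> ng nphi g1 gphi tail_le; apply: (le_trans (dens_le_up ng)).
pose r j := iter j (fwd k) (dens k).
have nr j : nnm (r j) := nnm_iter_fwd k j (nnm_dens k).
have nu := nnm_up k ng; have nd := nnm_down k nphi.
have nru j : nnm (fun x => pos (r j) x * up k g x) by apply: nnmM => //; exact: nnm_pos.
have step n : \sum_(j < n) \int[leb]_x (pos (r j) x * up k g x)
    + \int[leb]_x (pos (r n) x * phi x) <= \int[leb]_x (pos (r 0%N) x * phi x).
  elim: n => [|n ih]; first by rewrite big_ord0 add0e.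
  apply: le_trans ih; rewrite big_ord_recr -addeA; apply: leeD => //=.
  apply: (@le_trans _ _ (\int[leb]_x (pos (r n) x * (up k g x + down k phi x)))).
    under [leRHS]eq_integral.
      move=> x _; rewrite ge0_muleDr; [|exact: nu.2|exact: nd.2]; over.
    rewrite intD//; last by apply: nnmM => //; exact: nnm_pos.
    by rewrite leeD2l//; exact: fwd_le_down.
  apply: int_le.
  - by apply: nnmM; [exact: nnm_pos|exact: nnmD].
  - by apply: nnmM => //; exact: nnm_pos.
  move=> x; rewrite /pos; case: ifPn => x0; last by rewrite !mul0e.
  by apply: lee_wpmul2l; [exact: (nr n).2|exact: gphi].
apply: (@le_trans _ _ (\sum_(j <oo) \int[leb]_x (pos (r j) x * up k g x))).
  rewrite -int_series//; apply: int_le.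
  - by apply: nnmM => //; exact/nnm_pos/nnm_tail.
  - exact: nnm_series.
  move=> x; under eq_eseriesr do rewrite muleC.
  (* Finiteness, from [g <= 1], allows the factor [up k g x] to be taken out of the series. *)
  have /fineK <- : up k g x \is a fin_num.
    rewrite ge0_fin_numE; last exact: nu.2.
    apply: (@le_lt_trans _ _ 1); last exact: ltry.
    rewrite -[leRHS](int_cst k); apply: int_le; [exact: nnm_up_at|exact: nnm_cst|].
    by move=> y; case: (x < y)%R => //; exact: lee01.
  rewrite nneseriesZl; last by move=> j _; exact: (nnm_pos (nr j)).2.
  rewrite [leRHS]muleC; apply: lee_wpmul2r; first by rewrite lee_fin fine_ge0//; exact: nu.2.
  rewrite {1}/pos; case: ifPn => x0.
    apply: (le_trans (tail_le x)); apply: lee_nneseries => j *; first exact: (nr j).2.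
    by rewrite /pos x0.
  by apply: nneseries_ge0 => j _ _; exact: (nnm_pos (nr j)).2.
apply: lime_le; first by apply: is_cvg_nneseries => j _ _; exact: int_ge0.
apply: nearW => n; apply: le_trans (step n); rewrite big_mkord leeDl//.
by apply: int_ge0; apply: nnmM => //; exact: nnm_pos.
Qed.

End stationarity.

(** * The density has finite, positive mass *)

Section total_mass.
Context {R : realType}.
Variable k : probability R R.
Local Open Scope ereal_scope.
Local Notation leb := (@leb R).

Hypothesis kpos : k [set h | h <= 0]%R = 0.
Hypothesis ksqrt : \int[k]_h (Num.sqrt h)%:E < +oo.

Definition strip (h h' z : R) : bool := [&& (0 < z)%R, (z <= h)%R & (h - z <= h')%R].

Lemma measurable_strip h h' : measurable_fun [set: R] (strip h h').
Proof.
apply: measurable_and; first by apply: measurable_fun_ltr => //; exact: measurable_cst.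
apply: measurable_and; first by apply: measurable_fun_ler => //; exact: measurable_cst.
apply: measurable_fun_ler; last exact: measurable_cst.
by apply: measurable_funB => //; exact: measurable_cst.
Qed.

(** The strip lies in an interval of length [min(h, h')] if both are positive, and is null
    otherwise; a minimum is at most the geometric mean. *)
Lemma leb_strip h h' : leb [set z | strip h h' z] <= (Num.sqrt h * Num.sqrt h')%:E.
Proof.
have mS : measurable [set z | strip h h' z].
  by rewrite -[X in measurable X]setTI; exact: measurable_strip.
have s0 : (0 <= Num.sqrt h * Num.sqrt h')%R by rewrite mulr_ge0 ?sqrtr_ge0.
have [h0|h0] := leP h 0%R.
  rewrite (_ : [set z | _] = set0) ?measure0 ?lee_fin// -subset0 => z /=.
  by rewrite /strip => /and3P[z0 zh _]; lra.
have [h'0|h'0] := leP h' 0%R.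
  apply: (@le_trans _ _ (leb [set h])); last by rewrite leb_set1 lee_fin.
  apply: le_measure; rewrite ?inE// => z /=.
  by rewrite /strip => /and3P[z0 zh zh']; apply/eqP; rewrite eq_le zh /=; lra.
have [hh'|hh'] := leP h h'.
  apply: (@le_trans _ _ (leb `]0%R, h]%classic)).
    apply: le_measure; rewrite ?inE// => z /=.
    by rewrite /strip in_itv/= => /and3P[z0 zh _]; apply/andP.
  rewrite leb_oc h0 subr0 lee_fin -{1}(sqr_sqrtr (ltW h0)) expr2.
  by rewrite ler_wpM2l ?sqrtr_ge0// ler_wsqrtr.
apply: (@le_trans _ _ (leb `[(h - h')%R, h]%classic)).
  apply: le_measure; rewrite ?inE// => z /=.
  by rewrite /strip in_itv/= => /and3P[z0 zh zh']; apply/andP; split => //; lra.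
rewrite leb_cc ifT; last by lra.
rewrite lee_fin (_ : h - (h - h') = h')%R; last by lra.
rewrite -{1}(sqr_sqrtr (ltW h'0)) expr2 ler_wpM2r ?sqrtr_ge0// ler_wsqrtr// ltW//.
Qed.

Lemma nnm_strip : nnm (fun p : (R * R) * R => if strip p.1.2 p.2 p.1.1 then 1 else 0 : \bar R).
Proof.
apply: (@nnm_if _ _ R (fun p : (R * R) * R => strip p.1.2 p.2 p.1.1) (cst 1) (cst 0)).
- have m11 : measurable_fun [set: (R * R) * R] (fun p => p.1.1).
    by apply: (measurableT_comp measurable_fst); exact: measurable_fst.
  have m12 : measurable_fun [set: (R * R) * R] (fun p => p.1.2).
    by apply: (measurableT_comp measurable_snd); exact: measurable_fst.
  apply: measurable_and; first by apply: measurable_fun_ltr => //; exact: measurable_cst.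
  apply: measurable_and; first exact: measurable_fun_ler.
  by apply: measurable_fun_ler => //; exact: measurable_funB.
- exact: nnm_cst.
- exact: nnm_cst.
Qed.

Lemma pos_densE z :
  pos (dens k) z = \int[k]_h \int[k]_h' (if strip h h' z then 1 else 0).
Proof.
rewrite /pos /dens; case: ifPn => z0; last first.
  rewrite integral0_eq// => h _; rewrite integral0_eq// => h' _.
  by rewrite /strip (negbTE z0).
apply: eq_integral => h _; case: ifPn => zh.
  by apply: eq_integral => h' _; rewrite /strip z0 zh.
by rewrite integral0_eq// => h' _; rewrite /strip (negbTE zh) andbF.
Qed.

Lemma int_pos_dens :
  \int[leb]_z pos (dens k) z = \int[k]_h \int[k]_h' leb [set z | strip h h' z].
Proof.
have n2 : nnm (fun p : R * R => \int[k]_h' (if strip p.2 h' p.1 then 1 else 0)).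
  exact: (@nnm_int2 _ _ _ R R k (fun (p : R * R) h' => if strip p.2 h' p.1 then 1 else 0) nnm_strip).
have n3 h : nnm (fun p : R * R => if strip h p.2 p.1 then 1 else 0 : \bar R).
  have mp : measurable_fun [set: R * R] (fun p => ((p.1, h), p.2)).
    by apply: measurable_fun_pair => //; apply: measurable_fun_pair => //; exact: measurable_cst.
  exact: (nnm_comp mp nnm_strip).
under eq_integral do rewrite pos_densE.
rewrite (tonelli leb k n2); apply: eq_integral => h _.
rewrite (tonelli leb k (n3 h)); apply: eq_integral => h' _.
by rewrite int_if//; exact: measurable_strip.
Qed.

Lemma dens_fin : \int[leb]_z pos (dens k) z < +oo.
Proof.
pose c := fine (\int[k]_h (Num.sqrt h)%:E).
have cE : \int[k]_h (Num.sqrt h)%:E = c%:E.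
  by rewrite fineK// ge0_fin_numE//; exact: (int_ge0 k nnm_sqrt).
have ns := @nnm_sqrt R.
have nl : nnm (fun p : R * R => leb [set z | strip p.1 p.2 z]).
  apply: (@nnm_xsection _ _ (R * R)%type R R leb (fun p z => strip p.1 p.2 z)).
  have m11 : measurable_fun [set: (R * R) * R] (fun p => p.1.1).
    by apply: (measurableT_comp measurable_fst); exact: measurable_fst.
  have m12 : measurable_fun [set: (R * R) * R] (fun p => p.1.2).
    by apply: (measurableT_comp measurable_snd); exact: measurable_fst.
  have mb : measurable_fun [set: (R * R) * R] (fun p => strip p.1.1 p.1.2 p.2).
    apply: measurable_and; first by apply: measurable_fun_ltr => //; exact: measurable_cst.
    apply: measurable_and; first exact: measurable_fun_ler.
    by apply: measurable_fun_ler => //; exact: measurable_funB.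
  by rewrite -[X in measurable X]setTI; exact: mb.
rewrite int_pos_dens; apply: (@le_lt_trans _ _ (\int[k]_h ((Num.sqrt h)%:E * c%:E))).
  apply: int_le.
  - exact: (@nnm_int2 _ _ R R R k (fun h h' => leb [set z | strip h h' z]) nl).
  - apply: nnmM => //; apply: nnm_cst; rewrite -cE; exact: int_ge0.
  move=> h; have sh : 0 <= (Num.sqrt h)%:E by rewrite lee_fin sqrtr_ge0.
  rewrite -cE -(intZ k sh ns).
  apply: int_le.
  - exact: (@nnm_section1 _ _ _ R R (fun h h' => leb [set z | strip h h' z]) h nl).
  - by apply: nnmM => //; apply: nnm_cst; rewrite lee_fin sqrtr_ge0.
  by move=> h'; rewrite -EFinM; exact: leb_strip.
under eq_integral do rewrite muleC.
rewrite intZ//; last by rewrite -cE; exact: int_ge0.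
by rewrite cE -EFinM ltry.
Qed.

(** If [dens] had mass 0 on []0, +oo[], so would every [fwd^j dens] and hence, by [tail_le_series],
    [tail]. But the integral of [tail] over []0, +oo[] is the expectation of [H], which is
    positive. *)
Lemma dens_gt0 : 0 < \int[leb]_z pos (dens k) z.
Proof.
have nd := nnm_dens k.
rewrite lt0e (int_ge0 leb (nnm_pos nd)) andbT; apply/negP => /eqP d0.
have nr j := nnm_iter_fwd k j nd.
have r0 j : \int[leb]_z pos (iter j (fwd k) (dens k)) z = 0.
  elim: j => // j ih; apply/le_anti/andP; split; last exact: (int_ge0 leb (nnm_pos (nr j.+1))).
  rewrite -ih.
  have n1 : nnm (cst 1 : R -> \bar R) by exact: nnm_cst.
  have := fwd_le_down kpos (nr j) n1.
  under eq_integral do rewrite mule1.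
  move=> /le_trans; apply; apply: int_le.
  - by apply: nnmM; [exact: nnm_pos|exact: nnm_down].
  - exact: nnm_pos.
  move=> x; rewrite -[leRHS]mule1; apply: lee_wpmul2l; first exact: (nnm_pos (nr j)).2.
  rewrite -[leRHS](int_cst k); apply: int_le => //; first exact: nnm_down_at.
  by move=> y; case: (y <= x)%R.
have t0 : \int[leb]_z pos (tail k) z <= 0.
  apply: (@le_trans _ _ (\int[leb]_z \sum_(j <oo) pos (iter j (fwd k) (dens k)) z)).
    apply: int_le; [exact/nnm_pos/nnm_tail|by apply: nnm_series => j; exact: nnm_pos|].
    move=> z; rewrite {1}/pos; case: ifPn => z0; last first.
      by apply: nneseries_ge0 => j _ _; exact: (nnm_pos (nr j)).2.
    apply: (le_trans (tail_le_series kpos ksqrt z)).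
    apply: lee_nneseries => j *; first exact: (nr j).2.
    by rewrite /pos z0.
  rewrite int_series; last by move=> j; exact: nnm_pos.
  by rewrite eseries0// => j _ _; exact: r0.
have nt : nnm (fun p : R * R => if (0 < p.1 <= p.2)%R then 1 else 0 : \bar R).
  apply: (@nnm_if _ _ R (fun p : R * R => 0 < p.1 <= p.2)%R (cst 1) (cst 0)).
  - apply: measurable_and; last exact: measurable_fun_ler.
    by apply: measurable_fun_ltr => //; exact: measurable_cst.
  - exact: nnm_cst.
  - exact: nnm_cst.
have e : \int[leb]_z pos (tail k) z = \int[k]_h \int[leb]_z (if (0 < z <= h)%R then 1 else 0).
  rewrite -(tonelli leb k nt); apply: eq_integral => z _.
  rewrite /pos /tail; case: (0 < z)%R => /=; first by [].
  by rewrite integral0.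
move: t0; rewrite e leNgt => /negP; apply.
apply: (int_gt0 kpos).
  exact: (@nnm_int1 _ _ R R R leb (fun z h => if (0 < z <= h)%R then 1 else 0) nt).
move=> h h0; rewrite int_if.
  apply: (@lt_le_trans _ _ h%:E); first by rewrite lte_fin.
  have <- : leb `]0%R, h]%classic = h%:E by rewrite leb_oc h0 subr0.
  rewrite (_ : `]0%R, h]%classic = [set z | (0 < z <= h)%R]); first exact: lexx.
  by apply/seteqP; split => z /=; rewrite in_itv.
apply: measurable_and; first by apply: measurable_fun_ltr => //; exact: measurable_cst.
by apply: measurable_fun_ler => //; exact: measurable_cst.
Qed.

End total_mass.

(** * The walk does not escape to infinity *)

Section no_escape.
Context {R : realType}.
Variables (mu : probability R R) (Pi : probability (increments R) R).
Hypothesis fs : first_step mu Pi.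
Local Open Scope ereal_scope.
Local Notation leb := (@leb R).
Local Notation k := (ladder_law Pi).

Hypothesis kpos : k [set h | h <= 0]%R = 0.
Hypothesis ksqrt : \int[k]_h (Num.sqrt h)%:E < +oo.

Local Notation plow := (plow Pi).
Implicit Types f g : R -> \bar R.

(* Conditioning the walk started at [x] on the first strict ascending ladder epoch of the partial
   sums of the increments. *)
Lemma plow_ladder L m x : (0 <= x)%R ->
  up k (plow L m) x + down k (plow L m.+1) x <= plow L m.+1 x.
Proof.
move=> x0.
have np j := nnm_plow Pi L j.
(* [g h] is the value after a ladder step [h]. Before the ladder epoch the partial sum is some
   [- s <= 0], so the walk is at [x + s] and has not been reflected; this explains [phi] as the
   supersolution. *)
pose g (h : R) : \bar R := if (x < h)%R then plow L m (h - x)%R else plow L m.+1 (x - h)%R.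
pose phi (s : R) : \bar R := plow L m.+1 (x + s)%R.
have ng : nnm g.
  apply: nnm_if.
  - by apply: measurable_fun_ltr => //; exact: measurable_cst.
  - by apply: nnm_comp (np m); apply: measurable_funB => //; exact: measurable_cst.
  - by apply: nnm_comp (np m.+1); apply: measurable_funB => //; exact: measurable_cst.
have nphi : nnm phi.
  by apply: nnm_comp (np m.+1); apply: measurable_funD => //; exact: measurable_cst.
rewrite -updown// -/g (int_pos kpos ng).
have -> : plow L m.+1 x = phi 0%R by rewrite /phi addr0.
apply: (ladder_law_le fs) => // s s0.
rewrite /phi (plow_step fs).
(* Only an increment that reflects the walk has to lower the counter: the others may keep [m.+1], as
   [plow L m.+1 <= plow L m]. *)
apply: (@le_trans _ _ (up mu (plow L m) (x + s)%R + down mu (plow L m.+1) (x + s)%R)).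
  rewrite -updown// -[leRHS]updown//; apply: int_le.
  - apply: nnm_if.
    + by apply: measurable_fun_ltr => //; exact: measurable_cst.
    + by apply: nnm_comp ng; apply: measurable_funB => //; exact: measurable_cst.
    + by apply: nnm_comp nphi; apply: measurable_funB => //; exact: measurable_cst.
  - apply: nnm_if.
    + by apply: measurable_fun_ltr => //; exact: measurable_cst.
    + by apply: nnm_comp (np m); apply: measurable_funB => //; exact: measurable_cst.
    + by apply: nnm_comp (np m.+1); apply: measurable_funB => //; exact: measurable_cst.
  move=> y; rewrite le_eqVlt; apply/orP; left; apply/eqP; rewrite /g /phi.
  case: (ltP s y) => sy; case: (ltP (x + s)%R y) => xy.
  - by rewrite ifT ?opprD ?addrA; [rewrite addrAC|lra].
  - by rewrite ifF; [congr (plow _ _ _); lra|apply/negbTE; rewrite -leNgt; lra].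
  - by exfalso; lra.
  - by rewrite addrA.
by rewrite leeD2l//; apply: down_le => // z _; exact: plowS.
Qed.

Definition mass (f : R -> \bar R) : \bar R := \int[leb]_z (pos (dens k) z * f z).

Let nd : nnm (pos (dens k)). Proof. exact/nnm_pos/nnm_dens. Qed.

Lemma mass_le f g : nnm f -> nnm g -> (forall z, (0 < z)%R -> f z <= g z) -> mass f <= mass g.
Proof.
move=> nf ng fg; apply: int_le; [exact: nnmM|exact: nnmM|].
move=> z; rewrite /pos; case: ifPn => z0; last by rewrite !mul0e.
by apply: lee_wpmul2l; [exact: (nnm_dens k).2|exact: fg].
Qed.

Lemma massD f g : nnm f -> nnm g -> mass (fun z => f z + g z) = mass f + mass g.
Proof.
move=> nf ng; rewrite /mass -intD; [|exact: nnmM|exact: nnmM].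
by apply: eq_integral => z _; rewrite ge0_muleDr//; [exact: nf.2|exact: ng.2].
Qed.

(** Each increase of [m] is the stationarity inequality with [g = plow L m] and [phi = plow L m.+1].
    Together with [plowS], the averaged probability of a visit below [L] after time [m] does not
    depend on [m]. *)
Lemma mass_plow L m : mass (plow L 0) <= mass (plow L m).
Proof.
elim: m => // m /le_trans; apply.
apply: (dens_stationary kpos); [exact: nnm_plow|exact: nnm_plow|exact: plow_le1| |].
- by move=> x /ltW; exact: plow_ladder.
- exact: tail_le_series.
Qed.

Definition escape (x : R) (w : increments R) : Prop :=
  forall K : nat, exists m, ~ low K%:R m x w.

Lemma escape_indep x x' w : escape x w -> escape x' w.
Proof.
move=> e K; pose J := Num.truncn `|x - x'|%R.
have [m mJ] := e (K + J.+1)%N; exists m => -[n mn xn]; apply: mJ; exists n => //.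
have := rwalk_contract x x' n w.
rewrite natrD => H; have J1 : (`|x - x'| < J.+1%:R)%R by exact: truncnS_gt.
by have := ler_norm (rwalk x n w - rwalk x' n w)%R; lra.
Qed.

Lemma measurable_escape_pair :
  measurable [set z : R * increments R | escape z.1 z.2].
Proof.
rewrite (_ : [set z | _] = \bigcap_(K : nat) \bigcup_m
    ~` [set z : R * increments R | low K%:R m z.1 z.2]).
  apply: bigcapT_measurable => K; apply: bigcupT_measurable => m.
  by apply: measurableC; exact: measurable_low.
apply/seteqP; split => z /= ez K; first by move=> _; have [m] := ez K; exists m.
by have [m _ ?] := ez K I; exists m.
Qed.

Lemma measurable_escape x : measurable [set w | escape x w].
Proof. exact: (measurable_section x measurable_escape_pair). Qed.

Definition pesc (K m : nat) (x : R) : \bar R := Pi [set w | ~ low K%:R m x w].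

Lemma measurable_nlow K m : measurable [set z : R * increments R | ~ low K%:R m z.1 z.2].
Proof. by apply: measurableC; exact: measurable_low. Qed.

Lemma measurable_nlow_at K m (x : R) : measurable [set w | ~ low K%:R m x w].
Proof. by apply: measurableC; exact: measurable_low_at. Qed.

Lemma nnm_pesc K m : nnm (pesc K m).
Proof. exact: (nnm_xsection Pi (measurable_nlow K m)). Qed.

Lemma plow_pesc K m x : plow K%:R m x + pesc K m x = 1.
Proof.
rewrite /plow /pesc addeC.
have := @probability_setC _ _ _ Pi _ (measurable_low_at K%:R m x).
rewrite (_ : [set w | ~ low _ _ _ w] = ~` [set w | low K%:R m x w])// => ->.
rewrite subeK// fin_num_measure//; exact: measurable_low_at.
Qed.

Theorem escape_null x : Pi [set w | escape x w] = 0.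
Proof.
pose q := Pi [set w | escape 0%R w].
have qE z : Pi [set w | escape z w] = q.
  by congr (Pi _); apply/seteqP; split => w; exact: escape_indep.
rewrite qE.
pose one : R -> \bar R := cst 1.
have n1 : nnm one by exact: nnm_cst.
have m1 : mass one = \int[leb]_z pos (dens k) z.
  by apply: eq_integral => z _; rewrite mule1.
have mfin : mass one \is a fin_num.
  rewrite ge0_fin_numE; last by apply: int_ge0; exact: nnmM.
  by rewrite m1; exact: dens_fin.
pose small (K : nat) (z : R) : \bar R := if (z <= K%:R)%R then 1 else 0.
have nsmall K : nnm (small K).
  apply: (@nnm_if _ _ R (fun z : R => z <= K%:R)%R (cst 1) (cst 0)).
  - by apply: measurable_fun_ler => //; exact: measurable_cst.
  - exact: nnm_cst.
  - exact: nnm_cst.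
have msfin K : mass (small K) \is a fin_num.
  rewrite ge0_fin_numE; last by apply: int_ge0; exact: nnmM.
  apply: (@le_lt_trans _ _ (mass one)); last by rewrite m1; exact: dens_fin.
  by apply: mass_le => // z _; rewrite /small; case: ifP => // _; exact: lee01.
(* A walk started in []0, K]] is low at time 0, so [small K <= plow K 0], and [mass_plow] carries
   this mass to every [m]. *)
have bound K m : mass (pesc K m) <= mass one - mass (small K).
  rewrite leeBrDr//.
  have -> : mass one = mass (pesc K m) + mass (plow K%:R m).
    rewrite -massD; [|exact: nnm_pesc|exact: nnm_plow].
    by apply: eq_integral => z _; rewrite addeC plow_pesc.
  rewrite leeD2l//; apply: le_trans (mass_plow K%:R m).
  apply: mass_le => //; first exact: nnm_plow.
  move=> z z0; rewrite /small; case: ifPn => zK; last exact: measure_ge0.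
  rewrite /plow (_ : [set w | _] = setT) ?probability_setT//.
  by apply/seteqP; split => // w _; exists 0%N.
have q0 : 0 <= q by exact: measure_ge0.
have nq : nnm (cst q : R -> \bar R) by exact: nnm_cst.
have qfin : q \is a fin_num by rewrite fin_num_measure//; exact: measurable_escape.
have mq : mass (cst q) = q * mass one.
  rewrite m1 -intZ//; apply: eq_integral => z _; by rewrite muleC.
(* Let [m] tend to infinity with [K] fixed: [escape] is contained in the increasing union of the
   events of not being low after [m], and its probability is [q] from every starting point. *)
have bq K : mass (cst q) <= mass one - mass (small K).
  apply: (int_le_lim (F_ := fun m z => pos (dens k) z * pesc K m z)).
  - by move=> m; apply: nnmM => //; exact: nnm_pesc.
  - move=> z i j ij; apply: lee_wpmul2l; first exact: nd.2.
    apply: le_measure; rewrite ?inE; [exact: measurable_nlow_at..|].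
    by move=> w /= nl [n jn wn]; apply: nl; exists n => //; exact: leq_trans jn.
  - exact: nnmM.
  - move=> z.
    have dfin : pos (dens k) z \is a fin_num.
      rewrite ge0_fin_numE; last exact: nd.2.
      apply: (@le_lt_trans _ _ 1); last exact: ltry.
      rewrite /pos; case: ifPn => z0; last exact: lee01.
      rewrite -[leRHS](int_cst k) /dens; apply: int_le; last first.
      + move=> h; case: ifP => // _.
        rewrite -[leRHS](int_cst k) /tail; apply: int_le; last first.
        * by move=> h'; case: ifP => // _; exact: lee01.
        * exact: nnm_cst.
        * exact: (@nnm_section1 _ _ _ R R (fun z h : R => if (z <= h)%R then 1 else 0) _ (@nnm_ler_pair R)).
      + exact: nnm_cst.
      + exact: (@nnm_section1 _ _ _ R R (fun z h : R => if (z <= h)%R then tail k (h - z)%R else 0) z (nnm_dens_pair k)).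
    have mn m : measurable [set w | ~ low K%:R m z w].
      exact: measurable_nlow_at.
    have c : pesc K m z @[m --> \oo] --> Pi (\bigcup_m [set w | ~ low K%:R m z w]).
      apply: nondecreasing_cvg_mu => //; first exact: bigcupT_measurable.
      move=> i j ij; apply/subsetPset => w /= nl [n jn wn]; apply: nl; exists n => //.
      exact: leq_trans jn.
    rewrite (cvg_lim _ (cvgeZl dfin c))//; apply: lee_wpmul2l; first exact: nd.2.
    rewrite -(qE z); apply: le_measure; rewrite ?inE.
    + exact: measurable_escape.
    + exact: bigcupT_measurable.
    + by move=> w /(_ K)[m ?]; exists m.
  - exact: bound.
(* Now let [K] tend to infinity: [small K] increases to 1. As the total mass is finite and positive,
   what remains forces [q = 0]. *)
have key : mass one <= mass one - mass (cst q).
  have mqf : mass (cst q) \is a fin_num by rewrite mq fin_numM.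
  apply: (int_le_ex (F_ := fun K z => pos (dens k) z * small K z)).
  - by move=> K; exact: nnmM.
  - move=> z i j ij; apply: lee_wpmul2l; first exact: nd.2.
    rewrite /small; case: ifPn => zi; last by case: ifP.
    by rewrite ifT// (le_trans zi)// ler_nat.
  - exact: nnmM.
  - move=> z; exists (Num.truncn z).+1; rewrite /small ifT//.
    exact/ltW/truncnS_gt.
  - by move=> K; rewrite -/(mass (small K)) leeBrDr// addeC -leeBrDr//; exact: bq.
have : mass (cst q) <= 0.
  by move: key; rewrite leeBrDr ?mq ?fin_numM// -[leRHS]adde0 leeD2lE.
rewrite mq => qm; apply/eqP; rewrite eq_le q0 andbT leNgt; apply/negP => qp.
move: qm; rewrite leNgt => /negP; apply; apply: mule_gt0 => //.
by rewrite m1; exact: dens_gt0.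
Qed.

End no_escape.

(** * Square root moment of the ladder height *)

Section duality.
Context {R : realType}.
Variable mu : probability R R.
Local Open Scope ereal_scope.
Implicit Types (f q : R -> \bar R) (F G : R * R -> \bar R).

(* Transition of the pair (S_n, S_n - min_{m <= n} S_m). *)
Definition record_step (p : R * R) (y : R) : R * R :=
  (p.1 + y, Num.max (Num.max p.2 0 + y) 0)%R.

Definition record F (p : R * R) : \bar R := \int[mu]_y F (record_step p y).

Lemma measurable_record_step :
  measurable_fun [set: (R * R) * R] (fun z => record_step z.1 z.2).
Proof.
have m11 : measurable_fun [set: (R * R) * R] (fun p => p.1.1).
  by apply: (measurableT_comp measurable_fst); exact: measurable_fst.
have m12 : measurable_fun [set: (R * R) * R] (fun p => p.1.2).
  by apply: (measurableT_comp measurable_snd); exact: measurable_fst.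
apply: measurable_fun_pair; first exact: measurable_funD.
apply: measurable_maxr; last exact: measurable_cst.
by apply: measurable_funD => //; apply: measurable_maxr => //; exact: measurable_cst.
Qed.

Lemma nnm_record_pair F : nnm F -> nnm (fun z : (R * R) * R => F (record_step z.1 z.2)).
Proof. by move=> nF; exact: (nnm_comp measurable_record_step nF). Qed.

Lemma nnm_record_at F p : nnm F -> nnm (fun y => F (record_step p y)).
Proof.
move=> nF; exact: (@nnm_section1 R _ _ (R * R)%type R
  (fun p y => F (record_step p y)) p (nnm_record_pair nF)).
Qed.

Lemma nnm_record F : nnm F -> nnm (record F).
Proof.
move=> nF; exact: (@nnm_int2 _ _ (R * R)%type R R mu
  (fun p y => F (record_step p y)) (nnm_record_pair nF)).
Qed.

Lemma nnm_iter_record n F : nnm F -> nnm (iter n record F).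
Proof. by move=> nF; elim: n => //= n; exact: nnm_record. Qed.

(** Tonelli for the iterates; joint measurability in the parameter and the state is carried through
    the same induction. *)
Lemma iter_record_int n (G : R -> R * R -> \bar R) :
  nnm (fun z : R * (R * R) => G z.1 z.2) ->
  nnm (fun z : R * (R * R) => iter n record (G z.1) z.2) /\
  forall p, iter n record (fun p => \int[mu]_y G y p) p = \int[mu]_y iter n record (G y) p.
Proof.
move=> nG; elim: n => // n [nI eI].
have n3 : nnm (fun z : (R * (R * R)) * R =>
    iter n record (G z.1.1) (record_step z.1.2 z.2)).
  have m11 : measurable_fun [set: (R * (R * R)) * R] (fun p => p.1.1).
    by apply: (measurableT_comp measurable_fst); exact: measurable_fst.
  have m12 : measurable_fun [set: (R * (R * R)) * R] (fun p => p.1.2).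
    by apply: (measurableT_comp measurable_snd); exact: measurable_fst.
  have mr : measurable_fun [set: (R * (R * R)) * R] (fun z => record_step z.1.2 z.2).
    have mp : measurable_fun [set: (R * (R * R)) * R] (fun z => (z.1.2, z.2)).
      exact: measurable_fun_pair.
    exact: (measurableT_comp measurable_record_step mp).
  have mg : measurable_fun [set: (R * (R * R)) * R] (fun z => (z.1.1, record_step z.1.2 z.2)).
    exact: measurable_fun_pair.
  exact: (nnm_comp mg nI).
split.
  exact: (@nnm_int2 _ _ (R * (R * R))%type R R mu
    (fun z y => iter n record (G z.1) (record_step z.2 y)) n3).
move=> p; rewrite /= {1}/record.
have n2 : nnm (fun z : R * R => iter n record (G z.2) (record_step p z.1)).
  have mp : measurable_fun [set: R * R] (fun z => ((z.2, p), z.1)).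
    by apply: measurable_fun_pair => //; apply: measurable_fun_pair => //; exact: measurable_cst.
  exact: (nnm_comp mp n3).
rewrite -(tonelli mu mu n2); apply: eq_integral => y _; exact: eI.
Qed.

(** For [c = 0] this selects the times at which [S_n] equals its running minimum and evaluates [f]
    at the depth [- S_n]. The maximum with 0 gives a meaning to arbitrary pairs, so no invariant of
    the chain has to be maintained. *)
Definition at_record f c (p : R * R) : \bar R :=
  if (Num.max p.2 0 <= c)%R then f (c - p.1)%R else 0.

Lemma nnm_at_record_pair f : nnm f ->
  nnm (fun z : R * (R * R) => at_record f z.1 z.2).
Proof.
move=> nf.
have m21 : measurable_fun [set: R * (R * R)] (fun p => p.2.1).
  by apply: (measurableT_comp measurable_fst); exact: measurable_snd.
have m22 : measurable_fun [set: R * (R * R)] (fun p => p.2.2).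
  by apply: (measurableT_comp measurable_snd); exact: measurable_snd.
apply: nnm_if.
- by apply: measurable_fun_ler => //; apply: measurable_maxr => //; exact: measurable_cst.
- have ms : measurable_fun [set: R * (R * R)] (fun p => p.1 - p.2.1)%R by exact: measurable_funB.
  exact: (nnm_comp ms nf).
- exact: nnm_cst.
Qed.

Lemma nnm_at_record f c : nnm f -> nnm (at_record f c).
Proof. by move=> nf; exact: (@nnm_section1 R _ _ R (R * R)%type (at_record f) c (nnm_at_record_pair nf)). Qed.

(* Time reversal of the first [n] increments: staying nonnegative for the walk [c - S] becomes
   being near a record minimum. *)
Lemma iter_down_dual n f c : nnm f -> (0 <= c)%R ->
  iter n (down mu) f c = iter n record (at_record f c) (0, 0)%R.
Proof.
move=> nf; elim: n c => [|n ih] c c0.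
  by rewrite /= /at_record /= maxxx c0 subr0.
pose G (y : R) p := if (y <= c)%R then at_record f (c - y)%R p else 0.
have nG : nnm (fun z : R * (R * R) => G z.1 z.2).
  apply: nnm_if.
  - by apply: measurable_fun_ler => //; exact: measurable_cst.
  - have ms : measurable_fun [set: R * (R * R)] (fun p => (c - p.1, p.2))%R.
      by apply: measurable_fun_pair => //; apply: measurable_funB => //; exact: measurable_cst.
    exact: (nnm_comp ms (nnm_at_record_pair nf)).
  - exact: nnm_cst.
(* The last step of the record chain corresponds to the first step of the killed walk, hence the
   iteration is unfolded at its inner end. *)
have -> : iter n.+1 record (at_record f c) = iter n record (fun p => \int[mu]_y G y p).
  rewrite iterSr; congr (iter n record _); apply/funext => p.
  apply: eq_integral => y _; rewrite /G /at_record /record_step /=.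
  set w := Num.max p.2 0%R.
  have w0 : (0 <= w)%R by rewrite le_max lexx orbT.
  rewrite (max_idPl _ : Num.max (Num.max (w + y) 0) 0 = Num.max (w + y) 0)%R; last first.
    by rewrite le_max lexx orbT.
  rewrite ge_max c0 andbT opprD [(- p.1 - y)%R]addrC addrA.
  have [yc|yc] := leP y c; last by rewrite ifF//; apply/negbTE; rewrite -ltNge; lra.
  by rewrite (_ : (w + y <= c) = (w <= c - y))%R// lerBrDr.
rewrite (iter_record_int n nG).2 /= {1}/down; apply: eq_integral => y _.
rewrite /G; case: ifPn => yc; first by rewrite ih// subr_ge0.
suff -> : iter n record (fun=> 0) = fun=> 0 by [].
elim: (n) => //= m ->; apply/funext => p; exact: integral0.
Qed.

Definition cumul q (delta M : R) : \bar R := \sum_(j <oo) q (M + j%:R * delta)%R.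

Variables (q : R -> \bar R) (delta : R).
Hypotheses (nq : nnm q) (q_noninc : forall x y, (x <= y)%R -> q y <= q x) (delta0 : (0 < delta)%R).

Lemma nnm_cumul : nnm (cumul q delta).
Proof.
apply: nnm_series => j; apply: nnm_comp nq.
by apply: measurable_funD => //; exact: measurable_cst.
Qed.

Lemma cumul_noninc x y : (x <= y)%R -> cumul q delta y <= cumul q delta x.
Proof.
move=> xy; apply: lee_nneseries => j *; first exact: nq.2.
by apply: q_noninc; rewrite lerD2r.
Qed.

Lemma cumulE M : cumul q delta M = q M + cumul q delta (M + delta)%R.
Proof.
rewrite /cumul nneseries_recl//; last by move=> j _; exact: nq.2.
rewrite mul0r addr0; congr (_ + _); rewrite -nneseries_addn; last by move=> j; exact: nq.2.
by apply: eq_eseriesr => j _; congr q; rewrite natrD mulrDl mul1r -addrA [(delta + _)%R]addrC.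
Qed.

(** The argument of [cumul] is the depth of the running minimum, and [cumul] sums [q] over all
    depths still to come if these are spaced by [delta]. *)
Definition lyapunov (p : R * R) : \bar R := cumul q delta (Num.max p.2 0 - p.1)%R.

Lemma nnm_lyapunov : nnm lyapunov.
Proof.
apply: nnm_comp nnm_cumul; apply: measurable_funB; last exact: measurable_fst.
by apply: measurable_maxr; [exact: measurable_snd|exact: measurable_cst].
Qed.

(** The depth [M] never decreases, so [lyapunov] never increases. From a record minimum, an
    increment [y <= - delta] raises [M] by at least [delta], which removes the term [q M] from the
    sum. *)
Lemma record_lyapunov (p : R * R) :
  mu [set y | y <= - delta]%R * at_record q 0%R p + record lyapunov p <= lyapunov p.
Proof.
set w := Num.max p.2 0%R; set M := (w - p.1)%R.
have w0 : (0 <= w)%R by rewrite le_max lexx orbT.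
have noninc y : lyapunov (record_step p y) <= cumul q delta M.
  apply: cumul_noninc; rewrite /record_step /= -/w.
  apply: (@le_trans _ _ (w + y - (p.1 + y))%R); first by rewrite /M; lra.
  by rewrite lerB// !le_max lexx.
have nL := nnm_lyapunov.
have mb : measurable_fun [set: R] (fun y => y <= - delta)%R.
  by apply: measurable_fun_ler => //; exact: measurable_cst.
have [wp|wn] := ltP 0%R w.
  rewrite /at_record -/w ifF; last by apply/negbTE; rewrite -ltNge.
  rewrite mule0 add0e -[leRHS](int_cst mu); apply: int_le.
  - exact: nnm_record_at.
  - apply: nnm_cst; exact: nL.2.
  - exact: noninc.
have we : w = 0%R by apply/le_anti/andP.
rewrite /at_record -/w wn.
have qM : q (0 - p.1)%R = q M by rewrite /M we.
have n0 : nnm (fun y : R => if (y <= - delta)%R then 1 else 0 : \bar R).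
  by apply: (@nnm_if _ R R (fun y => y <= - delta)%R (cst 1) (cst 0)) => //; exact: nnm_cst.
have n1 : nnm (fun y : R => q M * (if (y <= - delta)%R then 1 else 0)).
  by apply: nnmM n0; apply: nnm_cst; exact: nq.2.
rewrite qM muleC -(int_if mu mb) -(intZ mu (nq.2 M) n0).
rewrite /record -intD//; last exact: nnm_record_at.
rewrite -[leRHS](int_cst mu); apply: int_le.
- by apply: nnmD => //; exact: nnm_record_at.
- by apply: nnm_cst; exact: nL.2.
move=> y; case: ifPn => yd; last by rewrite mule0 add0e; exact: noninc.
rewrite mule1 [leRHS]cumulE leeD2l//; apply: cumul_noninc; rewrite /M /w.
have we' : Num.max p.2 0%R = 0%R := we.
have y0 : Num.max (0 + y)%R 0%R = 0%R.
  by apply/max_idPr; rewrite add0r; apply: (le_trans yd); rewrite oppr_le0 ltW.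
by rewrite /record_step /= we' y0 maxxx; lra.
Qed.

(** By [iter_down_dual] the sum on the left is the expected sum of [q] over the depths of the record
    minima up to time [N]; [record_lyapunov], added up along the chain, bounds it. *)
Lemma dual_bound N :
  mu [set y | y <= - delta]%R * \sum_(n < N) iter n (down mu) q 0%R <= cumul q delta 0%R.
Proof.
have nL := nnm_lyapunov; have na := nnm_at_record 0%R nq.
set p0 := mu _; have p00 : 0 <= p0 by exact: measure_ge0.
have -> : cumul q delta 0%R = lyapunov (0, 0)%R by rewrite /lyapunov /= maxxx subr0.
have -> : \sum_(n < N) iter n (down mu) q 0%R = \sum_(n < N) iter n record (at_record q 0%R) (0, 0)%R.
  by apply: eq_bigr => n _; exact: iter_down_dual.
move: (0, 0)%R; elim: N => [|N ih] p; first by rewrite big_ord0 mule0; exact: nL.2.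
rewrite big_ord_recl /= ge0_muleDr; last 2 first.
- exact: na.2.
- by apply: sume_ge0 => n _; exact: (nnm_iter_record n.+1 na).2.
apply: le_trans (record_lyapunov p); rewrite -/p0 leeD2l//.
rewrite /record -(@int_sum _ _ _ mu (fun n y => iter n record (at_record q 0%R) (record_step p y))); last first.
  by move=> n; exact/nnm_record_at/nnm_iter_record.
have ns : nnm (fun y : R => \sum_(n < N) iter n record (at_record q 0%R) (record_step p y)).
  apply: (@nnm_sum _ R R (fun n y => iter n record (at_record q 0%R) (record_step p y))) => n.
  exact/nnm_record_at/nnm_iter_record.
rewrite -intZ//; apply: int_le; [by apply: nnmM; [exact: nnm_cst|exact: ns]|exact: nnm_record_at|].
by move=> y; exact: ih.
Qed.

End duality.

(** * Ladder heights: common bounds and the case of positive drift *)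

Section ladder_moments.
Context {R : realType}.
Variables (mu : probability R R) (Pi : probability (increments R) R).
Hypothesis fs : first_step mu Pi.
Local Open Scope ereal_scope.

Definition yp (y : R) : R := Num.max y 0%R.
Definition yn (y : R) : R := Num.max (- y)%R 0%R.

Lemma measurable_yp : measurable_fun [set: R] yp.
Proof. by apply: measurable_maxr => //; exact: measurable_cst. Qed.

Lemma measurable_yn : measurable_fun [set: R] yn.
Proof.
apply: measurable_maxr; last exact: measurable_cst.
exact: oppr_measurable.
Qed.

Lemma yp_ge0 y : (0 <= yp y)%R. Proof. by rewrite le_max lexx orbT. Qed.

Lemma yn_ge0 y : (0 <= yn y)%R. Proof. by rewrite le_max lexx orbT. Qed.

Lemma yp_id y : (0 <= y)%R -> yp y = y. Proof. by move=> y0; apply/max_idPl. Qed.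

Lemma yp_eq0 y : (y <= 0)%R -> yp y = 0%R. Proof. by move=> y0; apply/max_idPr. Qed.

Lemma yn_id y : (y <= 0)%R -> yn y = (- y)%R.
Proof. by move=> y0; apply/max_idPl; rewrite oppr_ge0. Qed.

Lemma yn_eq0 y : (0 <= y)%R -> yn y = 0%R.
Proof. by move=> y0; apply/max_idPr; rewrite oppr_le0. Qed.

Lemma nnm_yp : nnm (EFin \o yp).
Proof. exact: nnm_EFin measurable_yp yp_ge0. Qed.

Lemma nnm_yn : nnm (EFin \o yn).
Proof. exact: nnm_EFin measurable_yn yn_ge0. Qed.

Lemma nnm_sqrt_yp : nnm (fun y : R => (Num.sqrt (yp y))%:E).
Proof. exact: (nnm_comp measurable_yp (@nnm_sqrt R)). Qed.

Let n1 : nnm (cst 1 : R -> \bar R). Proof. exact: nnm_cst. Qed.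

Lemma down_cst_le (c : \bar R) x : 0 <= c -> down mu (cst c) x <= c.
Proof.
move=> c0; rewrite -[leRHS](int_cst mu); apply: int_le.
- by apply: nnm_down_at; exact: nnm_cst.
- exact: nnm_cst.
- by move=> y; case: (y <= x)%R.
Qed.

Lemma iter_down_noninc n m x : (0 <= x)%R -> (n <= m)%N ->
  iter m (down mu) (cst 1) x <= iter n (down mu) (cst 1) x.
Proof.
move=> x0 /subnK <-; elim: (m - n)%N => // j; apply: le_trans.
rewrite addSn; elim: (j + n)%N x x0 => [|i ih] x x0; first exact: down_cst_le.
by apply: down_le; [exact: (nnm_iter_down mu i.+1 n1)|exact: (nnm_iter_down mu i n1)|exact: ih].
Qed.

(** The terms decrease in [n]. This turns a bound on the expected time before the ladder epoch into
    one on the probability of no ladder height within [N] steps. *)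
Lemma iter_down_avg N :
  (N%:R)%:E * iter N (down mu) (cst 1) 0%R <= \sum_(n < N) iter n (down mu) (cst 1) 0%R.
Proof.
suff H M : (M <= N)%N -> (M%:R)%:E * iter N (down mu) (cst 1) 0%R <=
    \sum_(n < M) iter n (down mu) (cst 1) 0%R by exact: H.
elim: M => [|M ih] MN; first by rewrite big_ord0 mul0e.
rewrite big_ord_recr -natr1 EFinD ge0_muleDl ?lee_fin//.
rewrite mul1e; apply: leeD; first exact/ih/ltnW.
by apply: iter_down_noninc => //; exact: ltnW.
Qed.

Lemma no_ladder_null : (forall e : R, (0 < e)%R ->
    exists n, iter n (down mu) (cst 1) 0%R <= e%:E) ->
  ladder_law Pi [set h | h <= 0]%R = 0.
Proof.
move=> H; apply/eqP; rewrite eq_le measure_ge0 andbT.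
apply/lee_addgt0Pr => e e0; rewrite add0e.
by have [n ne] := H e e0; exact: (le_trans (no_ladder_le fs n)).
Qed.

Lemma ladder_sqrt_le phi : nnm phi ->
  (forall z, (0 <= z)%R -> up mu (fun h => (Num.sqrt h)%:E) z + down mu phi z <= phi z) ->
  \int[ladder_law Pi]_h (Num.sqrt h)%:E <= phi 0%R.
Proof.
move=> nphi H; apply: le_trans (ladder_law_le fs (@nnm_sqrt R) nphi H).
apply: int_le; [exact: nnm_sqrt|exact/nnm_pos/nnm_sqrt|].
by move=> h; rewrite /pos; case: ltP => // h0; rewrite ler0_sqrtr.
Qed.

Lemma up_sqrt_le z : (0 <= z)%R ->
  up mu (fun h => (Num.sqrt h)%:E) z <= \int[mu]_y (Num.sqrt (yp y))%:E.
Proof.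
move=> z0; apply: int_le; [exact: (nnm_up_at z (@nnm_sqrt R))|exact: nnm_sqrt_yp|].
move=> y; case: (ltP z y) => zy; last by rewrite lee_fin sqrtr_ge0.
by rewrite lee_fin ler_wsqrtr// yp_id; lra.
Qed.

Section positive_drift.
Hypothesis drift : \int[mu]_y (yn y)%:E < \int[mu]_y (yp y)%:E.
Hypothesis sqrt_fin : \int[mu]_y (Num.sqrt (yp y))%:E < +oo.

Lemma nnm_min_yp (M : nat) : nnm (fun y => (Num.min (yp y) M%:R)%:E).
Proof.
apply: nnm_EFin; last by move=> y; rewrite le_min yp_ge0 ler0n.
by apply: measurable_minr; [exact: measurable_yp|exact: measurable_cst].
Qed.

(** [E(Y_1^+)] may be infinite; by monotone convergence the strict inequality survives a truncation,
    after which both sides are finite. *)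
Lemma truncated_drift : exists M : nat,
  \int[mu]_y (yn y)%:E < \int[mu]_y (Num.min (yp y) M%:R)%:E.
Proof.
apply: contrapT => H; move: drift; rewrite ltNge => /negP; apply.
apply: (int_le_ex (F_ := fun M y => (Num.min (yp y) M%:R)%:E)).
- exact: nnm_min_yp.
- move=> y i j ij; rewrite lee_fin le_min ge_min lexx/= ge_min.
  by rewrite ler_nat ij orbT.
- exact: nnm_yp.
- move=> y; exists (Num.truncn (yp y)).+1; rewrite lee_fin le_min lexx/=.
  exact/ltW/truncnS_gt.
- by move=> M; rewrite leNgt; apply/negP => MH; apply: H; exists M.
Qed.

(** [c] is the truncated drift. For [y <= z] the function falls by [y], in the mean by at least [c]
    after truncation of [y^+]. For [y > z] the walk is killed and the whole value, at least
    [M >= min(y^+, M)], is lost: this is the purpose of the constant [M]. *)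
Lemma linear_supersolution : exists c M : R, [/\ (0 < c)%R, (0 <= M)%R &
  forall z, (0 <= z)%R -> c%:E + down mu (fun s => (M + yp s)%:E) z <= (M + yp z)%:E].
Proof.
have [M HM] := truncated_drift.
set n := \int[mu]_y (yn y)%:E in HM; set a := \int[mu]_y _ in HM.
have nM : nnm (fun s => (M%:R + yp s)%:E).
  apply: nnm_EFin; last by move=> s; rewrite addr_ge0// yp_ge0.
  by apply: measurable_funD; [exact: measurable_cst|exact: measurable_yp].
have afin : a \is a fin_num.
  rewrite ge0_fin_numE; last exact/int_ge0/nnm_min_yp.
  apply: (@le_lt_trans _ _ (M%:R)%:E); last exact: ltry.
  rewrite -[leRHS](int_cst mu); apply: int_le; first exact: nnm_min_yp.
    by apply: nnm_cst; rewrite lee_fin.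
  by move=> y; rewrite lee_fin ge_min lexx orbT.
have n0 : 0 <= n by exact: (int_ge0 mu nnm_yn).
have nfin : n \is a fin_num by rewrite ge0_fin_numE// (lt_trans HM)// ltey_eq afin.
exists (fine a - fine n)%R, M%:R; split.
- by rewrite subr_gt0 fine_lt.
- exact: ler0n.
move=> z z0.
have key : down mu (fun s => (M%:R + yp s)%:E) z + a <= (M%:R + yp z)%:E + n.
  have nc : nnm (fun y : R => (M%:R + yp z)%:E).
    by apply: nnm_cst; rewrite lee_fin addr_ge0// yp_ge0.
  rewrite -[X in _ <= X + n](int_cst mu) /a /n /down.
  rewrite -(intD mu (nnm_down_at z nM) (nnm_min_yp M)) -(intD mu nc nnm_yn); apply: int_le.
  - exact: (nnmD (nnm_down_at z nM) (nnm_min_yp M)).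
  - exact: nnmD nc nnm_yn.
  move=> y; rewrite (yp_id z0).
  have [yz|zy] := leP y z.
    rewrite (@yp_id (z - y)%R) ?subr_ge0// -!EFinD lee_fin.
    have [y0|y0] := leP 0%R y.
      by rewrite yn_eq0// yp_id// addr0 -addrA lerD2l -lerBrDl ge_min; apply/orP; left; lra.
    rewrite (yn_id (ltW y0)) (yp_eq0 (ltW y0)).
    have : (Num.min 0 M%:R <= (0:R))%R by rewrite ge_min lexx.
    lra.
  rewrite add0e -EFinD lee_fin yn_eq0; last by lra.
  have : (Num.min (yp y) M%:R <= (M%:R:R))%R by rewrite ge_min lexx orbT.
  lra.
rewrite EFinB !fineK// addeAC leeBlDr// addeC (le_trans _ key)//.
Qed.

Lemma positive_drift_ladder :
  ladder_law Pi [set h | h <= 0]%R = 0 /\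
  \int[ladder_law Pi]_h (Num.sqrt h)%:E < +oo.
Proof.
have [c [M [c0 M0 V]]] := linear_supersolution.
have nV : nnm (fun s => (M + yp s)%:E).
  apply: nnm_EFin; last by move=> s; rewrite addr_ge0// yp_ge0.
  by apply: measurable_funD; [exact: measurable_cst|exact: measurable_yp].
split.
  apply: no_ladder_null => e e0.
  (* From [c * N * iter N down 1 <= M], it is enough that [N > M / (c * e)]. *)
  pose N := (Num.truncn (M / c / e)).+1; exists N.
  have N0 : (0 < N%:R :> R)%R by rewrite ltr0n.
  have := iter_down_avg N.
  have S : c%:E * \sum_(n < N) iter n (down mu) (cst 1) 0%R <= M%:E.
    have nc : nnm (cst c%:E : R -> \bar R) by apply: nnm_cst; rewrite lee_fin ltW.
    have := potential_le N nc nV V (lexx 0%R).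
    rewrite yp_id// addr0; apply: le_trans.
    rewrite ge0_sume_distrr; last by move=> n _; exact: (nnm_iter_down mu _ n1).2.
    apply: lee_sum => n _; elim: (n : nat) (0%R) => [|m ih] x; first by rewrite mule1.
    rewrite /= -downZ; [|by rewrite lee_fin ltW|exact: nnm_iter_down].
    apply: down_le; [|exact: nnm_iter_down|by move=> z _; exact: ih].
    by apply: nnmM; [exact: nc|exact: nnm_iter_down].
  move=> avg.
  have : c%:E * ((N%:R)%:E * iter N (down mu) (cst 1) 0%R) <= M%:E.
    by apply: le_trans S; apply: lee_wpmul2l => //; rewrite lee_fin ltW.
  rewrite muleA -EFinM -lee_pdivlMl; last by rewrite mulr_gt0.
  move=> /le_trans; apply; rewrite -EFinM lee_fin mulrC ler_pdivrMr ?mulr_gt0//.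
  have : (M / c / e < N%:R)%R by exact: truncnS_gt.
  by rewrite !ltr_pdivrMr// => /ltW; lra.
have := sqrt_fin; set s := \int[mu]_y _ => sfin.
have s0 : 0 <= s by exact: (int_ge0 mu nnm_sqrt_yp).
(* Chosen so that [t * c] is the moment [s], which bounds [up] of the square root; [t] times the
   linear supersolution then absorbs the overshoot. *)
pose t := (fine s / c)%R.
have t0 : (0 <= t)%R by rewrite divr_ge0// ?fine_ge0// ltW.
have sE : s = (t * c)%:E by rewrite /t divfK ?gt_eqF// fineK// ge0_fin_numE.
apply: (@le_lt_trans _ _ (t%:E * (M + yp 0%R)%:E)); last by rewrite -EFinM ltry.
apply: (@ladder_sqrt_le (fun z => t%:E * (M + yp z)%:E)).
  by apply: nnmM nV; apply: nnm_cst.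
move=> z z0; rewrite downZ ?lee_fin//.
apply: (@le_trans _ _ (t%:E * (c%:E + down mu (fun s => (M + yp s)%:E) z))).
  have ce0 : 0 <= c%:E by rewrite lee_fin ltW.
  rewrite (ge0_muleDr _ ce0 ((nnm_down mu nV).2 z)).
  by rewrite leeD2r// -EFinM -sE; exact: up_sqrt_le.
by apply: lee_wpmul2l; [rewrite lee_fin|exact: V].
Qed.

End positive_drift.

End ladder_moments.

(** * Ladder heights: the case of zero drift *)

Section zero_drift.
Context {R : realType}.
Variables (mu : probability R R) (Pi : probability (increments R) R).
Hypothesis fs : first_step mu Pi.
Local Open Scope ereal_scope.

Lemma count_multiples (delta x : R) n : (0 < delta)%R -> (0 <= x)%R ->
  (\sum_(j < n) ((j%:R * delta <= x)%R)%:R <= x / delta + 1 :> R)%R.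
Proof.
move=> d0 x0; elim: n => [|n ih].
  by rewrite big_ord0 addr_ge0// divr_ge0// ltW.
rewrite big_ord_recr /=; have [nx|nx] := leP (n%:R * delta)%R x; last by rewrite addr0.
apply: lerD; last by [].
apply: (@le_trans _ _ n%:R); last by rewrite ler_pdivlMr.
have -> : (n%:R = \sum_(j < n) 1 :> R)%R by rewrite sumr_const card_ord.
by apply: ler_sum => j _; case: (_ <= x)%R.
Qed.

(** A smooth substitute for [|z|], above it by at most [L] and with second derivative at most
    [1 / L]: a large [L] makes second-order errors small. *)
Definition smooth_abs (L z : R) : R := Num.sqrt (z ^+ 2 + L ^+ 2).

Definition excess (B y : R) : R := Num.max (`|y| - B)%R 0%R.

(** A first-order expansion at [z], with slope [z / smooth_abs L z] in [[0, 1]]. If [|y| <= 2B] the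
    error is at most [2 B^2 / L]; if [|y| > 2B] it is at most [2|y| <= 4 (|y| - B)]. The linear term
    is split into [yp] and [yn] on opposite sides so that all integrands are nonnegative. *)
Lemma smooth_abs_step (L B z y : R) : (0 < L)%R -> (0 <= B)%R -> (0 <= z)%R ->
  (smooth_abs L (z - y) + z / smooth_abs L z * yp y <=
   smooth_abs L z + z / smooth_abs L z * yn y + (4 * excess B y + 2 * B ^+ 2 / L))%R.
Proof.
move=> L0 B0 z0; rewrite /smooth_abs.
set g := Num.sqrt (z ^+ 2 + L ^+ 2); set G := Num.sqrt _.
have g2 : (g ^+ 2 = z ^+ 2 + L ^+ 2)%R by rewrite sqr_sqrtr// addr_ge0// sqr_ge0.
have G2 : (G ^+ 2 = (z - y) ^+ 2 + L ^+ 2)%R by rewrite sqr_sqrtr// addr_ge0// sqr_ge0.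
have gge0 : (0 <= g)%R by exact: sqrtr_ge0.
have Gge0 : (0 <= G)%R by exact: sqrtr_ge0.
have gL : (L <= g)%R by rewrite -ler_sqr ?nnegrE ?(ltW L0)// g2 lerDr sqr_ge0.
have gz : (z <= g)%R by rewrite -ler_sqr ?nnegrE// g2 lerDl sqr_ge0.
have g0 : (0 < g)%R by exact: lt_le_trans gL.
have zg0 : (0 <= z / g)%R by rewrite divr_ge0.
have zg1 : (z / g <= 1)%R by rewrite ler_pdivrMr ?mul1r.
suff key : (G <= g - z / g * y + (4 * excess B y + 2 * B ^+ 2 / L))%R.
  have e : (y = yp y - yn y)%R.
    by have [y0|/ltW y0] := leP 0%R y; [rewrite yp_id// yn_eq0// subr0|rewrite yp_eq0// yn_id// sub0r opprK].
  have : (z / g * y = z / g * yp y - z / g * yn y)%R by rewrite -mulrBr -e.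
  by lra.
have ex0 : (0 <= excess B y)%R by rewrite le_max lexx orbT.
have ex1 : (`|y| - B <= excess B y)%R by rewrite le_max lexx.
have bL : (0 <= 2 * B ^+ 2 / L)%R by rewrite divr_ge0 ?mulr_ge0 ?sqr_ge0// ltW.
have [yB|By] := leP `|y|%R (2 * B)%R.
  (* The tangent line of the square root at [g^2], that is, [2 g G <= g^2 + G^2]. *)
  have h1 : (G <= g + (y ^+ 2 - 2 * z * y) / (2 * g))%R.
    have e : (y ^+ 2 - 2 * z * y = G ^+ 2 - g ^+ 2)%R by rewrite G2 g2; ring.
    have -> : (g + (y ^+ 2 - 2 * z * y) / (2 * g) = (g ^+ 2 + G ^+ 2) / (2 * g))%R.
      by rewrite e; field; rewrite gt_eqF.
    rewrite ler_pdivlMr ?mulr_gt0//.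
    have := sqr_ge0 (g - G)%R; nra.
  apply: (le_trans h1).
  have -> : ((y ^+ 2 - 2 * z * y) / (2 * g) = y ^+ 2 / (2 * g) - z / g * y)%R.
    by field; rewrite gt_eqF.
  have : (y ^+ 2 / (2 * g) <= 2 * B ^+ 2 / L)%R.
    rewrite ler_pdivrMr ?mulr_gt0//.
    apply: (@le_trans _ _ ((2 * B) ^+ 2)%R).
      by rewrite -real_normK ?num_real// ler_pXn2r ?nnegrE// mulr_ge0.
    apply: (@le_trans _ _ (2 * B ^+ 2 / L * (2 * L))%R); last first.
      by rewrite ler_wpM2l// ler_wpM2l.
    by rewrite le_eqVlt; apply/orP; left; apply/eqP; field; rewrite gt_eqF.
  by lra.
have h2 : (G <= g + `|y|)%R.
  rewrite -ler_sqr ?nnegrE ?addr_ge0// G2 (sqrrD g) g2.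
  have : (- y <= `|y|)%R by rewrite -normrN ler_norm.
  rewrite [(`|y| ^+ 2)%R]real_normK ?num_real//.
  have := normr_ge0 y; nra.
have : (z / g * y <= `|y|)%R.
  apply: (@le_trans _ _ (z / g * `|y|)%R); first by rewrite ler_wpM2l// ler_norm.
  by rewrite -[leRHS]mul1r ler_wpM2r.
by lra.
Qed.

Implicit Types f g : R -> \bar R.

Let n1 : nnm (cst 1 : R -> \bar R). Proof. exact: nnm_cst. Qed.

Lemma iter_down_le n f g x : nnm f -> nnm g -> (forall z, (0 <= z)%R -> f z <= g z) ->
  (0 <= x)%R -> iter n (down mu) f x <= iter n (down mu) g x.
Proof.
move=> nf ng fg; elim: n x => [|n ih] x x0; first exact: fg.
by apply: down_le; [exact: nnm_iter_down|exact: nnm_iter_down|exact: ih].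
Qed.

Lemma iter_downD n f g x : nnm f -> nnm g ->
  iter n (down mu) (fun z => f z + g z) x = iter n (down mu) f x + iter n (down mu) g x.
Proof.
move=> nf ng; elim: n x => // n ih x; rewrite !iterS.
by rewrite -downD; [congr (down mu _ x); apply/funext|exact: nnm_iter_down|exact: nnm_iter_down].
Qed.

Lemma iter_downZ n (c : \bar R) f x : 0 <= c -> nnm f ->
  iter n (down mu) (fun z => c * f z) x = c * iter n (down mu) f x.
Proof.
move=> c0 nf; elim: n x => // n ih x; rewrite !iterS.
by rewrite -downZ//; [congr (down mu _ x); apply/funext|exact: nnm_iter_down].
Qed.

Hypothesis neg_part : 0 < \int[mu]_y (yn y)%:E.

Lemma negative_steps : exists2 delta : R, (0 < delta)%R &
  0 < mu [set y | y <= - delta]%R.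
Proof.
apply: contrapT => H; move: neg_part; rewrite ltNge => /negP; apply.
have mu0 (j : nat) : mu [set y | y <= - j.+1%:R^-1]%R = 0.
  apply/eqP; rewrite eq_le measure_ge0 andbT leNgt; apply/negP => mj; apply: H.
  by exists j.+1%:R^-1%R.
have mb (j : nat) : measurable_fun [set: R] (fun y => y <= - j.+1%:R^-1)%R.
  by apply: measurable_fun_ler => //; exact: measurable_cst.
(* [F j] increases to [yn], yet is bounded by [j] and supported on a set that would be null. *)
pose F (j : nat) (y : R) : \bar R := if (y <= - j.+1%:R^-1)%R then (Num.min (yn y) j%:R)%:E else 0.
have nm j : nnm (fun y : R => (Num.min (yn y) j%:R)%:E).
  apply: nnm_EFin; last by move=> y; rewrite le_min yn_ge0 ler0n.
  by apply: measurable_minr; [exact: measurable_yn|exact: measurable_cst].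
have nF j : nnm (F j) by apply: nnm_if => //; exact: nnm_cst.
apply: (int_le_ex (F_ := F)) => //.
- move=> y i j ij; rewrite /F; case: ifPn => yi; last by case: ifP => // _; exact: (nm j).2.
  rewrite ifT.
    by rewrite lee_fin le_min ge_min lexx/= ge_min ler_nat ij orbT.
  apply: (le_trans yi); rewrite lerN2 lef_pV2 ?posrE ?ltr0n//.
  by rewrite ler_nat ltnS.
- exact: nnm_yn.
- move=> y; have [y0|y0] := leP 0%R y.
    by exists 0%N => /=; rewrite yn_eq0//; exact: (nF 0%N).2.
  pose m := maxn (Num.truncn (yn y)).+1 (Num.truncn (- y)^-1)%R.
  have m1 : (yn y <= m%:R)%R.
    apply: (@le_trans _ _ (Num.truncn (yn y)).+1%:R%R); first exact/ltW/truncnS_gt.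
    by rewrite ler_nat leq_maxl.
  have m2 : (y <= - m.+1%:R^-1)%R.
    have y1 : (0 < - y)%R by rewrite oppr_gt0.
    rewrite lerNr -[leRHS]invrK lef_pV2 ?posrE ?invr_gt0 ?ltr0n//.
    apply: (@le_trans _ _ (Num.truncn (- y)^-1).+1%:R%R); first exact/ltW/truncnS_gt.
    by rewrite ler_nat ltnS leq_maxr.
  by exists m; rewrite /F m2 /= (min_idPl m1).
move=> j; apply: (@le_trans _ _ (\int[mu]_y ((j%:R)%:E * (if (y <= - j.+1%:R^-1)%R then 1 else 0)))).
  have ni : nnm (fun y : R => if (y <= - j.+1%:R^-1)%R then 1 else 0 : \bar R).
    by apply: (@nnm_if _ R R (fun y => y <= - j.+1%:R^-1)%R (cst 1) (cst 0)) => //; exact: nnm_cst.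
  apply: int_le => //; first by apply: nnmM ni; apply: nnm_cst; rewrite lee_fin.
  move=> y; rewrite /F; case: ifP => _; last by rewrite mule0.
  by rewrite mule1 lee_fin ge_min lexx orbT.
have ni : nnm (fun y : R => if (y <= - j.+1%:R^-1)%R then 1 else 0 : \bar R).
  by apply: (@nnm_if _ R R (fun y => y <= - j.+1%:R^-1)%R (cst 1) (cst 0)) => //; exact: nnm_cst.
have e : \int[mu]_y (if (y <= - j.+1%:R^-1)%R then 1 else 0) = 0.
  by rewrite int_if//; exact: mu0.
by rewrite intZ ?lee_fin// e mule0.
Qed.

Hypothesis centered : \int[mu]_y (yn y)%:E = \int[mu]_y (yp y)%:E.
Hypothesis moment32 : \int[mu]_y (Num.sqrt (yp y) ^+ 3)%:E < +oo.

Lemma nnm_sqrt3 : nnm (fun y : R => (Num.sqrt (yp y) ^+ 3)%:E).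
Proof.
apply: nnm_EFin; last by move=> y; rewrite exprn_ge0 ?sqrtr_ge0.
apply: measurable_funX; apply/measurable_EFinP; exact: nnm_sqrt_yp.1.
Qed.

Lemma yp_fin : \int[mu]_y (yp y)%:E < +oo.
Proof.
apply: (@le_lt_trans _ _ (\int[mu]_y (1 + (Num.sqrt (yp y) ^+ 3)%:E))).
  apply: int_le; [exact: nnm_yp|exact: nnmD nnm_sqrt3|].
  move=> y; rewrite lee_fin; set w := Num.sqrt (yp y).
  have w0 : (0 <= w)%R by exact: sqrtr_ge0.
  rewrite -(sqr_sqrtr (yp_ge0 y)) -/w; have [w1|/ltW w1] := leP w 1%R.
    have : (w ^+ 2 <= 1)%R by rewrite expr_le1.
    by have : (0 <= w ^+ 3)%R by [exact: exprn_ge0]; lra.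
  have : (w ^+ 2 <= w ^+ 3)%R by rewrite ler_weXn2l.
  by lra.
by rewrite intD//; [rewrite int_cst lte_add_pinfty ?ltry|exact: nnm_sqrt3].
Qed.

Let m0 := fine (\int[mu]_y (yp y)%:E).

Let ypE : \int[mu]_y (yp y)%:E = m0%:E.
Proof. by rewrite fineK// ge0_fin_numE ?yp_fin//; exact: (int_ge0 mu (@nnm_yp R)). Qed.

Let ynE : \int[mu]_y (yn y)%:E = m0%:E.
Proof. by rewrite centered. Qed.

Lemma normE (y : R) : `|y|%R = (yp y + yn y)%R.
Proof.
have [y0|/ltW y0] := leP 0%R y; first by rewrite ger0_norm// yp_id// yn_eq0// addr0.
by rewrite ler0_norm// yp_eq0// yn_id// add0r.
Qed.

Let nabs : nnm (fun y : R => `|y|%R%:E).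
Proof. by apply: nnm_EFin => // y; exact: normr_ge0. Qed.

Let absE : \int[mu]_y `|y|%R%:E = (m0 + m0)%:E.
Proof.
rewrite EFinD -{1}ypE -ynE -intD; [|exact: nnm_yp|exact: nnm_yn].
by apply: eq_integral => y _; rewrite normE.
Qed.

Lemma nnm_excess B : nnm (fun y : R => (excess B y)%:E).
Proof.
apply: nnm_EFin; last by move=> y; rewrite le_max lexx orbT.
apply: measurable_maxr; last exact: measurable_cst.
by apply: measurable_funB => //; exact: measurable_cst.
Qed.

(** [min(|y|, B)] increases to the integrable function [|y|], and [excess B] is the difference. *)
Lemma excess_small (e : R) : (0 < e)%R -> exists B : nat, \int[mu]_y (excess B%:R y)%:E <= e%:E.
Proof.
move=> e0; apply: contrapT => H.
pose F (B : nat) (y : R) := (Num.min `|y| B%:R)%R%:E.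
have nF B : nnm (F B).
  apply: nnm_EFin; last by move=> y; rewrite le_min normr_ge0 ler0n.
  by apply: measurable_minr => //; exact: measurable_cst.
have FE B : \int[mu]_y F B y + \int[mu]_y (excess B%:R y)%:E = (m0 + m0)%:E.
  rewrite -absE -intD//; last exact: nnm_excess.
  apply: eq_integral => y _; rewrite /F /excess -EFinD; congr (_%:E).
  have [yB|/ltW yB] := leP `|y|%R B%:R.
    by rewrite (max_idPr _) ?subr_le0// addr0.
  by rewrite (max_idPl _) ?subr_ge0// addrC subrK.
have : \int[mu]_y `|y|%R%:E <= (m0 + m0 - e)%:E.
  apply: (int_le_ex (F_ := F)) => //.
  - by move=> y i j ij; rewrite lee_fin le_min ge_min lexx/= ge_min ler_nat ij orbT.
  - move=> y; exists (Num.truncn `|y|%R).+1; rewrite lee_fin le_min lexx/=.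
    exact/ltW/truncnS_gt.
  - move=> B; have eB : e%:E <= \int[mu]_y (excess B%:R y)%:E.
      by rewrite leNgt; apply/negP => /ltW eB; apply: H; exists B.
    by rewrite EFinB leeBrDr// -(FE B); exact: leeD2l.
by rewrite absE lee_fin; lra.
Qed.

Lemma smooth_abs_ge0 L z : (0 <= smooth_abs L z)%R.
Proof. exact: sqrtr_ge0. Qed.

Lemma nnm_smooth_abs L : nnm (fun z : R => (smooth_abs L z)%:E).
Proof.
apply: nnm_EFin (smooth_abs_ge0 L).
have ms : measurable_fun [set: R] (@Num.sqrt R).
  by apply: continuous_measurable_fun; exact: sqrt_continuous.
apply: (measurableT_comp ms); apply: measurable_funD; last exact: measurable_cst.
exact: measurable_funX.
Qed.

(** The linear terms of [smooth_abs_step] integrate to the same finite value on both sides because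
    the mean is zero, and cancel. Killing only decreases the left-hand side. *)
Lemma down_smooth_abs (L e : R) (B : nat) z : (0 < L)%R -> (0 <= z)%R ->
  \int[mu]_y (excess B%:R y)%:E <= e%:E ->
  down mu (fun z => (smooth_abs L z)%:E) z <=
    (smooth_abs L z + (4 * e + 2 * B%:R ^+ 2 / L))%:E.
Proof.
move=> L0 z0 exB; set a := (z / smooth_abs L z)%R; set b := (2 * B%:R ^+ 2 / L)%R.
have a0 : (0 <= a)%R by rewrite divr_ge0// smooth_abs_ge0.
have b0 : (0 <= b)%R by rewrite divr_ge0 ?mulr_ge0 ?sqr_ge0// ltW.
have nL := nnm_smooth_abs L.
have np := @nnm_yp R; have nn := @nnm_yn R; have ne := nnm_excess B%:R.
have nap : nnm (fun y => a%:E * (yp y)%:E) by apply: nnmM np; apply: nnm_cst; rewrite lee_fin.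
have nan : nnm (fun y => a%:E * (yn y)%:E) by apply: nnmM nn; apply: nnm_cst; rewrite lee_fin.
have nae : nnm (fun y => 4%:E * (excess B%:R y)%:E) by apply: nnmM ne; apply: nnm_cst; rewrite lee_fin.
have ncst : nnm (fun y : R => (smooth_abs L z + b)%:E).
  by apply: nnm_cst; rewrite lee_fin addr_ge0// smooth_abs_ge0.
have nd := nnm_down_at z nL.
have key : \int[mu]_y ((if (y <= z)%R then (smooth_abs L (z - y))%:E else 0) + a%:E * (yp y)%:E)
    <= \int[mu]_y ((smooth_abs L z + b)%:E + (a%:E * (yn y)%:E + 4%:E * (excess B%:R y)%:E)).
  apply: int_le; [exact: nnmD nd nap|exact: nnmD ncst (nnmD nan nae)|].
  move=> y; apply: (@le_trans _ _ ((smooth_abs L (z - y))%:E + a%:E * (yp y)%:E)).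
    by rewrite leeD2r//; case: (y <= z)%R => //; rewrite lee_fin smooth_abs_ge0.
  rewrite -!EFinM -!EFinD lee_fin.
  have := @smooth_abs_step L B%:R z y L0 (ler0n _ _) z0; rewrite -/a -/b; lra.
move: key; rewrite intD// intD//; last exact: nnmD.
rewrite intD// !intZ ?lee_fin// int_cst ypE ynE -/(down mu _ z) => key.
have : down mu (fun z => (smooth_abs L z)%:E) z + a%:E * m0%:E <=
    (smooth_abs L z + (4 * e + b))%:E + a%:E * m0%:E.
  apply: (le_trans key); rewrite addeCA addeC leeD2r//.
  rewrite (_ : smooth_abs L z + (4 * e + b) = smooth_abs L z + b + 4 * e)%R; last by lra.
  rewrite [X in _ <= X]EFinD leeD2l// EFinM.
  by apply: lee_wpmul2l; rewrite ?lee_fin.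
by rewrite leeD2rE.
Qed.

(** The slope in [n] can be made arbitrarily small by taking [B] and then [L] large, so the mean
    height of the killed walk is sublinear in [n]. *)
Lemma iter_smooth_abs (L e : R) (B : nat) n z : (0 < L)%R -> (0 <= e)%R -> (0 <= z)%R ->
  \int[mu]_y (excess B%:R y)%:E <= e%:E ->
  iter n (down mu) (fun z => (smooth_abs L z)%:E) z <=
    (smooth_abs L z + n%:R * (4 * e + 2 * B%:R ^+ 2 / L))%:E.
Proof.
move=> L0 e0 z0 exB; set d := (4 * e + 2 * B%:R ^+ 2 / L)%R.
have d0 : (0 <= d)%R.
  by apply: addr_ge0; [exact: mulr_ge0|rewrite divr_ge0 ?(ltW L0)// mulr_ge0 ?sqr_ge0].
elim: n z z0 => [|n ih] z z0; first by rewrite mul0r addr0.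
have nL := nnm_smooth_abs L.
have nd : nnm (cst (n%:R * d)%:E : R -> \bar R) by apply: nnm_cst; rewrite lee_fin mulr_ge0.
apply: (@le_trans _ _ (down mu (fun z => (smooth_abs L z)%:E + (n%:R * d)%:E) z)).
  by apply: down_le => [||x x0]; [exact: nnm_iter_down|exact: nnmD|rewrite -EFinD; exact: ih].
rewrite downD//; apply: (@le_trans _ _ ((smooth_abs L z + d)%:E + (n%:R * d)%:E)).
  by apply: leeD; [exact: down_smooth_abs|apply: down_cst_le; rewrite lee_fin mulr_ge0].
by rewrite -EFinD lee_fin -natr1; lra.
Qed.

Lemma nnm_le_cst (K : R) : nnm (fun z : R => if (z <= K)%R then 1 else 0 : \bar R).
Proof.
apply: (@nnm_if _ R R (fun z => z <= K)%R (cst 1) (cst 0)).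
- by apply: measurable_fun_ler => //; exact: measurable_cst.
- exact: nnm_cst.
- exact: nnm_cst.
Qed.

Lemma cumul_le_cst (K delta : R) : (0 <= K)%R -> (0 < delta)%R ->
  cumul (fun z : R => if (z <= K)%R then 1 else 0) delta 0%R <= (K / delta + 1)%:E.
Proof.
move=> K0 d0; apply: lime_le.
  by apply: is_cvg_nneseries => j _ _; exact: (nnm_le_cst K).2.
apply: nearW => n; rewrite big_mkord.
have -> : \sum_(j < n) (if (0 + j%:R * delta <= K)%R then 1 else 0) =
    (\sum_(j < n) ((j%:R * delta <= K)%R)%:R : R)%R%:E.
  by rewrite -sumEFin; apply: eq_bigr => j _; rewrite add0r; case: (_ <= K)%R.
by rewrite lee_fin; exact: count_multiples.
Qed.

(** The killed walk at time [n] is at height at most [K] or above [K]. Summed over [n < N], the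
    first case costs at most [(K / delta + 1) / p] by [dual_bound]; each term of the second is at
    most [(L + N d) / K] by Markov's inequality for [smooth_abs]. Dividing by [N] and using
    monotonicity gives the claim. *)
Lemma zero_drift_crossing (e : R) : (0 < e)%R ->
  exists n, iter n (down mu) (cst 1) 0%R <= e%:E.
Proof.
move=> e0'; pose e1 := (e / 4)%R; have e0 : (0 < e1)%R by rewrite divr_gt0.
have [delta delta0 p'0] := negative_steps.
set p' := mu _ in p'0; pose p := fine p'.
have pE : p' = p%:E.
  rewrite fineK// fin_num_measure//.
  rewrite -[X in measurable X]setTI.
  by apply: (@measurable_fun_ler _ _ R setT id (cst (- delta))%R).
have p0 : (0 < p)%R by rewrite -lte_fin -pE.
(* With [K = eta * N], the four error terms are [K / (delta p) = e1 N], [1 / p], [N L / K = L / eta]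
   and [N^2 d / K = N d / eta]. The choice of [B] and [L] gives [d <= e1 * eta], that of [N] bounds
   the two constant terms, and each of the four is at most [e N / 4]. *)
pose eta := (e1 * p * delta)%R; have eta0 : (0 < eta)%R by rewrite !mulr_gt0.
have [B exB] := @excess_small (e1 * eta / 8)%R (divr_gt0 (mulr_gt0 e0 eta0) (ltr0Sn _ _)).
pose L := (4 * B%:R ^+ 2 / (e1 * eta) + 1)%R.
have L0 : (0 < L)%R.
  by rewrite ltr_wpDl// divr_ge0 ?(mulr_ge0 _ (sqr_ge0 _))// mulr_ge0// ltW.
pose d := (4 * (e1 * eta / 8) + 2 * B%:R ^+ 2 / L)%R.
have d0 : (d <= e1 * eta)%R.
  have : (2 * B%:R ^+ 2 / L <= e1 * eta / 2)%R.
    rewrite ler_pdivrMr// /L mulrDr mulr1.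
    have -> : (e1 * eta / 2 * (4 * B%:R ^+ 2 / (e1 * eta)) = 2 * B%:R ^+ 2)%R.
      by field; rewrite !gt_eqF.
    by rewrite lerDl ltW// divr_gt0// mulr_gt0.
  by rewrite /d; lra.
pose N := (Num.truncn ((p * e1)^-1 + L / (eta * e1))).+1.
have NB : ((p * e1)^-1 + L / (eta * e1) < N%:R)%R by exact: truncnS_gt.
have N0 : (0 < N%:R :> R)%R by rewrite ltr0n.
have pe0 : (0 < (p * e1)^-1)%R by rewrite invr_gt0 mulr_gt0.
have Le0 : (0 < L / (eta * e1))%R by rewrite divr_gt0// mulr_gt0.
have N1 : (p^-1 <= e1 * N%:R)%R.
  have : ((p * e1)^-1 * e1 <= N%:R * e1)%R by rewrite ler_wpM2r ?ltW//; lra.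
  by rewrite invfM -mulrA mulVf ?gt_eqF// mulr1 mulrC.
have N2 : (L / eta <= e1 * N%:R)%R.
  have : (L / (eta * e1) * e1 <= N%:R * e1)%R by rewrite ler_wpM2r ?ltW//; lra.
  by rewrite (_ : L / (eta * e1) * e1 = L / eta)%R; [lra|field; rewrite !gt_eqF].
pose K := (eta * N%:R)%R; have K0 : (0 < K)%R by rewrite mulr_gt0.
exists N.
pose qK (z : R) : \bar R := if (z <= K)%R then 1 else 0.
have nq : nnm qK := nnm_le_cst K.
have nL := nnm_smooth_abs L.
have nKL : nnm (fun z => K^-1%:E * (smooth_abs L z)%:E).
  by apply: nnmM nL; apply: nnm_cst; rewrite lee_fin ltW// invr_gt0.
have d1 : (0 <= d)%R.
  by apply: addr_ge0; [rewrite mulr_ge0// divr_ge0// mulr_ge0// ltW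
                      |rewrite divr_ge0 ?(ltW L0)// mulr_ge0 ?sqr_ge0].
(* Above [K], the constant 1 is at most [smooth_abs L z / K]. *)
have split1 (n : nat) : (n < N)%N -> iter n (down mu) (cst 1) 0%R <=
    iter n (down mu) qK 0%R + (K^-1 * (L + N%:R * d))%:E.
  move=> nN; apply: (@le_trans _ _ (iter n (down mu)
      (fun z => qK z + K^-1%:E * (smooth_abs L z)%:E) 0%R)).
    apply: iter_down_le => //; first exact: nnmD.
    move=> z z0; rewrite /qK; case: ifPn => zK.
      by rewrite leeDl// -EFinM lee_fin mulr_ge0 ?smooth_abs_ge0// invr_ge0 ltW.
    rewrite add0e -EFinM lee_fin mulrC ler_pdivlMr// mul1r.
    apply: (@le_trans _ _ z); first by rewrite ltW// ltNge.
    rewrite -[leLHS]ger0_norm// -sqrtr_sqr ler_wsqrtr// lerDl sqr_ge0//.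
  rewrite iter_downD// leeD2l// iter_downZ//; last by rewrite lee_fin invr_ge0 ltW.
  rewrite EFinM; apply: lee_wpmul2l; first by rewrite lee_fin invr_ge0 ltW.
  apply: (@le_trans _ _ (smooth_abs L 0 + n%:R * d)%:E).
    apply: (iter_smooth_abs n L0 _ (lexx 0%R) exB).
    by rewrite divr_ge0// mulr_ge0// ltW.
  rewrite lee_fin; apply: lerD; last by rewrite ler_wpM2r// ler_nat ltnW.
  by rewrite /smooth_abs expr0n /= add0r sqrtr_sqr gtr0_norm.
have sumq : \sum_(n < N) iter n (down mu) qK 0%R <= ((K / delta + 1) / p)%:E.
  have := dual_bound mu nq _ delta0 N.
  rewrite -/p' pE => H.
  rewrite mulrC EFinM lee_pdivlMl//; apply: (le_trans (H _)).
    move=> x y xy; rewrite /qK; case: (leP y K) => yK; last by case: ifP => // _; exact: lee01.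
    by rewrite (le_trans xy yK).
  by apply: cumul_le_cst => //; exact: ltW.
have : (N%:R)%:E * iter N (down mu) (cst 1) 0%R <= ((K / delta + 1) / p + N%:R * (K^-1 * (L + N%:R * d)))%:E.
  apply: (le_trans (iter_down_avg mu N)).
  apply: (@le_trans _ _ (\sum_(n < N) (iter n (down mu) qK 0%R + (K^-1 * (L + N%:R * d))%:E))).
    by apply: lee_sum => n _; exact: split1.
  rewrite big_split/= EFinD; apply: leeD => //.
  by rewrite sumEFin lee_fin sumr_const card_ord -[leLHS]mulr_natl.
rewrite -lee_pdivlMl// => /le_trans; apply; rewrite -EFinM lee_fin.
rewrite mulrC ler_pdivrMr//.
have -> : ((K / delta + 1) / p = e1 * N%:R + p^-1)%R.
  by rewrite /K /eta; field; rewrite !gt_eqF.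
have -> : (N%:R * (K^-1 * (L + N%:R * d)) = L / eta + N%:R * (d / eta))%R.
  by rewrite /K; field; rewrite !gt_eqF.
have : (N%:R * (d / eta) <= N%:R * e1)%R.
  by rewrite ler_wpM2l// ler_pdivrMr.
by rewrite (_ : e = 4 * e1)%R; [lra|rewrite /e1; field].
Qed.

Let q := up mu (fun h : R => (Num.sqrt h)%:E).

Let nq : nnm q. Proof. exact/nnm_up/nnm_sqrt. Qed.

Lemma up_sqrt_noninc x y : (x <= y)%R -> q y <= q x.
Proof.
move=> xy; apply: int_le; [exact: (nnm_up_at y (@nnm_sqrt R))|exact: (nnm_up_at x (@nnm_sqrt R))|].
move=> u; case: (ltP y u) => yu; last by case: (x < u)%R => //; rewrite lee_fin sqrtr_ge0.
by rewrite (le_lt_trans xy yu) lee_fin ler_wsqrtr// lerD2l lerN2.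
Qed.

(** At most [y^+ / delta + 1] multiples [j * delta] lie below [y], and each contributes at most
    [sqrt(y^+)]. The total is of order [(y^+)^(3/2)], the one place where an overshoot costs more
    than a square root. *)
Lemma cumul_up_sqrt_fin (delta : R) : (0 < delta)%R -> cumul q delta 0%R < +oo.
Proof.
move=> d0; pose F (j : nat) (y : R) : \bar R :=
  if (0 + j%:R * delta < y)%R then (Num.sqrt (y - (0 + j%:R * delta)))%:E else 0.
have nF j : nnm (F j) by exact: (nnm_up_at (0 + j%:R * delta)%R (@nnm_sqrt R)).
have -> : cumul q delta 0%R = \int[mu]_y \sum_(j <oo) F j y by rewrite int_series.
have nb : nnm (fun y : R => 1 + (delta^-1 + 1)%:E * (Num.sqrt (yp y) ^+ 3)%:E).
  apply: nnmD; first exact: nnm_cst.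
  by apply: nnmM nnm_sqrt3; apply: nnm_cst; rewrite lee_fin addr_ge0// invr_ge0 ltW.
apply: (@le_lt_trans _ _ (\int[mu]_y (1 + (delta^-1 + 1)%:E * (Num.sqrt (yp y) ^+ 3)%:E))).
  apply: int_le => //; first exact: nnm_series.
  move=> y; apply: lime_le; first by apply: is_cvg_nneseries => j _ _; exact: (nF j).2.
  apply: nearW => n; rewrite big_mkord -EFinM -EFinD.
  set w := Num.sqrt (yp y); have w0 : (0 <= w)%R by exact: sqrtr_ge0.
  have w2 : (yp y = w ^+ 2)%R by rewrite sqr_sqrtr ?yp_ge0.
  apply: (@le_trans _ _ ((\sum_(j < n) ((j%:R * delta <= yp y)%R)%:R * w)%R)%:E).
    rewrite -sumEFin; apply: lee_sum => j _; rewrite /F add0r.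
    case: (ltP (j%:R * delta)%R y) => jy; last by rewrite lee_fin mulr_ge0.
    have jd : (0 <= j%:R * delta)%R by rewrite mulr_ge0// ltW.
    rewrite yp_id ?(ltW (le_lt_trans jd jy))// (ltW jy) mul1r lee_fin /w ler_wsqrtr//.
    by rewrite yp_id ?(ltW (le_lt_trans jd jy))// lerBlDr lerDl.
  rewrite lee_fin -mulr_suml.
  apply: (@le_trans _ _ ((yp y / delta + 1) * w)%R).
    by rewrite ler_wpM2r// count_multiples// yp_ge0.
  rewrite w2 (_ : (w ^+ 2 / delta + 1) * w = delta^-1 * w ^+ 3 + w)%R; last by ring.
  have w1 : (w <= 1 + w ^+ 3)%R.
    have w3 : (0 <= w ^+ 3)%R by exact: exprn_ge0.
    have [w1|/ltW w1] := leP w 1%R; first by lra.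
    have : (w ^+ 1 <= w ^+ 3)%R by rewrite ler_weXn2l.
    by rewrite expr1; lra.
  by lra.
rewrite intD; [|exact: nnm_cst|]; last first.
  by apply: nnmM nnm_sqrt3; apply: nnm_cst; rewrite lee_fin addr_ge0// invr_ge0 ltW.
rewrite int_cst intZ ?lee_fin ?addr_ge0 ?invr_ge0 ?(ltW d0)//; last exact: nnm_sqrt3.
rewrite lte_add_pinfty ?ltry// lte_mul_pinfty ?lee_fin ?addr_ge0 ?invr_ge0 ?(ltW d0)//.
Qed.

Lemma zero_drift_ladder :
  ladder_law Pi [set h | h <= 0]%R = 0 /\
  \int[ladder_law Pi]_h (Num.sqrt h)%:E < +oo.
Proof.
split; first exact: (no_ladder_null fs zero_drift_crossing).
have [delta delta0 p'0] := negative_steps.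
set p' := mu _ in p'0; pose p := fine p'.
have pE : p' = p%:E.
  rewrite fineK// fin_num_measure//.
  rewrite -[X in measurable X]setTI.
  by apply: (@measurable_fun_ler _ _ R setT id (cst (- delta))%R).
have p0 : (0 < p)%R by rewrite -lte_fin -pE.
(* The overshoot reward [q] serves as the source, so its potential is a supersolution for the square
   root of the ladder height. *)
apply: (@le_lt_trans _ _ (potential mu q 0%R)).
  apply: (ladder_sqrt_le fs); first exact: nnm_potential.
  by move=> z _; rewrite [leRHS]potentialE.
apply: (@le_lt_trans _ _ (p^-1%:E * cumul q delta 0%R)).
  apply: lime_le.
    by apply: is_cvg_nneseries => j _ _; exact: (nnm_iter_down mu j nq).2.
  apply: nearW => n; rewrite big_mkord.
  have := dual_bound mu nq up_sqrt_noninc delta0 n.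
  by rewrite -/p' pE -lee_pdivlMl.
by rewrite lte_mul_pinfty ?lee_fin ?invr_ge0 ?(ltW p0)//; exact: cumul_up_sqrt_fin.
Qed.

End zero_drift.

(** * Recurrence from uniform hitting *)

Section hitting.
Context {R : realType}.
Variables (mu : probability R R) (Pi : probability (increments R) R).
Hypothesis fs : first_step mu Pi.
Local Open Scope ereal_scope.
Variable V : set R.
Hypothesis mV : measurable V.

(** Time 0 is left out, so that for a start in [V] a later hit is a return. *)
Definition avoid (n : nat) (x : R) (w : increments R) : Prop :=
  forall j, (0 < j <= n)%N -> ~ V (rwalk x j w).

Lemma measurable_rwalk_in (A : set R) n : measurable A ->
  measurable [set z : R * increments R | A (rwalk z.1 n z.2)].
Proof.
by move=> mA; rewrite -[X in measurable X]setTI; exact: (measurable_rwalk n).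
Qed.

Lemma measurable_avoid n :
  measurable [set z : R * increments R | avoid n z.1 z.2].
Proof.
rewrite (_ : [set z | _] = \bigcap_(j in [set j | (0 < j <= n)%N])
    [set z : R * increments R | (~` V) (rwalk z.1 j z.2)]).
  apply: bigcap_measurableType => j _.
  by apply: measurable_rwalk_in; exact: measurableC.
by apply/seteqP; split => z.
Qed.

Definition pavoid n x : \bar R := Pi [set w | avoid n x w].

Definition pvisit (B : set R) n x : \bar R :=
  Pi [set w | avoid n x w /\ B (rwalk x n w)].

Lemma measurable_visit B n : measurable B ->
  measurable [set z : R * increments R | avoid n z.1 z.2 /\ B (rwalk z.1 n z.2)].
Proof.
move=> mB; apply: measurableI; first exact: measurable_avoid.
exact: measurable_rwalk_in.
Qed.

Lemma measurable_avoid_at n x : measurable [set w | avoid n x w].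
Proof. exact: (measurable_section x (measurable_avoid n)). Qed.

Lemma measurable_visit_at B n x : measurable B ->
  measurable [set w | avoid n x w /\ B (rwalk x n w)].
Proof. by move=> mB; exact: (measurable_section (G := fun x w => avoid n x w /\ B (rwalk x n w)) x (measurable_visit n mB)). Qed.

Lemma nnm_pavoid n : nnm (pavoid n).
Proof. exact: (nnm_xsection Pi (measurable_avoid n)). Qed.

Lemma nnm_pvisit B n : measurable B -> nnm (pvisit B n).
Proof. by move=> mB; exact: (nnm_xsection Pi (G := fun x w => avoid n x w /\ B (rwalk x n w)) (measurable_visit n mB)). Qed.

Definition kill (f : R -> \bar R) (z : R) : \bar R := (\1_(~` V) z)%:E * f z.

Lemma nnm_kill f : nnm f -> nnm (kill f).
Proof.
have mC : measurable (~` V) by exact: measurableC.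
have nI : nnm (EFin \o (\1_(~` V) : R -> R)).
  by apply: nnm_EFin => [|z]; [exact: measurable_indic|rewrite indicE ler0n].
by move=> nf; exact: nnmM nI nf.
Qed.

Lemma killE f z : (V z -> kill f z = 0) /\ (~ V z -> kill f z = f z).
Proof.
rewrite /kill indicE; split => Vz.
  by rewrite memNset ?mul0e//; exact.
by rewrite mem_set ?mul1e.
Qed.

Lemma avoid_scons n x y w :
  avoid n.+1 x (scons y w) <-> ~ V `|x - y|%R /\ avoid n `|x - y|%R w.
Proof.
split=> [a|[V1 a] [|[|j]]] //.
  split=> [|j /andP[j0 jn]].
    by have := a 1%N isT.
  by have := a j.+1; rewrite rwalk_scons /= ltnS jn => /(_ isT).
by rewrite rwalk_scons ltnS => /andP[_ jn]; apply: a.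
Qed.

Lemma nnm_norm_sub (f : R -> \bar R) (x : R) : nnm f -> nnm (fun y : R => f `|x - y|%R).
Proof.
apply: nnm_comp; apply: measurableT_comp => //.
by apply: measurable_funB => //; exact: measurable_cst.
Qed.

Lemma pavoidS n x : pavoid n.+1 x = \int[mu]_y kill (pavoid n) `|x - y|%R.
Proof.
rewrite /pavoid (first_step_event fs); last exact: measurable_avoid_at.
apply: eq_integral => y _; have [Vy|Vy] := pselect (V `|x - y|%R).
  rewrite (killE _ _).1// (_ : [set w | _] = set0) ?measure0//.
  by rewrite -subset0 => w /avoid_scons[].
rewrite (killE _ _).2//; congr (Pi _); apply/seteqP; split => w.
  by move=> /avoid_scons[].
by move=> a; apply/avoid_scons.
Qed.

Lemma pvisitS B n x : measurable B ->
  pvisit B n.+1 x = \int[mu]_y kill (pvisit B n) `|x - y|%R.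
Proof.
move=> mB; rewrite /pvisit (first_step_event fs); last exact: measurable_visit_at.
apply: eq_integral => y _; have [Vy|Vy] := pselect (V `|x - y|%R).
  rewrite (killE _ _).1// (_ : [set w | _] = set0) ?measure0//.
  by rewrite -subset0 => w [/avoid_scons[]].
rewrite (killE _ _).2//; congr (Pi _); apply/seteqP; split => w.
  by move=> [/avoid_scons[_ a]]; rewrite rwalk_scons.
by move=> [a Bw]; split; [exact/avoid_scons|rewrite rwalk_scons].
Qed.

Lemma pavoid0 x : pavoid 0 x = 1.
Proof.
rewrite /pavoid (_ : [set w | _] = setT) ?probability_setT//.
by apply/seteqP; split => // w _ [].
Qed.

Section uniform_hitting.
Variables (B : set R) (m : nat) (delta : R).
Hypotheses (mB : measurable B) (delta0 : (0 < delta)%R).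
Hypothesis hit : forall x, B x -> pavoid m x + delta%:E <= 1.

(** On a visit to [B] at time [n] without earlier hit of [V], a hit follows within [m] steps with
    probability at least [delta]. The case [n = 0] is the hypothesis, and conditioning on the first
    step shifts [n]. *)
Lemma pvisit_le n x : delta%:E * pvisit B n x + pavoid (n + m) x <= pavoid n x.
Proof.
elim: n x => [|n ih] x.
  rewrite pavoid0 add0n; have [Bx|Bx] := pselect (B x).
    apply: le_trans (hit Bx); rewrite addeC leeD2l//.
    rewrite -[leRHS]mule1; apply: lee_wpmul2l; first by rewrite lee_fin ltW.
    by apply: probability_le1; exact: measurable_visit_at.
  rewrite /pvisit (_ : [set w | _] = set0); last by rewrite -subset0 => w [].
  rewrite measure0 mule0 add0e.
  by apply: probability_le1; exact: measurable_avoid_at.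
have nv := nnm_pvisit n mB; have na j := nnm_pavoid j.
have d0 : 0 <= delta%:E by rewrite lee_fin ltW.
have nkv := nnm_norm_sub x (nnm_kill nv).
have nka j := nnm_norm_sub x (nnm_kill (na j)).
rewrite addSn !pavoidS pvisitS// -intZ// -intD//; last by apply: nnmM => //; exact: nnm_cst.
apply: int_le => //; first by apply: nnmD => //; apply: nnmM => //; exact: nnm_cst.
move=> y; have [Vy|Vy] := pselect (V `|x - y|%R).
  by rewrite !(killE _ _).1// mule0 adde0.
by rewrite !(killE _ _).2.
Qed.

Lemma pavoid_le1 n x : pavoid n x <= 1.
Proof. by apply: probability_le1; exact: measurable_avoid_at. Qed.

Lemma pavoid_fin n x : pavoid n x \is a fin_num.
Proof. by apply: fin_num_measure; exact: measurable_avoid_at. Qed.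

(** The differences [pavoid n - pavoid (n + m)] telescope; at most [m] terms survive, each at most
    1. *)
Lemma sum_pvisit_le N x : delta%:E * \sum_(n < N) pvisit B n x <= (m%:R)%:E.
Proof.
have nv n := (nnm_pvisit n mB).2 x; have na j := (nnm_pavoid j).2 x.
have H : delta%:E * \sum_(n < N) pvisit B n x + \sum_(n < N) pavoid (n + m) x <=
    \sum_(n < N) pavoid n x.
  rewrite ge0_sume_distrr// -big_split/=; apply: lee_sum => n _; exact: pvisit_le.
have H2 : \sum_(n < N) pavoid n x <= \sum_(n < m) pavoid n x + \sum_(n < N) pavoid (n + m) x.
  rewrite -!(big_mkord xpredT (fun n => pavoid n x)) -(big_mkord xpredT (fun n => pavoid (n + m) x)).
  have -> : \sum_(0 <= i < N) pavoid (i + m) x = \sum_(m <= i < N + m) pavoid i x.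
    by rewrite -{2}[m]add0n big_addn addnK.
  rewrite -big_cat_nat//=; last exact: leq_addl.
  rewrite (@big_cat_nat _ _ _ N 0 (N + m))//=; last exact: leq_addr.
  by rewrite leeDl// sume_ge0.
have H3 : \sum_(n < m) pavoid n x <= (m%:R)%:E.
  apply: (@le_trans _ _ (\sum_(n < m) 1)); first by apply: lee_sum => n _; exact: pavoid_le1.
  by rewrite sumEFin sumr_const card_ord.
have : delta%:E * \sum_(n < N) pvisit B n x + \sum_(n < N) pavoid (n + m) x <=
    (m%:R)%:E + \sum_(n < N) pavoid (n + m) x.
  by apply: (le_trans H); apply: (le_trans H2); rewrite leeD2r.
rewrite leeD2rE//; apply/sum_fin_numP => n _ _; exact: pavoid_fin.
Qed.

(** Borel-Cantelli: the expected number of visits to [B] before hitting [V] is at most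
    [m / delta]. *)
Lemma avoid_finite_visits x :
  Pi [set w | (forall j, (0 < j)%N -> ~ V (rwalk x j w)) /\
              forall n, exists2 j, (n <= j)%N & B (rwalk x j w)] = 0.
Proof.
pose F n := [set w | avoid n x w /\ B (rwalk x n w)].
have mF n : measurable (F n) by exact: measurable_visit_at.
have F0 : Pi (lim_sup_set F) = 0.
  apply: lim_sup_set_cvg0 => //.
  apply: (@le_lt_trans _ _ (delta^-1%:E * (m%:R)%:E)); last by rewrite -EFinM ltry.
  apply: lime_le; first by apply: is_cvg_nneseries => n _ _; exact: measure_ge0.
  apply: nearW => n; rewrite big_mkord -lee_pdivrMl ?invr_gt0// invrK.
  exact: sum_pvisit_le.
apply/eqP; rewrite eq_le measure_ge0 andbT -F0; apply: le_measure; rewrite ?inE.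
- rewrite (_ : [set w | _] = \bigcap_(j in [set j | (0 < j)%N]) [set w | (~` V) (rwalk x j w)] `&`
     \bigcap_n \bigcup_(j in [set j | (n <= j)%N]) [set w | B (rwalk x j w)]).
    apply: measurableI.
      apply: bigcap_measurableType => j _.
      apply: (measurable_section (G := fun x w => (~` V) (rwalk x j w)) x).
      by apply: measurable_rwalk_in; exact: measurableC.
    apply: bigcapT_measurable => n; apply: bigcup_measurable => j _.
    exact: (measurable_section (G := fun x w => B (rwalk x j w)) x (measurable_rwalk_in j mB)).
  apply/seteqP; split => w [a b]; split => // n; first by move=> _; have [j ? ?] := b n; exists j.
  by have [j ? ?] := b n I; exists j.
- apply: bigcapT_measurable => n; apply: bigcup_measurable => j _; exact: mF.
move=> w [av io] n _; have [j nj Bj] := io n; exists j => //; split => // i /andP[i0 _].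
exact: av.
Qed.

End uniform_hitting.

End hitting.

Lemma measurable_step {R : realType} (C : set R) x : measurable C -> measurable [set y : R | ~ C `|x - y|].
Proof.
move=> mC; have ms : measurable_fun [set: R] (fun y : R => `|x - y|%R).
  apply: measurableT_comp => //; apply: measurable_funB => //; exact: measurable_cst.
by rewrite -[X in measurable X]setTI; exact: (ms measurableT _ (measurableC mC)).
Qed.

(** * Recurrence from absence of escape and uniform hitting *)

Section recurrence_criterion.
Context {R : realType}.
Variables (mu : probability R R) (Pi : probability (increments R) R).
Hypothesis fs : first_step mu Pi.
Hypothesis noescape : forall x, Pi [set w | escape x w] = 0%E.
Local Open Scope ereal_scope.
Variables C V : set R.
Hypotheses (mC : measurable C) (mV : measurable V).
Hypothesis Cstep : forall x, C x -> mu [set y | ~ C `|x - y|%R] = 0.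
Hypothesis hit : forall K : nat, exists m (delta : R), (0 < delta)%R /\
  forall x, C x /\ (x <= K%:R)%R -> pavoid Pi V m x + delta%:E <= 1.

Lemma int_step0 (f : R -> \bar R) x : nnm f -> (forall z, f z <= 1) ->
  (forall z, C z -> f z = 0) -> C x -> \int[mu]_y f `|x - y|%R = 0.
Proof.
move=> nf f1 fC Cx.
have mb := measurable_step x mC.
have nI : nnm (EFin \o (\1_[set y : R | ~ C `|x - y|%R] : R -> R)).
  by apply: nnm_EFin => [|z]; [exact: measurable_indic|rewrite indicE ler0n].
apply/eqP; rewrite eq_le; apply/andP; split; last exact: (int_ge0 mu (nnm_norm_sub x nf)).
apply: (@le_trans _ _ (\int[mu]_y (\1_[set y : R | ~ C `|x - y|%R] y)%:E)).
  apply: int_le; [exact: (nnm_norm_sub x nf)|exact: nI|].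
  move=> y; rewrite indicE; have [Cy|Cy] := pselect (C `|x - y|%R).
    by rewrite fC// lee_fin ler0n.
  by rewrite mem_set.
rewrite integral_indic// setIT; move: (Cstep Cx) => /eqP; rewrite eq_le => /andP[h _]; exact: h.
Qed.

Lemma leave_null x : C x -> Pi [set w | exists n, ~ C (rwalk x n w)] = 0.
Proof.
move=> Cx; have mn n y : measurable [set w | ~ C (rwalk y n w)].
  apply: (measurable_section (G := fun x w => (~` C) (rwalk x n w)) y).
  exact: (measurable_rwalk_in _ (measurableC mC)).
have H n y : C y -> Pi [set w | ~ C (rwalk y n w)] = 0.
  elim: n y => [|n ih] y Cy.
    by rewrite /= (_ : [set w | _] = set0) ?measure0// -subset0.
  rewrite (first_step_event fs)//.
  under eq_integral.
    move=> z _; rewrite (_ : [set w | _] = [set w | ~ C (rwalk `|y - z|%R n w)]); first over.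
    by apply/funext => w; rewrite /mkset rwalk_scons.
  apply: (int_step0 (f := fun z => Pi [set w | ~ C (rwalk z n w)])) => //.
  - apply: (nnm_xsection Pi (G := fun x w => ~ C (rwalk x n w))).
    exact: (measurable_rwalk_in _ (measurableC mC)).
  - by move=> z; exact: probability_le1.
have N : Pi.-negligible (\bigcup_n [set w | ~ C (rwalk x n w)]).
  by apply: negligible_bigcup => n; apply/negligibleP => //; exact: H.
have mU : measurable (\bigcup_n [set w | ~ C (rwalk x n w)]) by exact: bigcupT_measurable.
move/negligibleP : N => /(_ mU) <-; congr (Pi _).
by apply/seteqP; split => w [n]; [exists n|move=> _; exists n].
Qed.

Lemma measurable_never x : measurable [set w | forall j, (0 < j)%N -> ~ V (rwalk x j w)].
Proof.
rewrite (_ : [set w | _] = \bigcap_(j in [set j | (0 < j)%N]) [set w | (~` V) (rwalk x j w)])//.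
apply: bigcap_measurableType => j _;
exact: (measurable_section (G := fun x w => (~` V) (rwalk x j w)) x (measurable_rwalk_in j (measurableC mV))).
Qed.

(** Off the null events of escaping and of leaving [C], the walk is in some [B K] infinitely often,
    and [avoid_finite_visits] applies to each of these countably many sets. *)
Lemma never_hit_null x : C x -> Pi [set w | forall j, (0 < j)%N -> ~ V (rwalk x j w)] = 0.
Proof.
move=> Cx; apply/negligibleP; first exact: measurable_never.
pose B (K : nat) := C `&` [set z | (z <= K%:R)%R].
have mB K : measurable (B K).
  apply: measurableI => //; rewrite -[X in measurable X]setTI.
  by apply: (@measurable_fun_ler _ _ R setT id (cst K%:R)%R).
pose A K := [set w | (forall j, (0 < j)%N -> ~ V (rwalk x j w)) /\
    forall n, exists2 j, (n <= j)%N & B K (rwalk x j w)].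
have NA K : Pi.-negligible (A K).
  have [m [delta [d0 hitK]]] := hit K.
  exists (A K); split => //; last exact: (avoid_finite_visits fs mV (mB K) d0 (fun z Bz => hitK z Bz)).
  rewrite (_ : A K = [set w | forall j, (0 < j)%N -> ~ V (rwalk x j w)] `&`
     \bigcap_n \bigcup_(j in [set j | (n <= j)%N]) [set w | B K (rwalk x j w)]).
    apply: measurableI; first exact: measurable_never.
    apply: bigcapT_measurable => n; apply: bigcup_measurable => j _.
    exact: (measurable_section (G := fun x w => B K (rwalk x j w)) x (measurable_rwalk_in j (mB K))).
  apply/seteqP; split => w [a b]; split => // n; first by move=> _; have [j ? ?] := b n; exists j.
  by have [j ? ?] := b n I; exists j.
have NE : Pi.-negligible [set w | escape x w].
  by apply/negligibleP; [exact: measurable_escape|exact: noescape].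
have ml : measurable [set w | exists n, ~ C (rwalk x n w)].
  rewrite (_ : [set w | _] = \bigcup_n [set w | (~` C) (rwalk x n w)]).
    apply: bigcupT_measurable => n.
    apply: (measurable_section (G := fun x w => (~` C) (rwalk x n w)) x).
    exact: (measurable_rwalk_in _ (measurableC mC)).
  by apply/seteqP; split => w [n]; [exists n|move=> _; exists n].
have NL : Pi.-negligible [set w | exists n, ~ C (rwalk x n w)].
  by apply/negligibleP => //; exact: leave_null.
apply: negligibleS (negligibleU (negligibleU NE NL) (negligible_bigcup NA)).
move=> w nV; have [Ew|nE] := pselect (escape x w); first by left; left.
have [Lw|nL] := pselect (exists n, ~ C (rwalk x n w)); first by left; right.
right; have [K nK] : exists K : nat, forall m, low K%:R m x w.
  by apply: contrapT => H; apply: nE => K; apply: contrapT => H2; apply: H; exists K => m;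
     apply: contrapT => H3; apply: H2; exists m.
exists K => //; split => // n; have [j nj jK] := nK n; exists j => //; split => //.
by apply: contrapT => H; apply: nL; exists j.
Qed.

(** After the first step, which almost surely stays in [C], the last permitted hit is one time unit
    nearer. *)
Lemma finitely_many_hits_null x n : C x ->
  Pi [set w | forall j, (n < j)%N -> ~ V (rwalk x j w)] = 0.
Proof.
elim: n x => [|n ih] x Cx; first exact: never_hit_null.
have mn k : measurable [set z : R * increments R | forall j, (k < j)%N -> ~ V (rwalk z.1 j z.2)].
  rewrite (_ : [set w | _] = \bigcap_(j in [set j | (k < j)%N])
      [set z : R * increments R | (~` V) (rwalk z.1 j z.2)])//.
  by apply: bigcap_measurableType => j _; exact: (measurable_rwalk_in j (measurableC mV)).
have mnx k y := measurable_section (G := fun x w => forall j, (k < j)%N -> ~ V (rwalk x j w)) y (mn k).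
rewrite (first_step_event fs)//.
under eq_integral.
  move=> z _; rewrite (_ : [set w | _] =
    [set w | forall j, (n < j)%N -> ~ V (rwalk `|x - z|%R j w)]); first over.
  apply/seteqP; split => w /= H j nj; first by have := H j.+1 nj; rewrite rwalk_scons.
  by case: j nj => // j nj; rewrite rwalk_scons; exact: H.
apply: (int_step0 (f := fun z => Pi [set w | forall j, (n < j)%N -> ~ V (rwalk z j w)])) => //.
- exact: (nnm_xsection Pi (G := fun x w => forall j, (n < j)%N -> ~ V (rwalk x j w)) (mn n)).
- by move=> z; exact: probability_le1.
Qed.

Lemma infinitely_many_hits x : C x ->
  Pi.-negligible [set w | ~ forall n, exists2 j, (n < j)%N & V (rwalk x j w)].
Proof.
move=> Cx.
have mn n : measurable [set w | forall j, (n < j)%N -> ~ V (rwalk x j w)].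
  rewrite (_ : [set w | _] = \bigcap_(j in [set j | (n < j)%N]) [set w | (~` V) (rwalk x j w)])//.
  apply: bigcap_measurableType => j _;
  exact: (measurable_section (G := fun x w => (~` V) (rwalk x j w)) x (measurable_rwalk_in j (measurableC mV))).
have N n : Pi.-negligible [set w | forall j, (n < j)%N -> ~ V (rwalk x j w)].
  by apply/negligibleP; [exact: mn|exact: finitely_many_hits_null].
apply: negligibleS (negligible_bigcup N) => w /= H.
apply: contrapT => H2; apply: H => n; apply: contrapT => H3; apply: H2; exists n => // j nj Vj.
by apply: H3; exists j.
Qed.

End recurrence_criterion.

(** * The support of the law *)

Section support.
Context {R : realType}.

Definition rat_interval (p : rat * rat) : set R := [set y | ratr p.1 < y < ratr p.2].

Lemma open_contains_ball (U : set R) z : open U -> U z ->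
  exists2 e, 0 < e & forall y, `|y - z| < e -> U y.
Proof.
move=> oU Uz; have /nbhs_ballP[e /= e0 eU] := open_nbhs_nbhs (conj oU Uz).
by exists e => // y; rewrite distrC => yz; apply: eU.
Qed.

Lemma rat_interval_in_open (U : set R) z : open U -> U z ->
  exists2 p, rat_interval p z & rat_interval p `<=` U.
Proof.
move=> oU Uz; have [e e0 eU] := open_contains_ball oU Uz.
have [|a] := @rat_in_itvoo R (z - e) z; first by lra.
rewrite in_itv /= => /andP[a1 a2].
have [|b] := @rat_in_itvoo R z (z + e); first by lra.
rewrite in_itv /= => /andP[b1 b2].
exists (a, b) => [|y /andP[/= ay yb]]; first by apply/andP.
by apply: eU; rewrite ltr_norml; apply/andP; split; lra.
Qed.

Lemma open_rat_interval p : open (rat_interval p).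
Proof.
rewrite (_ : rat_interval p = `]ratr p.1, ratr p.2[%classic); first exact: itv_open.
by apply/seteqP; split => y; rewrite /= in_itv.
Qed.

Lemma open_ball_norm (z e : R) : open [set y : R | `|y - z| < e].
Proof.
rewrite (_ : mkset _ = `]z - e, z + e[%classic); first exact: itv_open.
by apply/seteqP; split => y; rewrite /= in_itv /= ltr_norml => /andP[? ?]; apply/andP; split; lra.
Qed.

Lemma measurable_open_set (U : set R) : open U -> measurable U.
Proof. exact: open_measurable. Qed.

Lemma null_cover d (T : measurableType d) (P : probability T R) (F : nat -> set T) (U : set T) :
  (forall n, measurable (F n) /\ P (F n) = 0%E) -> measurable U ->
  U `<=` \bigcup_n F n -> P U = 0%E.
Proof.
move=> F0 mU UF; have F0' n : P.-negligible (F n).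
  by apply/negligibleP; [exact: (F0 n).1|exact: (F0 n).2].
have /negligibleP := negligibleS UF (negligible_bigcup F0').
exact.
Qed.

Variable mu : probability R R.

(** Every point off the support lies in a null rational interval, and there are countably many of
    these; so an open set missing the support is null. *)
Lemma open_charged (U : set R) : open U -> (0 < mu U)%E -> U `&` supp mu !=set0.
Proof.
move=> oU; apply: contraPP => US; apply/negP; rewrite -leNgt.
pose F n := if @choice.unpickle (rat * rat)%type n is Some p then
  if mu (rat_interval p) == 0%E then rat_interval p else set0 else set0.
rewrite (@null_cover _ _ mu F) //; last 2 first.
- exact: measurable_open_set.
- move=> z Uz; have : ~ supp mu z by move=> Sz; apply: US; exists z.
  move=> /existsNP[W /not_implyP[oW /not_implyP[Wz W0]]].
  have [p pz pW] := rat_interval_in_open oW Wz.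
  exists (choice.pickle p); [exact: I|rewrite /F choice.pickleK].
  rewrite (_ : mu (rat_interval p) == 0%E); first exact: pz.
  rewrite eq_le measure_ge0 andbT; move/negP : W0; rewrite -leNgt; apply: le_trans.
  apply: le_measure; rewrite ?inE //; apply: measurable_open_set => //; exact: open_rat_interval.
move=> n; rewrite /F; case: (@choice.unpickle (rat * rat)%type n) => [p|]; last by rewrite measure0; split.
case: eqP => [p0|_]; last by rewrite measure0; split.
split; last exact: p0.
apply: measurable_open_set; exact: open_rat_interval.
Qed.

Lemma open_null (U : set R) : open U -> U `&` supp mu = set0 -> mu U = 0%E.
Proof.
move=> oU US; apply/eqP; rewrite eq_le measure_ge0 andbT leNgt; apply/negP => /(open_charged oU).
by rewrite US => -[].
Qed.

Lemma supp_ball (s e : R) : supp mu s -> 0 < e -> (0 < mu [set y : R | (`|y - s| < e)%R])%E.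
Proof.
by move=> Ss e0; apply: Ss; [exact: open_ball_norm|rewrite /= subrr normr0].
Qed.

Lemma closed_supp : closed (supp mu).
Proof.
move=> z cz U oU Uz; have [s [Ss Us]] := cz U (open_nbhs_nbhs (conj oU Uz)).
exact: Ss.
Qed.

Lemma sup_supp : supp mu !=set0 -> has_ubound (supp mu) -> supp mu (sup (supp mu)).
Proof.
by move=> S0 Sb; apply: closed_supp; exact: closure_sup.
Qed.

End support.

(** * Deterministic reachability *)

Section dense_groups.
Context {R : realType}.

Definition dense_set (H : set R) := forall z e, 0 < e -> exists2 g, H g & `|g - z| < e.

Definition approached (H : set R) : set R :=
  [set z | forall e, 0 < e -> exists2 g, H g & `|g - z| < e].

Lemma closed_approached H : closed (approached H).
Proof.
move=> z cz e e0; have e2 : 0 < e / 2 by rewrite divr_gt0.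
have [|y [ay /= yz]] := cz [set y : R | `|y - z| < e / 2].
  by apply: open_nbhs_nbhs; split; [exact: open_ball_norm|rewrite /= subrr normr0].
have [g Hg gy] := ay _ e2; exists g => //.
by rewrite (splitr e) -(subrKA y); apply: le_lt_trans (ler_normD _ _) _; exact: ltrD.
Qed.

Lemma approached_sub H x y : (forall x y, H x -> H y -> H (x - y)) ->
  approached H x -> approached H y -> approached H (x - y).
Proof.
move=> Hs ax ay e e0; have e2 : 0 < e / 2 by rewrite divr_gt0.
have [g Hg gx] := ax _ e2; have [h Hh hy] := ay _ e2.
exists (g - h); first exact: Hs.
rewrite (splitr e) (_ : _ - _ = (g - x) - (h - y)); last by ring.
by apply: le_lt_trans (ler_normB _ _) _; exact: ltrD.
Qed.

Lemma approached_in (H : set R) x : H x -> approached H x.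
Proof. by move=> Hx e e0; exists x => //; rewrite subrr normr0. Qed.

(** The closure of [H] is a closed subgroup containing [S], hence everything. Only the closure is
    required to be a group, because [H] will also be a semigroup. *)
Lemma generated_closed_group_dense (S H : set R) : generated_closed_group S = setT ->
  additive_subgroup (approached H) -> S `<=` approached H -> dense_set H.
Proof.
move=> ST gH SH z; have : generated_closed_group S z by rewrite ST.
move=> /(_ (approached H)); apply; split => //; split => //; exact: closed_approached.
Qed.

Lemma dense_subgroup (S H : set R) : generated_closed_group S = setT ->
  additive_subgroup H -> S `<=` H -> dense_set H.
Proof.
move=> ST [H0 Hs] SH; apply: (generated_closed_group_dense ST).
  by split; [exact: approached_in|move=> x y; exact: approached_sub].
by move=> s /SH; exact: approached_in.
Qed.

End dense_groups.

Section deterministic_walk.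
Context {R : realType}.
Variable S : set R.

Inductive reach : R -> R -> Prop :=
| reach_refl u : reach u u
| reach_step u s v : S s -> reach `|u - s| v -> reach u v.

Lemma reach_trans u v w : reach u v -> reach v w -> reach u w.
Proof. by elim=> // a s b Ss _ ih bw; apply: reach_step Ss (ih bw). Qed.

Section reflection_in_a_strip.
(* [fold N x a]: [a] is the distance of [x] to [2N Z]. *)
Definition fold (N x a : R) := [/\ 0 <= a, a <= N &
  exists k : int, x = 2 * N * k%:~R + a \/ x = 2 * N * k%:~R - a].

Lemma fold_le N x a (l : int) : fold N x a -> a <= `|x - 2 * N * l%:~R|.
Proof.
move=> [a0 aN [k xk]].
have [kl|kl] := eqVneq k l.
  by rewrite -kl; case: xk => ->; rewrite addrC addKr ?normrN ger0_norm.
have N0 : 0 <= N by exact: le_trans aN.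
have kl1 : (1 <= `|k%:~R - l%:~R| :> R).
  by rewrite -intrB -intr_norm (ler_int _ 1) -gtz0_ge1 normr_gt0 subr_eq0.
have H : 2 * N <= `|2 * N * (k%:~R - l%:~R)|.
  by rewrite normrM ger0_norm ?mulr_ge0// ler_peMr// mulr_ge0.
case: xk => ->.
  have : `|2 * N * (k%:~R - l%:~R)| <= `|2 * N * k%:~R + a - 2 * N * l%:~R| + `|a|.
    by rewrite (_ : 2 * N * (_ - _) = 2 * N * k%:~R + a - 2 * N * l%:~R - a); [exact: ler_normB|ring].
  rewrite (ger0_norm a0); lra.
have : `|2 * N * (k%:~R - l%:~R)| <= `|2 * N * k%:~R - a - 2 * N * l%:~R| + `|a|.
  by rewrite (_ : 2 * N * (_ - _) = 2 * N * k%:~R - a - 2 * N * l%:~R + a); [exact: ler_normD|ring].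
rewrite (ger0_norm a0); lra.
Qed.

(** The distance to a set is a 1-Lipschitz function. *)
Lemma fold_lipschitz N x y a b : fold N x a -> fold N y b -> `|a - b| <= `|x - y|.
Proof.
have half x' y' a' b' : fold N x' a' -> fold N y' b' -> a' - b' <= `|x' - y'|.
  move=> fx [b0 _ [l yl]]; have := fold_le l fx.
  have : `|x' - 2 * N * l%:~R| <= `|x' - y'| + b'.
    rewrite -(subrKA y'); apply: le_trans (ler_normD _ _) _; rewrite lerD2l.
    by case: yl => ->; rewrite addrC addKr ?normrN ger0_norm.
  by move=> h1 h2; rewrite lerBlDr; exact: le_trans h2 h1.
move=> fx fy; rewrite ler_norml half// andbT lerNl opprB distrC; exact: half.
Qed.

Lemma fold_id N x : 0 <= x -> x <= N -> fold N x x.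
Proof. by move=> x0 xN; split => //; exists 0; left; rewrite mulr0 add0r. Qed.

(** Both [x + g] and [x - g] are demanded, since a position in the strip determines [x] only up to
    sign modulo [2N]; this also makes the property stable under subtraction. The threshold [b]
    ensures that [N] dominates all the steps that make up [g]. *)
Definition swept (g : R) := exists2 b, S b & forall N, S N -> b <= N -> forall x a, fold N x a ->
  (exists2 c, fold N (x + g) c & reach a c) /\ (exists2 c, fold N (x - g) c & reach a c).

Lemma swept0 : S !=set0 -> swept 0.
Proof.
move=> [b Sb]; exists b => // N SN bN x a f; rewrite subr0 addr0.
by split; exists a => //; exact: reach_refl.
Qed.

Lemma sweptB g h : swept g -> swept h -> swept (g - h).
Proof.
move=> [b Sb Hb] [c Sc Hc]; exists (Num.max b c); first by case: (leP b c).
move=> N SN; rewrite ge_max => /andP[bN cN] x a f.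
have [[a1 f1 r1] [a2 f2 r2]] := Hb N SN bN x a f; split.
  have [_ [c1 fc rc]] := Hc N SN cN _ _ f1; exists c1; first by rewrite addrA.
  exact: reach_trans rc.
have [[c1 fc rc] _] := Hc N SN cN _ _ f2; exists c1; last exact: reach_trans rc.
by rewrite (_ : x - (g - h) = x - g + h)//; ring.
Qed.

(* The step [N] is the flip [a -> N - a] of the strip, which conjugates the step [s] to its inverse. *)
Lemma swept_atom s : 0 <= s -> S s -> swept s.
Proof.
move=> s0 Ss; exists s => // N SN sN x a [a0 aN [k xk]].
have st : reach a `|a - s| by apply: reach_step Ss (reach_refl _).
have N0 : 0 <= N by exact: le_trans aN.
pose a' := N - `|N - a - s|.
have st' : reach a a'.
  apply: (reach_step (s := N)) => //; apply: (reach_step (s := s)) => //.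
  apply: (reach_step (s := N)) => //.
  rewrite [X in reach X _](_ : _ = a'); first exact: reach_refl.
  rewrite (distrC a N) (ger0_norm (_ : 0 <= N - a)); last by rewrite subr_ge0.
  rewrite distrC ger0_norm // subr_ge0 ler_norml; apply/andP; split; lra.
have b1 : 0 <= `|a - s| by [].
have b2 : `|a - s| <= N by rewrite ler_norml; apply/andP; split; lra.
have b3 : 0 <= `|N - a - s| by [].
have b4 : `|N - a - s| <= N by rewrite ler_norml; apply/andP; split; lra.
have c1 : 0 <= a' by rewrite /a'; lra.
have c2 : a' <= N by rewrite /a'; lra.
case: xk => ->; split.
- exists a' => //; split => //; rewrite /a'; case: (ger0P (N - a - s)) => h.
    by exists k; left; ring.
  by exists (k + 1); right; rewrite intrD; ring.
- exists `|a - s| => //; split => //; exists k.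
  by case: (ger0P (a - s)) => h; [left|right]; ring.
- exists `|a - s| => //; split => //; exists k.
  by case: (ger0P (a - s)) => h; [right|left]; ring.
- exists a' => //; split => //; rewrite /a'; case: (ger0P (N - a - s)) => h.
    by exists k; right; ring.
  by exists (k - 1); left; rewrite intrB; ring.
Qed.

(** Swept displacements form a subgroup containing [S], hence dense: displace [u] by some [g] close
    to [v - u]. Folding back into the strip does not increase the distance to [v]. *)
Lemma reach_nonneg_steps u v e : generated_closed_group S = setT ->
  (forall s, S s -> 0 <= s) -> S !=set0 -> 0 <= u -> 0 <= v ->
  (forall b, S b -> exists N, [/\ S N, b <= N, u <= N & v <= N]) -> 0 < e ->
  exists2 v', reach u v' & `|v' - v| < e.
Proof.
move=> ST Sp S0 u0 v0 HN e0.
have D : dense_set swept.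
  apply: (dense_subgroup ST); first by split; [exact: swept0|exact: sweptB].
  by move=> s Ss; exact: swept_atom (Sp _ Ss) Ss.
have [g [b Sb Hb] gz] := D (v - u) e e0.
have [N [SN bN uN vN]] := HN b Sb.
have [[c fc rc] _] := Hb N SN bN u u (fold_id u0 uN).
exists c => //; apply: le_lt_trans (fold_lipschitz fc (fold_id v0 vN)) _.
by rewrite (_ : u + g - v = g - (v - u))//; ring.
Qed.

End reflection_in_a_strip.

Section steps_of_both_signs.

(** Sums of elements [- s], because the walk subtracts its increments. *)
Inductive semigroup (A : set R) : R -> Prop :=
| semigroup0 : semigroup A 0
| semigroupD s g : A s -> semigroup A g -> semigroup A (g - s).

Lemma semigroup_add A g h : semigroup A g -> semigroup A h -> semigroup A (g + h).
Proof.
move=> Ag Ah; elim: Ag => [|s g' As _ ih]; first by rewrite add0r.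
by rewrite addrAC; exact: semigroupD.
Qed.

Lemma semigroup_muln A s n : A s -> semigroup A (- s *+ n).
Proof.
move=> As; elim: n => [|n ih]; first by rewrite mulr0n; exact: semigroup0.
by rewrite mulrSr; exact: semigroupD.
Qed.

(* Pigeonhole on the multiples of [a] modulo [b]. *)
Lemma small_combination (a b e : R) : 0 < a -> 0 < b -> 0 < e ->
  exists j k : nat, [/\ (0 < j)%N, (0 < k)%N & `|a *+ j - b *+ k| < e].
Proof.
move=> a0 b0 e0.
(* The bound [d <= a] will force [k > 0]: without a multiple of [b] to subtract, the combination
   would be at least [a]. *)
have [d [d0 de da]] : exists d : R, [/\ 0 < d, d <= e & d <= a].
  by exists (Num.min e a); rewrite lt_min e0 a0 !ge_min !lexx orbT.
have Sd n : n.+1%:R * d = n%:R * d + d by rewrite -natr1 mulrDl mul1r.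
(* [Q] boxes of width [d] cover [[0, b[], so two of the residues of [Q + 1] multiples of [a] share a
   box. *)
pose Q := (Num.truncn (b / d)).+1.
have Qd : b < Q%:R * d by rewrite -ltr_pdivrMr//; exact: truncnS_gt.
pose q m : nat := Num.truncn (a *+ m / b).
pose r m : R := a *+ m - b *+ q m.
have am m : 0 <= a *+ m by rewrite mulrn_wge0// ltW.
have r0 m : 0 <= r m.
  rewrite subr_ge0 -(mulr_natl b) -ler_pdivlMr//; by rewrite truncn_le divr_ge0// ltW.
have rb m : r m < b.
  rewrite ltrBlDl -mulrSr -(mulr_natl b) -ltr_pdivrMr//; exact: truncnS_gt.
pose box (m : 'I_Q.+1) : 'I_Q := inord (Num.truncn (r m / d)).
have boxE m : nat_of_ord (box m) = Num.truncn (r m / d).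
  rewrite /box inordK//; rewrite ltnS.
  have : r m / d < Q%:R by rewrite ltr_pdivrMr//; exact: lt_trans Qd.
  move=> h; rewrite -ltnS -(ltr_nat R); apply: le_lt_trans h.
  by rewrite truncn_le divr_ge0// ltW.
have /injectivePn[m1 [m2 m12 bm]] : ~~ injectiveb box.
  by apply/injectiveP => /leq_card; rewrite !card_ord ltnn.
have close : `|r m1 - r m2| < d.
  have := congr1 (@nat_of_ord _) bm; rewrite !boxE => E.
  have h m : (Num.truncn (r m / d))%:R * d <= r m < (Num.truncn (r m / d))%:R * d + d.
    rewrite [X in _ < X](_ : _ = (Num.truncn (r m / d)).+1%:R * d); last by rewrite Sd.
    rewrite -ler_pdivlMr// -ltr_pdivrMr// truncnS_gt andbT.
    by rewrite truncn_le divr_ge0// ltW.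
  have := h m1; have := h m2; rewrite E => /andP[? ?] /andP[? ?].
  by rewrite ltr_norml; apply/andP; split; lra.
wlog lt12 : m1 m2 m12 bm close / (m1 < m2)%N.
  move=> W; case: (ltngtP m1 m2) => h; first exact: (W m1 m2 m12 bm close h).
    by apply: (W m2 m1 _ (esym bm) _ h); [rewrite eq_sym|rewrite distrC].
  by move/eqP : m12; case; exact: val_inj.
have key : `|a *+ (m2 - m1) - (b *+ q m2 - b *+ q m1)| < d.
  rewrite mulrnBr; last exact: ltnW.
  by rewrite distrC in close; rewrite (_ : _ - _ = r m2 - r m1)// /r; ring.
have q12 : (q m1 < q m2)%N.
  rewrite ltnNge; apply/negP => q21.
  have : b *+ q m2 <= b *+ q m1 by rewrite ler_wpMn2l// ltW.
  have : a <= a *+ (m2 - m1) by rewrite -{1}[a]mulr1n ler_wpMn2l ?subn_gt0// ltW.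
  move: key; rewrite ltr_norml => /andP[_]; lra.
exists (m2 - m1)%N, (q m2 - q m1)%N; rewrite !subn_gt0; split => //.
by rewrite (mulrnBr b (ltnW q12)); exact: lt_le_trans key de.
Qed.

(** If [r] has the sign opposite to [t] and [j |t|] is close to [k |r|], then [- (j - 1) t - k r] is
    close to [t]. *)
Lemma approached_opp s : S s -> (exists2 p, S p & 0 < p) -> (exists2 q, S q & q < 0) ->
  approached (semigroup S) s.
Proof.
have H t r : S t -> S r -> t * r < 0 -> approached (semigroup S) t.
  move=> St Sr tr e e0.
  have t0 : t != 0 by apply: contraTneq tr => ->; rewrite mul0r ltxx.
  have r0 : r != 0 by apply: contraTneq tr => ->; rewrite mulr0 ltxx.
  have [j [k [j0 k0 jk]]] : exists j k : nat,
      [/\ (0 < j)%N, (0 < k)%N & `| `|t| *+ j - `|r| *+ k| < e].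
    by apply: small_combination; rewrite ?normr_gt0.
  exists ((- t *+ j.-1) + (- r *+ k)).
    by apply: semigroup_add; exact: semigroup_muln.
  rewrite (_ : _ - t = - (t *+ j + r *+ k)); last first.
    by case: j j0 {jk} => // j _; rewrite mulrS /= !mulNrn; ring.
  rewrite normrN; case: (ltgtP t 0) t0 => // ts _.
    have rs : 0 < r by rewrite nmulr_rlt0 in tr.
    by move: jk; rewrite (ltr0_norm ts) (gtr0_norm rs) distrC mulNrn opprK addrC.
  have rs : r < 0 by rewrite pmulr_rlt0 in tr.
  by move: jk; rewrite (gtr0_norm ts) (ltr0_norm rs) mulNrn opprK.
move=> Ss [p Sp p0] [q Sq q0]; case: (ltgtP s 0) => s0.
- by apply: (H s p) => //; rewrite nmulr_rlt0.
- by apply: (H s q) => //; rewrite pmulr_rlt0.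
- by rewrite s0; apply: approached_in; exact: semigroup0.
Qed.

Lemma semigroup_dense : generated_closed_group S = setT ->
  (exists2 p, S p & 0 < p) -> (exists2 q, S q & q < 0) -> dense_set (semigroup S).
Proof.
move=> ST Sp Sq; apply: (generated_closed_group_dense ST); last first.
  by move=> s Ss; exact: approached_opp.
have add x y : approached (semigroup S) x -> approached (semigroup S) y ->
    approached (semigroup S) (x + y).
  move=> ax ay e e0; have e2 : 0 < e / 2 by rewrite divr_gt0.
  have [g Hg gx] := ax _ e2; have [h Hh hy] := ay _ e2.
  exists (g + h); first exact: semigroup_add.
  rewrite (splitr e) (_ : _ - _ = (g - x) + (h - y)); last by ring.
  by apply: le_lt_trans (ler_normD _ _) _; exact: ltrD.
split; first exact/approached_in/semigroup0.
(* For the opposite of [y]: if [g] approximates [y], then [- g] is a sum of elements of [S], each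
   approached by the semigroup. *)
move=> x y ax ay; apply: (add) => // e e0; have e2 : 0 < e / 2 by rewrite divr_gt0.
have [g Hg gy] := ay _ e2.
have [h Hh hg] : exists2 h, semigroup S h & `|h - - g| < e / 2.
  have : approached (semigroup S) (- g); last exact.
  elim: Hg => [|s g' Ss _ ih]; first by rewrite oppr0; exact/approached_in/semigroup0.
  rewrite (_ : - (g' - s) = - g' + s); last by ring.
  exact: (add _ _ ih (approached_opp Ss Sp Sq)).
exists h => //; rewrite (splitr e) (_ : h - - y = (h - - g) - (g - y)); last by ring.
by apply: le_lt_trans (ler_normB _ _) _; exact: ltrD.
Qed.

Lemma semigroup_split g : semigroup S g -> exists g1 g2,
  [/\ g = g1 + g2, semigroup (S `&` [set s | s <= 0]) g1 & semigroup (S `&` [set s | 0 <= s]) g2].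
Proof.
elim=> [|s h Ss _ [g1 [g2 [-> s1 s2]]]].
  by exists 0, 0; rewrite addr0; split => //; exact: semigroup0.
have [s0|s0] := leP s 0.
  by exists (g1 - s), g2; split => //; [ring|exact: semigroupD].
exists g1, (g2 - s); split => //; first by ring.
by apply: semigroupD => //; split => //; exact: ltW.
Qed.

Lemma reach_up u g : 0 <= u -> semigroup (S `&` [set s | s <= 0]) g -> reach u (u + g).
Proof.
move=> u0 sg; elim: sg u u0 => [u _|s h [Ss /= s0] _ ih u u0]; first by rewrite addr0; exact: reach_refl.
apply: (reach_step Ss); rewrite ger0_norm; last by lra.
by rewrite (_ : u + (h - s) = u - s + h); [apply: ih; lra|ring].
Qed.

Lemma semigroup_nonneg_le0 g : semigroup (S `&` [set s | 0 <= s]) g -> g <= 0.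
Proof. by elim=> // s h [_ /= s0] _ h0; lra. Qed.

Lemma reach_down u g : 0 <= u + g -> semigroup (S `&` [set s | 0 <= s]) g -> reach u (u + g).
Proof.
move=> + sg; elim: sg u => [u _|s h [Ss /= s0] sh ih u u0]; first by rewrite addr0; exact: reach_refl.
have h0 := semigroup_nonneg_le0 sh.
apply: (reach_step Ss); rewrite ger0_norm; last by lra.
by rewrite (_ : u + (h - s) = u - s + h); [apply: ih; lra|ring].
Qed.

(* Upward steps are taken first, so that no reflection occurs on the way. *)
Lemma reach_signed_steps u v e : generated_closed_group S = setT ->
  (exists2 p, S p & 0 < p) -> (exists2 q, S q & q < 0) -> 0 <= u -> 0 <= v -> 0 < e ->
  exists2 v', reach u v' & `|v' - v| < e.
Proof.
move=> ST Sp Sq u0 v0 e0; have e2 : 0 < e / 2 by rewrite divr_gt0.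
(* Aiming at [v + e / 2] with tolerance [e / 2] places the end point strictly between [v] and
   [v + e], so it is nonnegative and the downward steps are not reflected. *)
have [g Sg gz] := semigroup_dense ST Sp Sq (v + e / 2 - u) e2.
have [g1 [g2 [gE S1 S2]]] := semigroup_split Sg.
move: gz; rewrite ltr_norml => /andP[z1 z2].
exists (u + g1 + g2); last by rewrite ltr_norml; apply/andP; split; lra.
apply: reach_trans (reach_up u0 S1) _; apply: reach_down => //; lra.
Qed.

End steps_of_both_signs.

End deterministic_walk.

(** * Uniform hitting from reachability *)

Section irreducibility.
Context {R : realType}.
Variables (mu : probability R R) (Pi : probability (increments R) R).
Hypothesis fs : first_step mu Pi.
Local Open Scope ereal_scope.

Lemma int_ge_on (f : R -> \bar R) (A : set R) (p : \bar R) : nnm f -> measurable A -> 0 <= p ->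
  (forall y, A y -> p <= f y) -> p * mu A <= \int[mu]_y f y.
Proof.
move=> nf mA p0 pf.
have nI : nnm (EFin \o (\1_A : R -> R)).
  by apply: nnm_EFin => [|z]; [exact: measurable_indic|rewrite indicE ler0n].
apply: (@le_trans _ _ (\int[mu]_y (p * (\1_A y)%:E))).
  rewrite (intZ mu p0 nI) integral_indic// setIT; exact: lexx.
apply: int_le => //; first by apply: nnmM => //; exact: nnm_cst.
move=> y; rewrite indicE; have [Ay|Ay] := pselect (A y).
  by rewrite mem_set// mule1; exact: pf.
by rewrite memNset// mule0; exact: nf.2.
Qed.

Lemma measurable_rwalk_at (A : set R) n x : measurable A -> measurable [set w | A (rwalk x n w)].
Proof. by move=> mA; exact: (measurable_section (G := fun x w => A (rwalk x n w)) x (measurable_rwalk_in n mA)). Qed.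

Lemma measurable_ball_norm (z e : R) : measurable [set y : R | (`|y - z| < e)%R].
Proof. by apply: measurable_open_set; exact: open_ball_norm. Qed.

Lemma first_step_ge (A : set R) (B : set R) (u : R) n (p : \bar R) : measurable A -> measurable B ->
  0 <= p -> (forall y, A y -> p <= Pi [set w | B (rwalk `|u - y|%R n w)]) ->
  p * mu A <= Pi [set w | B (rwalk u n.+1 w)].
Proof.
move=> mA mB p0 H; rewrite (first_step_event fs); last exact: measurable_rwalk_at.
have nf : nnm (fun y : R => Pi [set w | B (rwalk `|u - y|%R n w)]).
  apply: (nnm_norm_sub (f := fun z => Pi [set w | B (rwalk z n w)])).
  exact: (nnm_xsection Pi (G := fun x w => B (rwalk x n w)) (measurable_rwalk_in n mB)).
apply: le_trans (int_ge_on nf mA p0 H) _; rewrite le_eqVlt; apply/orP; left; apply/eqP.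
by apply: eq_integral => y _; congr (Pi _); apply/funext => w; rewrite /mkset rwalk_scons.
Qed.

(** Increments within [r / 2] of [s] have positive probability, and by contractivity they displace
    the rest of the path by less than [r / 2]. *)
Lemma near_after_step u s v n (r : R) : supp mu s -> (0 < r)%R ->
  0 < Pi [set w | (`|rwalk `|u - s| n w - v| < r / 2)%R] ->
  0 < Pi [set w | (`|rwalk u n.+1 w - v| < r)%R].
Proof.
move=> Ss r0 H; have r2 : (0 < r / 2)%R by rewrite divr_gt0.
have := mule_gt0 H (supp_ball Ss r2).
move/lt_le_trans; apply.
apply: (first_step_ge (B := [set z | (`|z - v| < r)%R])) => //; try exact: measurable_ball_norm.
move=> y ys; apply: le_measure; rewrite ?inE.
- exact: (measurable_rwalk_at n _ (measurable_ball_norm v (r / 2))).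
- exact: (measurable_rwalk_at n _ (measurable_ball_norm v r)).
move=> w /= h; rewrite (splitr r) -(subrKA (rwalk `|u - s|%R n w)).
apply: le_lt_trans (ler_normD _ _) _; apply: ltrD h.
apply: le_lt_trans (rwalk_contract _ _ _ _) _.
apply: le_lt_trans (ler_dist_dist _ _) _.
rewrite (_ : u - y - (u - s) = s - y)%R; last by ring.
by rewrite distrC.
Qed.

Lemma reach_near u v : reach (supp mu) u v -> forall r : R, (0 < r)%R ->
  exists n, 0 < Pi [set w | (`|rwalk u n w - v| < r)%R].
Proof.
elim=> [{}u|{}u s {}v Ss _ ih] r r0.
  exists 0%N; rewrite (_ : [set w | _] = setT) ?probability_setT//.
  by apply/seteqP; split => // w _ /=; rewrite subrr normr0.
have [|n pn] := ih (r / 2)%R; first by rewrite divr_gt0.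
by exists n.+1; exact: near_after_step Ss r0 pn.
Qed.

Section uniform_hits.
Variable V : set R.
Hypothesis mV : measurable V.

Definition hit_uniformly (B : set R) := exists m (delta : R), (0 < delta)%R /\
  forall x, B x -> pavoid Pi V m x + delta%:E <= 1.

Lemma pavoid_anti m n x : (m <= n)%N -> pavoid Pi V n x <= pavoid Pi V m x.
Proof.
move=> mn; apply: le_measure; rewrite ?inE; [exact: measurable_avoid_at..|].
by move=> w a j /andP[j0 jm]; apply: a; rewrite j0 (leq_trans jm mn).
Qed.

Lemma hit_uniformlyU A B : hit_uniformly A -> hit_uniformly B -> hit_uniformly (A `|` B).
Proof.
move=> [m [a [a0 Ha]]] [n [b [b0 Hb]]]; exists (maxn m n), (Num.min a b).
split; first by rewrite lt_min a0.
move=> x [/Ha|/Hb]; apply: le_trans; apply: leeD.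
- exact/pavoid_anti/leq_maxl.
- by rewrite lee_fin ge_min lexx.
- exact/pavoid_anti/leq_maxr.
- by rewrite lee_fin ge_min lexx orbT.
Qed.

Lemma hit_uniformlyS A B : A `<=` B -> hit_uniformly B -> hit_uniformly A.
Proof. by move=> AB [m [d [d0 H]]]; exists m, d; split => // x /AB; exact: H. Qed.

Lemma hit_uniformly_bigcup (B : nat -> set R) n : (forall i, hit_uniformly (B i)) ->
  hit_uniformly [set x | exists2 i, (i < n)%N & B i x].
Proof.
move=> HB; elim: n => [|n ih].
  by exists 0%N, 1%R; split => // x [].
apply: hit_uniformlyS (hit_uniformlyU ih (HB n)) => x [i].
by rewrite ltnS leq_eqVlt => /predU1P[->|ni] Bi; [right|left; exists i].
Qed.

Lemma hit_at_time (B : set R) n (p : \bar R) : 0 < p ->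
  (forall x, B x -> p <= Pi [set w | V (rwalk x n.+1 w)]) -> hit_uniformly B.
Proof.
move=> p0 H.
have [e e0 ep] : exists2 e : R, (0 < e)%R & e%:E <= p.
  case: p p0 {H} => [e| |] // p0; first by exists e.
  by exists 1%R => //; rewrite leey.
exists n.+1, e; split => // x /H /(le_trans ep) ex.
apply: (@le_trans _ _ (pavoid Pi V n.+1 x + Pi [set w | V (rwalk x n.+1 w)])); first by rewrite leeD2l.
rewrite /pavoid -measureU.
- apply: probability_le1; apply: measurableU; first exact: measurable_avoid_at.
  exact: measurable_rwalk_at.
- exact: measurable_avoid_at.
- exact: measurable_rwalk_at.
- by rewrite -subset0 => w [a /= b]; apply: (a n.+1) b; rewrite ltn0Sn leqnn.
Qed.

End uniform_hits.

Section open_sets.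
Variables C V : set R.
Hypothesis C0 : forall x, C x -> (0 <= x)%R.
Hypothesis Cdown : forall x z : R, C x -> (0 <= z)%R -> (z <= x)%R -> C z.
Hypothesis irr : forall u v e : R, C u -> C v -> (0 < e)%R ->
  exists s v', [/\ supp mu s, reach (supp mu) `|u - s|%R v' & (`|v' - v| < e)%R].
Hypothesis oV : open V.
Hypothesis CV : V `&` C !=set0.

Lemma hit_open (K : nat) : hit_uniformly V [set x | C x /\ (x <= K%:R)%R].
Proof.
have mV := measurable_open_set oV.
have [v0 [Vv0 Cv0]] := CV; have [e e0 eV] := open_contains_ball oV Vv0.
(* Three errors, each at most [r], add up to less than [e]: moving the start to the end of its cell,
   ending near [v'], and [v'] differing from [v0]. *)
pose r := (e / 4)%R; have r0 : (0 < r)%R by rewrite divr_gt0.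
pose cell (i : nat) := [set x | C x /\ (i%:R * r <= x <= i%:R * r + r)%R].
have Hc i : hit_uniformly V (cell i).
  (* If the left end of a cell is not in [C], the cell is empty, since [C] is closed downwards in
     [[0, +oo[]. *)
  have [Ci|nCi] := pselect (C (i%:R * r)%R); last first.
    exists 0%N, 1%R; split => // x [Cx /andP[h _]]; exfalso; apply: nCi.
    by apply: Cdown h => //; rewrite mulr_ge0// ltW.
  have [s [v' [Ss rv vv]]] := irr Ci Cv0 r0.
  have [|n pn] := reach_near rv (r := (r / 2)%R); first by rewrite divr_gt0.
  have := near_after_step Ss r0 pn.
  move/(hit_at_time mV); apply => x [Cx /andP[x1 x2]].
  apply: le_measure; rewrite ?inE.
  - exact: (measurable_rwalk_at n.+1 _ (measurable_ball_norm v' r)).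
  - exact: (measurable_rwalk_at n.+1 _ mV).
  move=> w h; apply: eV; have h2 := rwalk_contract x (i%:R * r)%R n.+1 w.
  have h3 : (`|x - i%:R * r| <= r)%R by rewrite ler_norml; apply/andP; split; lra.
  move: h h2; rewrite [X in X -> _]/mkset; set a := rwalk _ _ _; set b := rwalk _ _ _ => h1 h2.
  apply: le_lt_trans (ler_distD a _ _) _.
  have h4 := ler_distD v' a v0; have h5 : (e = 4 * r)%R by rewrite /r; field.
  have h6 := le_trans h2 h3; rewrite h5; lra.
have HK := hit_uniformly_bigcup mV (Num.truncn (K%:R / r)%R).+1 Hc.
apply: (hit_uniformlyS _ HK) => x [Cx xK]; have x0 := C0 Cx.
have xr : (0 <= x / r)%R by rewrite divr_ge0// ltW.
exists (Num.truncn (x / r)%R).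
  by rewrite ltnS; apply: le_truncn; rewrite ler_pM2r// invr_gt0.
split => //; have /andP[t1 t2] := truncn_itv xr.
rewrite -ler_pdivlMr// t1/= -[X in (_ <= _ + X)%R]mul1r -mulrDl natr1 -ler_pdivrMr//.
exact: ltW.
Qed.

End open_sets.

Section lattice_sets.
Variables (x u : R) (C : set R).
Hypothesis CL : C `<=` lattice_states x.
Hypothesis irr : forall v, C v -> exists n, 0 < Pi [set w | rwalk v n.+1 w = u].

Lemma hit_point (K : nat) : hit_uniformly [set u] [set v | C v /\ (v <= K%:R)%R].
Proof.
have mV : measurable [set u] by exact: measurable_set1.
have H v : hit_uniformly [set u] [set z | C z /\ z = v].
  have [Cv|nCv] := pselect (C v); last first.
    by exists 0%N, 1%R; split => // z [Cz zv]; rewrite zv in Cz.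
  have [n pn] := irr Cv; apply: (hit_at_time mV pn) => z [_ ->]; exact: lexx.
(* States up to [K] have the form [k + x] or [k - x] with [|k| < M]; they are enumerated by
   [i = k + M < 2M]. *)
pose M := (Num.truncn (K%:R + `|x|)%R).+1.
have HM : (K%:R + `|x| < M%:R)%R by exact: truncnS_gt.
pose B (i : nat) := [set z | C z /\ z = i%:R - M%:R + x]%R `|`
  [set z | C z /\ z = i%:R - M%:R - x]%R.
have HK := hit_uniformly_bigcup mV (M + M) (fun i => hit_uniformlyU mV (H _) (H _) : hit_uniformly [set u] (B i)).
apply: (hit_uniformlyS _ HK) => v [Cv vK].
have [v0 [k kx]] := CL Cv.
have x1 := ler_norm x; have x2 := ler_norm (- x)%R; rewrite normrN in x2.
have kM : (`|k%:~R| < M%:R :> R)%R by rewrite ltr_norml; apply/andP; case: kx => kx; split; lra.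
have k1 : (- M%:Z < k < M%:Z)%R.
  by rewrite -ltr_norml -(ltr_int R) intr_norm.
exists (absz (k + M%:Z)%R); first by lia.
have -> : B (absz (k + M%:Z)%R) v = ((C v /\ v = k%:~R + x) \/ (C v /\ v = k%:~R - x))%R.
  rewrite /B /setU /mkset (_ : ((absz (k + M%:Z)%R)%:R - M%:R)%R = k%:~R :> R)//.
  rewrite natr_absz ger0_norm; last by lia.
  by rewrite intrD addrK.
by case: kx; [left|right].
Qed.

End lattice_sets.
End irreducibility.

(** * Moments and null sets in terms of the law *)

Section moments_of_the_law.
Context {R : realType} {d : measure_display} {T : measurableType d}.
Variables (P : probability T R) (Y : nat -> {RV P >-> R}) (mu : probability R R).
Hypothesis distY : common_distribution P Y mu.

Lemma expectation_law (g : R -> R) : measurable_fun [set: R] g -> (forall y, 0 <= g y) ->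
  ('E_P[(fun t => g (Y 0%N t))%R] = \int[mu]_y (g y)%:E)%E.
Proof.
move=> mg g0; have ng := nnm_EFin mg g0.
rewrite unlock; transitivity (\int[distribution P (Y 0%N)]_y (g y)%:E)%E.
  by rewrite (ge0_integral_distribution (Y 0%N) ng.1 ng.2).
by apply: eq_measure_integral => A mA _; exact: distY.
Qed.

Lemma expectation_pos : ('E_P[(Y 0%N)^\+] = \int[mu]_y (yp y)%:E)%E.
Proof. by rewrite -expectation_law; [|exact: measurable_yp|exact: yp_ge0]. Qed.

Lemma expectation_neg : ('E_P[(Y 0%N)^\-] = \int[mu]_y (yn y)%:E)%E.
Proof. by rewrite -expectation_law; [|exact: measurable_yn|exact: yn_ge0]. Qed.

Lemma expectation_sqrt (n : nat) : ('E_P[(fun t => Num.sqrt ((Y 0%N)^\+ t) ^+ n)%R] =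
  \int[mu]_y (Num.sqrt (yp y) ^+ n)%:E)%E.
Proof.
rewrite -(@expectation_law (fun y => Num.sqrt (yp y) ^+ n)) //.
  apply: measurable_funX; apply/measurable_EFinP; exact: (nnm_sqrt_yp (R := R)).1.
Qed.

Lemma positive_mass : (0 < \int[mu]_y (yp y)%:E)%E -> exists2 p, supp mu p & 0 < p.
Proof.
move=> i0; have oU : open [set y : R | 0 < y].
  exact: open_gt.
have [|p [p0 Sp]] := @open_charged R mu _ oU; last by exists p.
rewrite lt0e measure_ge0 andbT; apply/eqP => m0; move: i0.
rewrite (_ : (\int[mu]_y (yp y)%:E = \int[mu]_y (cst 0 y : \bar R))%E).
  by rewrite integral_cst// mul0e ltxx.
apply: ge0_ae_eq_integral => //; first exact: (nnm_yp (R := R)).1.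
  by move=> y _; rewrite lee_fin yp_ge0.
exists [set y | 0 < y]; split => //; first exact: measurable_open_set.
move=> y /= H; rewrite ltNge; apply/negP => y0; apply: H => _; by rewrite yp_eq0.
Qed.

End moments_of_the_law.

Section null_sets_of_the_law.
Context {R : realType}.
Variables (mu : probability R R).

Lemma lattice_null (E : set R) : supp mu `<=` integers -> measurable E ->
  (forall k : int, E k%:~R -> mu [set k%:~R] = 0%E) -> mu E = 0%E.
Proof.
move=> SZ mE E0.
(* The open interval []k, k + 1[], null because it misses the support. With the integers themselves,
   these intervals give a countable cover of the line. *)
pose gap (k : int) : set R := [set y | `|y - (k%:~R + 2^-1)| < 2^-1].
have gap0 k : mu (gap k) = 0%E.
  apply: open_null; first exact: open_ball_norm.
  rewrite -subset0 => y [/= h /SZ[l _ ly]]; move: h; rewrite -ly /gap /= ltr_norml => /andP[l1 l2].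
  have : (k%:~R < l%:~R :> R) by lra.
  have : (l%:~R < (k + 1)%:~R :> R) by rewrite intrD; lra.
  rewrite !ltr_int; lia.
pose F n := if @choice.unpickle (bool * int)%type n is Some p then
  (if p.1 then gap p.2 else [set p.2%:~R] `&` E) else set0.
apply: (@null_cover _ _ _ mu F) => //.
  move=> n; rewrite /F; case: (@choice.unpickle (bool * int)%type n) => [[[] k]|] /=.
  - by split; [apply: measurable_open_set; exact: open_ball_norm|exact: gap0].
  - split; first by apply: measurableI => //; exact: measurable_set1.
    have [Ek|nEk] := pselect (E k%:~R).
      by rewrite (_ : _ `&` _ = [set k%:~R]) ?E0//; apply/seteqP; split => [y []//|y ->].
    by rewrite (_ : _ `&` _ = set0) ?measure0// -subset0 => y [/= ->].
  - by rewrite measure0; split.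
move=> y Ey; have [yZ|yZ] := eqVneq y (Num.floor y)%:~R.
  exists (choice.pickle (false, Num.floor y)); [exact: I|rewrite /F choice.pickleK].
  by split.
exists (choice.pickle (true, Num.floor y)); [exact: I|rewrite /F choice.pickleK /gap /=].
have /andP[f1 f2] := floor_itv y.
have f3 : (Num.floor y)%:~R < y by rewrite lt_neqAle f1 andbT eq_sym.
by move: f2; rewrite intrD ltr_norml => f2; apply/andP; split; lra.
Qed.

Lemma lattice_atom : supp mu `<=` integers -> exists k : int, (0 < mu [set k%:~R])%E.
Proof.
move=> SZ; apply: contrapT => H.
have : mu setT = 0%E.
  apply: lattice_null => // k _; apply/eqP; rewrite eq_le measure_ge0 andbT leNgt.
  by apply/negP => k0; apply: H; exists k.
have : mu setT = 1%E by exact: probability_setT.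
by move=> -> /eqP; rewrite onee_eq0.
Qed.

End null_sets_of_the_law.

(** * The lattice and non-lattice cases *)

Section recurrence.
Context {R : realType} {d : measure_display} {T : measurableType d}.
Variables (P : probability T R) (Y : nat -> {RV P >-> R}) (mu : probability R R).
Hypothesis indepY : mutually_independent P Y.
Hypothesis distY : common_distribution P Y mu.

Let Pi := path_law Y.
Let fs : first_step mu Pi := path_law_first_step indepY distY.

Hypothesis noescape : forall x, Pi [set w | escape x w] = 0%E.

Lemma reflected_walk_path x n t : reflected_walk Y x n t = rwalk x n (path Y t).
Proof. by elim: n => //= n ->. Qed.

Lemma reflected_walk_law x n v :
  P [set t | reflected_walk Y x n t = v] = Pi [set w | rwalk x n w = v].
Proof.
rewrite /Pi path_lawE; congr (P _); apply/funext => t.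
by rewrite /mkset /preimage /= reflected_walk_path.
Qed.

Lemma negligible_path (G : set (increments R)) : Pi.-negligible G ->
  P.-negligible (path Y @^-1` G).
Proof.
move=> [H [mH H0 GH]]; exists (path Y @^-1` H); split.
- by rewrite -[X in measurable X]setTI; exact: (measurable_path Y measurableT mH).
- by rewrite -H0.
- by move=> t; exact: GH.
Qed.

Lemma lattice_recurrence x C : lattice_case mu -> essential_class P Y x C -> recurrent_on P Y C.
Proof.
move=> [SZ _] [CL Cess] u Cu.
have mC : measurable C.
  apply: countable_measurable; first by move=> y; exact: measurable_set1.
  pose f (p : bool * int) : R := if p.1 then p.2%:~R + x else p.2%:~R - x.
  have Cf : C `<=` f @` setT.
    by move=> v /CL[_ [k [->|->]]]; [exists (true, k)|exists (false, k)].
  exact: (sub_countable (card_le_trans (subset_card_le Cf) (card_image_le f setT)) (countableP _)).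
(* A single atom step is a path of positive probability, so the class is closed under it. *)
have step v k : C v -> (0 < mu [set k%:~R])%E -> C `|v - k%:~R|.
  move=> Cv k0; apply/(Cess v _ Cv).
    have [_ [l lv]] := CL _ Cv; split => //.
    case: (ger0P (v - k%:~R)) => _.
      by case: lv => ->; [exists (l - k); left|exists (l - k); right]; rewrite intrB; ring.
    by case: lv => ->; [exists (k - l); right|exists (k - l); left]; rewrite intrB; ring.
  exists 1%N; rewrite reflected_walk_law.
  have mS : measurable [set `|v - k%:~R|] by exact: measurable_set1.
  have mk : measurable [set k%:~R : R] by exact: measurable_set1.
  apply: lt_le_trans (first_step_ge fs (p := 1%E) (n := 0%N) (B := [set `|v - k%:~R|]) mk mS _ _) => //.
    by rewrite mul1e.
  move=> y /= ->; rewrite (_ : [set w | _] = setT) ?probability_setT//.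
  by apply/seteqP; split.
have [a a0] := lattice_atom SZ.
have mV : measurable [set u] by exact: measurable_set1.
have Cstep v : C v -> mu [set y | ~ C `|v - y|] = 0%E.
  move=> Cv; apply: lattice_null => //; first exact: measurable_step.
  move=> k nC; apply/eqP; rewrite eq_le measure_ge0 andbT leNgt; apply/negP => k0.
  exact: nC (step _ _ Cv k0).
(* [reachable] admits time 0, whereas a return needs a positive time; an atom step [a] is therefore
   made first, staying in the class. *)
have irr v : C v -> exists n, (0 < Pi [set w | rwalk v n.+1 w = u])%E.
  move=> Cv; have Ca := step _ _ Cv a0.
  have [n] := (Cess _ _ Ca (CL _ Cu)).2 Cu; rewrite reflected_walk_law => n0.
  exists n; have := mule_gt0 n0 a0; move/lt_le_trans; apply.
  have ma : measurable [set a%:~R : R] by exact: measurable_set1.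
  apply: (first_step_ge fs (B := [set u]) ma mV); first exact: measure_ge0.
  move=> y /= ->; exact: lexx.
have := never_hit_null fs noescape mC mV Cstep (hit_point CL irr) Cu.
set E := [set w | _] => E0.
have mE : measurable E by exact: (measurable_never mV u).
have mR : measurable (path Y @^-1` E).
  by rewrite -[X in measurable X]setTI; exact: (measurable_path Y measurableT mE).
rewrite (_ : [set t | _] = ~` (path Y @^-1` E)).
  by rewrite probability_setC// -path_lawE E0 sube0.
apply/seteqP; split => t /=.
  by move=> [n nu] H; apply: (H n.+1 isT); move: nu; rewrite -reflected_walk_path.
move=> /existsNP[[|n] /not_implyP[//= _ /contrapT h]]; exists n.
by move: h; rewrite -reflected_walk_path.
Qed.

Lemma itv_recurrence (C : set R) : measurable C -> (forall x, C x -> 0 <= x) ->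
  (forall x z : R, C x -> 0 <= z -> z <= x -> C z) ->
  (forall x, C x -> mu [set y | ~ C `|x - y|] = 0%E) ->
  (forall u v e : R, C u -> C v -> 0 < e ->
    exists s v', [/\ supp mu s, reach (supp mu) `|u - s| v' & `|v' - v| < e]) ->
  topologically_recurrent_on P Y C.
Proof.
move=> mC C0 Cdown Cstep irr x Cx.
(* The exceptional null set must serve all open sets at once, so it is assembled from the countably
   many rational intervals that meet [C]. *)
pose F n := if @choice.unpickle (rat * rat)%type n is Some p then
  [set t | rat_interval p `&` C !=set0 /\
    ~ forall m, exists2 j, (m < j)%N & rat_interval p (reflected_walk Y x j t)] else set0.
have NF n : P.-negligible (F n).
  rewrite /F; case: (@choice.unpickle (rat * rat)%type n) => [p|]; last exact: negligible_set0.
  have [pC|pC] := pselect (rat_interval p `&` C !=set0); last first.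
    by rewrite (_ : mkset _ = set0); [exact: negligible_set0|rewrite -subset0 => t []].
  have op := @open_rat_interval R p.
  have H := infinitely_many_hits fs noescape mC (measurable_open_set op) Cstep
    (hit_open fs C0 Cdown irr op pC) Cx.
  apply: negligibleS (negligible_path H) => t [_ nt] /= h; apply: nt => m.
  by have [j mj jp] := h m; exists j => //; rewrite reflected_walk_path.
apply: negligibleS (negligible_bigcup NF) => t /= /existsNP[U /not_implyP[oU /not_implyP[UC fin]]].
have [z [Uz Cz]] := UC; have [p pz pU] := rat_interval_in_open oU Uz.
exists (choice.pickle p); [exact: I|rewrite /F choice.pickleK]; split; first by exists z.
move=> H; apply: fin => /finite_seqP[s sE].
have [j mj jp] := H (\max_(i <- s) i)%N.
have : j \in s by have : [set` s] j; [rewrite -sE; exact: pU|].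
by move=> js; move: mj; rewrite ltnNge (@leq_bigmax_seq _ _ xpredT id j js isT).
Qed.

Lemma nonneg_increments : {ae P, forall t, 0 <= Y 0%N t} <-> mu [set y | y < 0] = 0%E.
Proof.
have mN : measurable [set y : R | y < 0] by apply: measurable_open_set; exact: open_lt.
have mY : measurable (Y 0%N @^-1` [set y : R | y < 0]).
  by rewrite -[X in measurable X]setTI; exact: measurable_funPT.
have <- : P (Y 0%N @^-1` [set y : R | y < 0]) = mu [set y | y < 0] := distY 0 mN.
split => [[B [mB B0 sB]]|H].
  apply/eqP; rewrite eq_le measure_ge0 andbT -B0; apply: le_measure; rewrite ?inE//.
  by move=> t /= Yt; apply: sB => /=; rewrite leNgt Yt.
exists (Y 0%N @^-1` [set y : R | y < 0]); split => //.
by move=> t /= /negP; rewrite -ltNge.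
Qed.

Lemma nonlattice_recurrence : nonlattice_case mu -> (exists2 p, supp mu p & 0 < p) ->
  topologically_recurrent_on P Y (nonlattice_class P Y mu).
Proof.
move=> ST Sp; have [p Sp' p0] := Sp; have S0 : supp mu !=set0 by exists p.
rewrite /nonlattice_class; case: asboolP => [[/nonneg_increments m0 Sb]|nb].
  have SN := sup_supp S0 Sb; set N := sup (supp mu) in SN *.
  have SleN s : supp mu s -> s <= N by move=> Ss; exact: ub_le_sup.
  have S_ge0 s : supp mu s -> 0 <= s.
    move=> Ss; rewrite leNgt; apply/negP => s0.
    by have := Ss _ (@open_lt R 0) s0; rewrite m0 ltxx.
  have N0 : 0 <= N := S_ge0 _ SN.
  apply: itv_recurrence => //.
  - by move=> x; rewrite /= in_itv => /andP[].
  - move=> x z; rewrite /= !in_itv /= => /andP[x0 xN] z0 zx; rewrite z0; exact: le_trans xN.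
  - move=> x Cx; have /andP[x0 xN] : 0 <= x <= N by move: Cx; rewrite /= in_itv.
    have mN : mu [set y | N < y] = 0%E.
      apply: open_null; first exact: open_gt.
      by rewrite -subset0 => y [/= + /SleN]; rewrite ltNge => /negP.
    have oN : open [set y : R | y < 0] := @open_lt R 0.
    have oP : open [set y : R | N < y] := @open_gt R N.
    apply: (@null_cover _ _ _ mu (fun n => if n is 0 then [set y | y < 0] else [set y | N < y])).
    + by case=> [|n]; split => //; exact: measurable_open_set.
    + exact: (measurable_step x (measurable_itv `[0, N])).
    + move=> y /= H; have [y0|y0] := ltP y 0; first by exists 0%N.
      exists 1%N => //=; rewrite ltNge; apply/negP => yN; apply: H.
      by rewrite in_itv /= normr_ge0 /= ler_norml; apply/andP; split; lra.
  - move=> u v e; rewrite /= !in_itv /= => /andP[u0 uN] /andP[v0 vN] e0.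
    (* The step [N] maps [[0, N]] into itself and serves as the required first step; the strip
       argument uses this same [N], the maximum of the support. *)
    have uN' : `|u - N| <= N by rewrite ler_norml; apply/andP; split; lra.
    have [v' r vv] := @reach_nonneg_steps _ (supp mu) `|u - N| v e ST S_ge0 S0 (normr_ge0 _) v0
      (fun b Sb' => ex_intro _ N (And4 SN (SleN b Sb') uN' vN)) e0.
    by exists N, v'.
have irr u v e : 0 <= u -> 0 <= v -> 0 < e ->
    exists2 v', reach (supp mu) u v' & `|v' - v| < e.
  move=> u0 v0 e0; have [Sn|Sn] := pselect (exists2 q, supp mu q & q < 0).
    exact: reach_signed_steps.
  have S_ge0 s : supp mu s -> 0 <= s.
    by move=> Ss; rewrite leNgt; apply/negP => s0; apply: Sn; exists s.
  (* If no element of the support exceeded [b], [u] and [v], the support would be bounded and the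
     increments nonnegative, which is the other case. *)
  apply: reach_nonneg_steps => // b Sb; apply: contrapT => H; apply: nb; split.
    apply/nonneg_increments; apply: open_null; first exact: open_lt.
    by rewrite -subset0 => y [/= + /S_ge0]; rewrite ltNge => /negP.
  exists (Num.max b (Num.max u v)) => s Ss; rewrite leNgt; apply/negP => Hs; apply: H.
  by exists s; move: Hs; rewrite !gt_max => /andP[/ltW ? /andP[/ltW ? /ltW ?]].
apply: itv_recurrence => //.
- by move=> x; rewrite /= in_itv /= andbT.
- by move=> x z; rewrite /= !in_itv /= !andbT.
- move=> x _; rewrite (_ : mkset _ = set0) ?measure0// -subset0 => y /=.
  by rewrite in_itv /= normr_ge0.
- move=> u v e; rewrite /= !in_itv /= !andbT => u0 v0 e0.
  by have [v' r vv] := irr `|u - p| v e (normr_ge0 _) v0 e0; exists p, v'.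
Qed.

End recurrence.

Unset Implicit Arguments.
Set Strict Implicit.
Set Printing Implicit Defensive.

Theorem mainTheorem7 (R : realType) (d : measure_display)
    (T : measurableType d) (P : probability T R)
    (Y : nat -> {RV P >-> R}) (mu : probability R R)
    (indepY : mutually_independent P Y)
    (distY : common_distribution P Y mu)
    (moments :
      (('E_P[(Y 0%N)^\-] < 'E_P[(Y 0%N)^\+])%E /\
       ('E_P[(fun t => Num.sqrt ((Y 0%N)^\+ t))%R] < +oo)%E)
      \/
      [/\ (0 < 'E_P[(Y 0%N)^\-])%E,
          ('E_P[(Y 0%N)^\-] = 'E_P[(Y 0%N)^\+])%E &
          ('E_P[(fun t => Num.sqrt ((Y 0%N)^\+ t) ^+ 3)%R] < +oo)%E]) :
  (lattice_case mu ->
    forall x : R, 0 <= x ->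
    forall C : set R, essential_class P Y x C -> recurrent_on P Y C) /\
  (nonlattice_case mu ->
    topologically_recurrent_on P Y (nonlattice_class P Y mu)).
Proof.
have fs := path_law_first_step indepY distY.
have [[kpos ksqrt] ipos] : (ladder_law (path_law Y) [set h | h <= 0] = 0%E /\
    (\int[ladder_law (path_law Y)]_h (Num.sqrt h)%:E < +oo)%E) /\
    (0 < \int[mu]_y (yp y)%:E)%E.
  move: moments; rewrite (expectation_neg distY) (expectation_pos distY) => -[[h1 h2]|[h1 h2 h3]].
    split; last by apply: le_lt_trans h1; exact: (int_ge0 mu (nnm_yn (R := R))).
    apply: (positive_drift_ladder fs h1).
    (* The power with exponent 1 is convertible to its base, so the general formula covers the
       square root. *)
    have := expectation_sqrt distY 1; rewrite -[X in _ = X -> _]/(\int[mu]_y (Num.sqrt (yp y))%:E)%E.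
    by move=> <-; exact: h2.
  split; last by rewrite -h2.
  by apply: (zero_drift_ladder fs h1 h2); rewrite -(expectation_sqrt distY 3).
have noescape := escape_null fs kpos ksqrt.
split=> [lat x _ C|nl]; first exact: (lattice_recurrence indepY distY noescape).
exact: (nonlattice_recurrence indepY distY noescape nl (positive_mass ipos)).
Qed.
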